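(* Let $N\ge1$ be an integer, $2_*:=2+\frac4{N+1}$, let $I$ be a segment of length $\pi$, and let $S_1$ be the unit circle. Then $$\lim_{B\to+\infty}K_{\mathbb R^N\times S_1,2_*,B}=K_{\mathbb R^{N+1},2_*}\qquad\text{and}\qquad\lim_{B\to+\infty}K_{\mathbb R^N\times I,2_*,B}=K_{\mathbb R^{N+1}_+,2_*}=2^{\frac2{N+1}}K_{\mathbb R^{N+1},2_*}.$$
   Context: For $\mathcal G=I$ (length $l(I)=\pi$) or $\mathcal G=S_1$ (length $l(S_1)=2\pi$, identified with $[-\pi,\pi]$ with endpoints glued), $H^1(\mathbb R^N\times I)$ is the usual Sobolev space on $\mathbb R^N\times[0,\pi]\subset\mathbb R^{N+1}$ and $H^1(\mathbb R^N\times S_1)$ is the usual Sobolev space on the cylinder, i.e. the set of $u\in H^1(\mathbb R^N\times[-\pi,\pi])$ with equal traces on $\mathbb R^N\times\{-\pi\}$ and $\mathbb R^N\times\{\pi\}$. Functions are real-valued. For $B>0$, $$K_{\mathbb R^N\times\mathcal G,2_*,B}=\sup_{u\in H^1(\mathbb R^N\times\mathcal G)\setminus\{0\}}\frac{\|u\|_{2_*}^{2_*}}{\big(\|\nabla_{x,y}u\|_2^2+\frac{B}{l(\mathcal G)^2}\|u\|_2^2\big)\|u\|_2^{2_*-2}},$$ where norms are over $\mathbb R^N\times\mathcal G$ and $\|\nabla_{x,y}u\|_2^2=\|\nabla_xu\|_2^2+\|\partial_yu\|_2^2$. For $\Omega=\mathbb R^{N+1}$ or $\Omega=\mathbb R^{N+1}_+=\mathbb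 R^N\times[0,+\infty)$, $$K_{\Omega,2_*}=\sup_{u\in H^1(\Omega)\setminus\{0\}}\frac{\|u\|_{L^{2_*}(\Omega)}^{2_*}}{\|\nabla u\|_{L^2(\Omega)}^{2}\|u\|_{L^2(\Omega)}^{2_*-2}}.$$ *)

(* Defs.v *)
From HB Require Import structures.
From mathcomp Require Import all_boot all_order all_algebra.
From mathcomp Require Import all_classical all_reals all_analysis.

Set Implicit Arguments.
Unset Strict Implicit.
Unset Printing Implicit Defensive.
Import Order.TTheory GRing.Theory Num.Theory.
Import numFieldNormedType.Exports.

Local Open Scope classical_set_scope.
Local Open Scope ring_scope.

(* The product sigma-algebra on R^n, generated by the coordinates; it is the
   Borel sigma-algebra. *)
Section measurable_rV.
Context {R : realType} {n : nat}.

Definition rV_coord (i : 'I_n) (x : 'rV[R]_n) : R := x ord0 i.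

Let rV_set0 : g_sigma_preimage rV_coord set0.
Proof. exact: sigma_algebra0. Qed.

Let rV_setC A : g_sigma_preimage rV_coord A -> g_sigma_preimage rV_coord (~` A).
Proof. exact: sigma_algebraC. Qed.

Let rV_bigcup (F : _^nat) : (forall i, g_sigma_preimage rV_coord (F i)) ->
  g_sigma_preimage rV_coord (\bigcup_i (F i)).
Proof. exact: sigma_algebra_bigcup. Qed.

HB.instance Definition _ := @isMeasurable.Build default_measure_display
  'rV[R]_n (g_sigma_preimage rV_coord) rV_set0 rV_setC rV_bigcup.

End measurable_rV.

Section lebesgue_rV.
Context {R : realType}.
(* [lebesgue_measure] lives on [measurableTypeR R], a copy of [R]. *)
Local Notation RR := (measurableTypeR R).

Lemma measurable_rV_coord n (i : 'I_n) :
  measurable_fun [set: 'rV[R]_n] (fun x : 'rV[R]_n => x ord0 i).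
Proof.
move=> _ Y mY; rewrite setTI; apply: sub_sigma_algebra => /=.
rewrite -bigcup_seq/=; exists i => /=; first by rewrite mem_index_enum.
by exists Y => //; rewrite setTI.
Qed.

Lemma measurable_fun_rV d (T : measurableType d) n (f : T -> 'rV[R]_n) :
  (forall i, measurable_fun [set: T] (fun t => f t ord0 i)) ->
  measurable_fun [set: T] f.
Proof.
move=> mf; suff sub : g_sigma_preimage (fun i t => rV_coord i (f t)) `<=`
    @measurable _ T.
  move=> _ A mA; rewrite setTI; apply: sub.
  rewrite (@g_sigma_preimage_comp _ R n 'rV[R]_n rV_coord T f).
  by exists A => //; rewrite setTI.
apply: smallest_sub; first exact: sigma_algebra_measurable.
case: n => [|n] in f mf *; first by rewrite big_ord0.
rewrite -bigcup_mkord_ord; apply: bigcup_sub => i Ii.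
by move=> A [B mB <-]; exact: mf.
Qed.

Definition rV_cons n (z : RR * 'rV[R]_n) : 'rV[R]_n.+1 :=
  \row_i (if unlift ord0 i is Some j then z.2 ord0 j else z.1).

Definition rV_uncons n (x : 'rV[R]_n.+1) : RR * 'rV[R]_n :=
  (x ord0 ord0, \row_j x ord0 (lift ord0 j)).

Lemma rV_consK n : cancel (@rV_cons n) (@rV_uncons n).
Proof.
case=> t x; rewrite /rV_cons /rV_uncons mxE unlift_none; congr pair.
by apply/rowP => j; rewrite !mxE liftK.
Qed.

Lemma measurable_rV_cons n : measurable_fun [set: RR * 'rV[R]_n] (@rV_cons n).
Proof.
apply: measurable_fun_rV => i; under eq_fun do rewrite mxE.
case: (unlift ord0 i) => [j|]; last exact: measurable_fst.
exact: (measurableT_comp (measurable_rV_coord j) measurable_snd).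
Qed.

HB.instance Definition _ n := isMeasurableFun.Build _ _ _ _ (@rV_cons n)
  (@measurable_rV_cons n).

Lemma measurable_rV_uncons n :
  measurable_fun [set: 'rV[R]_n.+1] (@rV_uncons n).
Proof.
apply: measurable_fun_pair; first exact: measurable_rV_coord.
apply: measurable_fun_rV => i; under eq_fun do rewrite /= mxE.
exact: measurable_rV_coord.
Qed.

Section step.
Variables (n : nat) (m : {sigma_finite_measure set 'rV[R]_n -> \bar R}).

Definition lebesgue_rV_step : set 'rV[R]_n.+1 -> \bar R :=
  pushforward (@lebesgue_measure R \x m)%E (@rV_cons n).

Let step0 : lebesgue_rV_step set0 = 0%E.
Proof. exact: measure0. Qed.

Let step_ge0 A : (0 <= lebesgue_rV_step A)%E.
Proof. exact: measure_ge0. Qed.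

Let step_sigma_additive : semi_sigma_additive lebesgue_rV_step.
Proof. exact: measure_semi_sigma_additive. Qed.

HB.instance Definition _ := isMeasure.Build _ _ _ lebesgue_rV_step
  step0 step_ge0 step_sigma_additive.

Let step_sigma_finite : sigma_finite [set: 'rV[R]_n.+1] lebesgue_rV_step.
Proof.
have /sigma_finiteP[F [TF ndF Foo]] := sigma_finiteT (@lebesgue_measure R).
have /sigma_finiteP[G [TG ndG Goo]] := sigma_finiteT m.
exists (fun k => @rV_uncons n @^-1` (F k `*` G k)).
  rewrite -preimage_bigcup (_ : \bigcup_k (F k `*` G k) = setT)//.
  rewrite -setXTT TF TG predeqE => -[x y]; split.
    by move=> [k _ []/= ? ?]; split; exists k.
  move=> [/= [k _ Fkx] [l _ Gly]]; exists (maxn k l) => //; split.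
  - by move: x Fkx; exact/subsetPset/ndF/leq_maxl.
  - by move: y Gly; exact/subsetPset/ndG/leq_maxr.
move=> k; have [mF Fk] := Foo k; have [mG Gk] := Goo k; split.
  by rewrite -[X in measurable X]setTI; apply: measurable_rV_uncons => //;
    exact: measurableX.
rewrite /lebesgue_rV_step /pushforward -comp_preimage.
rewrite (_ : _ \o _ = id) ?preimage_id; last exact/funext/rV_consK.
by rewrite product_measure1E// lte_mul_pinfty// ge0_fin_numE.
Qed.

HB.instance Definition _ := Measure_isSigmaFinite.Build _ _ _
  lebesgue_rV_step step_sigma_finite.

End step.

(* Lebesgue measure on R^n, as the n-fold product of Lebesgue measure on R. *)
Fixpoint lebesgue_rV n : {sigma_finite_measure set 'rV[R]_n -> \bar R} :=
  if n is n'.+1 then lebesgue_rV_step (lebesgue_rV n')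
  else dirac (0 : 'rV[R]_0).

End lebesgue_rV.

Section sobolev.
Variables (R : realType) (N : nat).

(* R^(N+1) = R^N x R, with points (x, y). *)
Local Notation space := ('rV[R]_N * measurableTypeR R)%type.

Definition vol : {measure set space -> \bar R} :=
  (lebesgue_rV N \x @lebesgue_measure R)%E.

Definition dir_x (i : 'I_N) : space := (delta_mx ord0 i, 0).
Definition dir_y : space := (0, 1).

(* On a finite-dimensional space, a function is of class C^(k+1) if and only if
   it is differentiable and all its directional derivatives are of class C^k. *)
Fixpoint class_C (k : nat) (phi : space -> R) : Prop :=
  if k is k'.+1 then
    (forall z, differentiable phi z) /\
    (forall v, class_C k' (fun z => 'D_v phi z))
  else continuous phi.

(* The space C_c^oo(Om). *)
Definition test_function (Om : set space) (phi : space -> R) : Prop :=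
  (forall k, class_C k phi) /\
  exists K, [/\ compact K, K `<=` Om & forall z, ~ K z -> phi z = 0].

(* A function on a domain [Om] is represented by a function on the whole space
   of which only the values on [Om] matter: [u \_ Om] is [u] on [Om] and 0
   elsewhere. *)
Definition norm_L (Om : set space) (p : R) (u : space -> R) : \bar R :=
  'N[vol]_(p%:E)[EFin \o (u \_ Om)].

Definition in_L2 (Om : set space) (u : space -> R) : Prop :=
  u \_ Om \in Lfun vol 2%:E.

Definition weak_derivative (Om : set space) (v : space) (u g : space -> R) :
    Prop :=
  forall phi, test_function Om phi ->
    \int[vol]_(z in Om) (u z * 'D_v phi z) =
    - \int[vol]_(z in Om) (g z * phi z).

Record gradient := Gradient {
  grad_x : 'I_N -> space -> R ;
  grad_y : space -> R }.

(* [u] belongs to H^1(Om), and [Du] is its weak gradient. The latter is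
   determined by [u] up to a null set of [Om]. *)
Definition in_H1 (Om : set space) (u : space -> R) (Du : gradient) : Prop :=
  [/\ in_L2 Om u,
      (forall i, in_L2 Om (grad_x Du i)),
      in_L2 Om (grad_y Du),
      (forall i, weak_derivative Om (dir_x i) u (grad_x Du i)) &
      weak_derivative Om dir_y u (grad_y Du)].

Definition nonzero (Om : set space) (u : space -> R) : Prop :=
  ~ {ae vol, forall z, Om z -> u z = 0}.

Definition whole_space : set space := setT.
Definition half_space : set space := [set z | 0 < z.2].
Definition strip (a b : R) : set space := [set z | a < z.2 < b].

(* [ga] and [gb] are the traces on y = a and y = b of the function [u] of
   H^1(strip a b) with weak gradient [Du]: they are the elements of L^2(R^N)
   for which the Gauss-Green formula holds with test functions that need not
   vanish on the boundary, and this determines both of them. *)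
Definition traces (a b : R) (u : space -> R) (Du : gradient)
    (ga gb : 'rV[R]_N -> R) : Prop :=
  [/\ ga \in Lfun (lebesgue_rV N) 2%:E, gb \in Lfun (lebesgue_rV N) 2%:E &
      forall phi, test_function whole_space phi ->
        \int[vol]_(z in strip a b) (u z * 'D_dir_y phi z + grad_y Du z * phi z)
        = \int[lebesgue_rV N]_x (gb x * phi (x, b) - ga x * phi (x, a))].

(* H^1 of the cylinder obtained by gluing y = a and y = b. *)
Definition in_H1_cylinder (a b : R) (u : space -> R) (Du : gradient) : Prop :=
  in_H1 (strip a b) u Du /\ exists g, traces a b u Du g g.

Definition crit_exp : R := 2 + 4 / N.+1%:R.

Local Open Scope ereal_scope.

Definition norm_grad_sq (Om : set space) (Du : gradient) : \bar R :=
  (\sum_(i < N) norm_L Om 2 (grad_x Du i) `^ 2) + norm_L Om 2 (grad_y Du) `^ 2.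

Definition GN_quotient (Om : set space) (energy : \bar R) (u : space -> R) :
    \bar R :=
  norm_L Om crit_exp u `^ crit_exp /
  (energy * norm_L Om 2 u `^ (crit_exp - 2)).

Definition K_domain (Om : set space) : \bar R :=
  ereal_sup [set q | exists u Du, [/\ in_H1 Om u Du, nonzero Om u &
    q = GN_quotient Om (norm_grad_sq Om Du) u]].

(* The energy with parameter [B] on the strip a < y < b, of width l = b - a. *)
Definition energy_strip (a b B : R) (u : space -> R) (Du : gradient) : \bar R :=
  norm_grad_sq (strip a b) Du +
  (B / (b - a) ^+ 2)%:E * norm_L (strip a b) 2 u `^ 2.

Definition K_segment (a b B : R) : \bar R :=
  ereal_sup [set q | exists u Du, [/\ in_H1 (strip a b) u Du,
    nonzero (strip a b) u &
    q = GN_quotient (strip a b) (energy_strip a b B u Du) u]].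

Definition K_cylinder (a b B : R) : \bar R :=
  ereal_sup [set q | exists u Du, [/\ in_H1_cylinder a b u Du,
    nonzero (strip a b) u &
    q = GN_quotient (strip a b) (energy_strip a b B u Du) u]].

End sobolev.

Arguments whole_space : clear implicits.
Arguments half_space : clear implicits.

(* Main.v *)
(* For all large [B] the constants of the strips are equal to those of their
   blow-ups, so the limits are those of eventually constant functions.

   Blow-up. If u is in H^1 of the whole space or of the half-space, then the
   functions cos(y/2) u(n z) are admissible on the strip and their quotients tend
   to the quotient of u, because the mass is of lower order than the energy
   under concentration.

   Localization. Since cos(y/2)^2 + sin(y/2)^2 = 1, the energies of cos(y/2) u and
   sin(y/2) u add up to that of u plus a quarter of its mass. The first function
   vanishes at y = pi (and at y = -pi), the second one at y = 0; after a
   translation of the cylinder or a reflection of the segment, both extend by 0 to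
   the whole space or to the half-space. The convexity inequality
   (x + y)^q <= t^(1-q) x^q + (1-t)^(1-q) y^q, with q half the critical exponent and
   t the share of the first function in the mass, adds up the two inequalities so
   obtained without any loss in the constant.

   Half-space. Even reflection of a function on the half-space gives one
   inequality. For the other one, a function on the whole space is cut along the
   hyperplane that divides its mass into two equal parts. *)

(* The obstacle is the boundary. H^1 is defined by test functions with compact support in the open
   domain, whereas extending a function by 0 or reflecting it leads to test functions that do not
   vanish near the boundary. [wd_boundary] bridges this gap: the test function is multiplied by a
   smooth cutoff whose derivative is of size 1/rho, where rho vanishes on the boundary, and a factor
   of size rho in the test function absorbs this derivative. That factor is cos(y/2) at y = pi and y
   = -pi, the test function itself at the boundary of the half-space, and the odd difference phi(x,
   y) - phi(x, -y) in the case of the even reflection.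

   The half angle fixes the threshold for B: the squared derivatives of cos(y/2) and sin(y/2) add up
   to 1/4, which the mass term pays for once B / l^2 >= 1/4, l being the width of the strip. Every
   comparison of constants is made through their real upper bounds k, so that infinite values are
   covered as well. *)
Require Import Defs.
From mathcomp Require Import all_boot all_order all_algebra.
From mathcomp Require Import all_classical all_reals all_analysis.
From mathcomp Require Import measurable_realfun.
From mathcomp Require Import ring lra.
Import Order.TTheory GRing.Theory Num.Theory.
Import numFieldNormedType.Exports.
Local Open Scope classical_set_scope.
Local Open Scope ring_scope.

Set Implicit Arguments.
Unset Strict Implicit.
Unset Printing Implicit Defensive.

(** * Smooth functions of one variable *)

Section smooth1.
Context {R : realType}.
Implicit Types f g : R -> R.
Local Notation D1 := (@derive1 R R).

(** One-variable counterpart of [class_C]. The multipliers of the proof (cutoffs, half-angle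
    functions, constants) are functions of y alone, and [smooth_class_C] lifts them to the whole
    space. *)
Fixpoint smooth_upto (k : nat) f : Prop :=
  if k is k'.+1 then (forall t, derivable f t 1) /\ smooth_upto k' (D1 f)
  else continuous f.

Definition smooth f := forall k, smooth_upto k f.

Lemma smooth_uptoW k f : smooth_upto k.+1 f -> smooth_upto k f.
Proof.
elim: k f => [f [df _]|k IH f [df sf]]; last by split=> //; exact: IH.
by move=> t; apply: differentiable_continuous; exact/derivable1_diffP.
Qed.

Lemma smooth_derivable f : smooth f -> forall t, derivable f t 1.
Proof. by move=> /(_ 1%N) []. Qed.

Lemma smooth_derive f : smooth f -> smooth (D1 f).
Proof. by move=> sf k; have [] := sf k.+1. Qed.

Lemma smooth_continuous f : smooth f -> continuous f.
Proof. by move=> /(_ 0%N). Qed.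

Lemma smooth_upto_cst k (c : R) : smooth_upto k (fun=> c).
Proof.
elim: k c => [c|k IH c]; first exact: cst_continuous.
split=> [t|]; first exact: derivable_cst.
rewrite (_ : D1 _ = fun=> 0) //; apply/funext => t; exact: derive1_cst.
Qed.

Lemma smooth_upto_id k : smooth_upto k id.
Proof.
case: k => [|k]; first by move=> t; exact: cvg_id.
split=> [t|]; first exact: derivable_id.
rewrite (_ : D1 _ = fun=> 1); first exact: smooth_upto_cst.
by apply/funext => t; rewrite derive1_id.
Qed.

Lemma smooth_uptoD k f g : smooth_upto k f -> smooth_upto k g ->
  smooth_upto k (fun t => f t + g t).
Proof.
elim: k f g => [f g cf cg t|k IH f g [df sf] [dg sg]].
  by apply: cvgD; [exact: cf|exact: cg].
split=> [t|]; first exact: derivableD.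
rewrite (_ : D1 _ = fun t => D1 f t + D1 g t); first exact: IH.
by apply/funext => t; rewrite !derive1E deriveD.
Qed.

Lemma smooth_uptoM k f g : smooth_upto k f -> smooth_upto k g ->
  smooth_upto k (fun t => f t * g t).
Proof.
elim: k f g => [f g cf cg t|k IH f g sf sg].
  by apply: cvgM; [exact: cf|exact: cg].
have sf' := smooth_uptoW sf; have sg' := smooth_uptoW sg.
case: sf sg => [df sf] [dg sg].
split=> [t|]; first exact: derivableM.
rewrite (_ : D1 _ = fun t => f t * D1 g t + g t * D1 f t).
  by apply: smooth_uptoD; apply: IH.
by apply/funext => t; rewrite !derive1E deriveM.
Qed.

Lemma smooth_cst (c : R) : smooth (fun=> c).
Proof. by move=> k; exact: smooth_upto_cst. Qed.

Lemma smooth_id : smooth id.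
Proof. by move=> k; exact: smooth_upto_id. Qed.

Lemma smoothD f g : smooth f -> smooth g -> smooth (fun t => f t + g t).
Proof. by move=> sf sg k; exact: smooth_uptoD. Qed.

Lemma smoothM f g : smooth f -> smooth g -> smooth (fun t => f t * g t).
Proof. by move=> sf sg k; exact: smooth_uptoM. Qed.

Lemma smooth_affine a b : smooth (fun t => a * t + b).
Proof.
apply: smoothD; last exact: smooth_cst.
by apply: smoothM; [exact: smooth_cst|exact: smooth_id].
Qed.

Lemma smooth_comp f g : smooth g -> smooth f -> smooth (fun t => g (f t)).
Proof.
move=> sg sf k; elim: k g sg => [|k IH] g sg.
  move=> t; apply: (@continuous_comp _ _ _ f g).
    exact: smooth_continuous.
  exact: smooth_continuous.
split=> [t|].
  by apply/derivable1_diffP; apply: (@differentiable_comp _ _ _ _ f g);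
    apply/derivable1_diffP; exact: smooth_derivable.
rewrite (_ : D1 _ = fun t => D1 g (f t) * D1 f t).
  apply: smooth_uptoM; first exact: IH (smooth_derive sg).
  exact: smooth_derive.
by apply/funext => t; rewrite (@derive1_comp _ f g)//; exact: smooth_derivable.
Qed.

(** The two functions are treated together because differentiation exchanges them up to sign. *)
Lemma smooth_cos_sin : smooth (@cos R) /\ smooth (@sin R).
Proof.
have H k : smooth_upto k (@cos R) /\ smooth_upto k (@sin R).
  elim: k => [|k [IHc IHs]].
    by split; [exact: continuous_cos|exact: continuous_sin].
  split; split=> [t|].
  - by have [] := is_derive_cos t.
  - rewrite (_ : D1 _ = fun t => (-1) * sin t).
      by apply: smooth_uptoM => //; exact: smooth_upto_cst.
    by apply/funext => t; rewrite derive1E derive_val mulN1r.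
  - by have [] := is_derive_sin t.
  - by rewrite (_ : D1 _ = cos) //; apply/funext => t; rewrite derive1E derive_val.
by split=> k; have [] := H k.
Qed.

Lemma smooth_cos : smooth (@cos R). Proof. exact: smooth_cos_sin.1. Qed.

Lemma smooth_sin : smooth (@sin R). Proof. exact: smooth_cos_sin.2. Qed.

(* The functions t^-m exp(-1/t), extended by 0 to t <= 0; their derivatives are
   linear combinations of functions of the same kind. *)
Definition flat (m : nat) (t : R) : R :=
  if 0 < t then t^-1 ^+ m * expR (- t^-1) else 0.

Lemma flat_ge0 m t : 0 <= flat m t.
Proof.
rewrite /flat; case: ifP => // t0.
by rewrite mulr_ge0 ?expR_ge0// exprn_ge0// invr_ge0 ltW.
Qed.

Lemma flat_le0 m t : t <= 0 -> flat m t = 0.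
Proof. by rewrite /flat ltNge => ->. Qed.

(** The left side is m! times one term of the exponential series. With x = 1/t this bounds t^-m
    exp(-1/t) by m!, uniformly in t > 0. *)
Lemma expR_ge_monomial (m : nat) (x : R) : 0 <= x -> x ^+ m <= m`!%:R * expR x.
Proof.
move=> x0; rewrite -ler_pdivrMl ?ltr0n ?fact_gt0// mulrC.
case: m => [|m]; first by rewrite expr0 fact0 divr1 -expR0 ler_expR.
by apply: le_trans (expR_ge1Dxn m x0); rewrite lerDr.
Qed.

Lemma flat_le_fact m t : flat m t <= m`!%:R.
Proof.
rewrite /flat; case: ifP => // t0.
by rewrite expRN ler_pdivrMr ?expR_gt0// expR_ge_monomial// invr_ge0 ltW.
Qed.

Lemma flatS m t : 0 < t -> flat m.+1 t = t^-1 * flat m t.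
Proof. by move=> t0; rewrite /flat t0 exprS mulrA. Qed.

Lemma flatE m t : 0 <= t -> flat m t = t * flat m.+1 t.
Proof.
rewrite le_eqVlt => /orP[/eqP<-|t0]; first by rewrite mul0r flat_le0.
by rewrite flatS// mulrA divff ?mul1r// gt_eqF.
Qed.

Lemma flat_le_linear m t : flat m t <= m.+1`!%:R * `|t|.
Proof.
have [t0|t0] := leP t 0; first by rewrite flat_le0// mulr_ge0.
rewrite (flatE _ (ltW t0)) gtr0_norm// mulrC.
by rewrite ler_pM2r//; exact: flat_le_fact.
Qed.

Lemma is_derive_flat m (t : R) :
  is_derive t 1 (flat m) ((- m%:R) * flat m.+1 t + flat m.+2 t).
Proof.
have [t0|t0|->] := ltgtP t 0.
- rewrite !flat_le0 ?ltW// mulr0 addr0.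
  apply: (@near_eq_is_derive _ _ _ (cst 0)).
  near=> x; rewrite flat_le0//; apply: ltW; near: x; exact: lt_nbhsl.
- have -> : (- m%:R) * flat m.+1 t + flat m.+2 t =
      t^-1 ^+ m * (expR (- t^-1) * (t ^- 2)) +
      expR (- t^-1) * (m%:R * t^-1 ^+ m.-1 * (- t ^- 2)).
    rewrite /flat t0 -[t ^- 2]exprVn; case: m => [|m] /=; first by ring.
    by rewrite !exprS; ring.
  apply: (@near_eq_is_derive _ _ _
      ((fun x : R => x^-1 ^+ m) * (fun x => expR (- x^-1)))).
  + near=> x; rewrite /flat ifT//; near: x; exact: lt_nbhsr.
  + have dV : is_derive t 1 (fun x : R => x^-1) (- t ^- 2).
      have := @is_deriveV R id t 1 1 (lt0r_neq0 t0) (is_derive_id _ _).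
      by move=> h; apply: is_derive_eq h _; rewrite -[LHS]/(_ * _) mulr1.
    have dN : is_derive t 1 (fun x : R => - x^-1) (t ^- 2).
      by apply: is_derive_eq; rewrite opprK.
    have dE : is_derive t 1 (fun x => expR (- x^-1)) (expR (- t^-1) * (t ^- 2)).
      exact: is_derive1_comp.
    have dX : is_derive t 1 (fun x => x^-1 ^+ m) (m%:R * t^-1 ^+ m.-1 * - t ^- 2).
      have := @is_deriveX _ _ _ m _ _ _ dV.
      by rewrite (_ : GRing.inv ^+ m = (fun x : R => x^-1 ^+ m))// exprfctE.
    exact: is_deriveM.
- rewrite !flat_le0 ?lexx// mulr0 addr0.
  have h0 : (fun h => h^-1 *: ((flat m \o shift 0) (h *: 1) - flat m 0)) @ 0^' --> (0:R).
    apply/cvgrPdist_le => e e0.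
    (* At 0 the difference quotient for h > 0 is [flat m.+1 h], which [flat_le_linear] bounds by
       (m+2)! |h|. *)
    exists (e / (m.+2)`!%:R) => /=; first by rewrite divr_gt0// ltr0n fact_gt0.
    move=> h; rewrite /= sub0r normrN => he h0.
    rewrite sub0r normrN -![_ *: _]/(_ * _) mulr1 addr0 (flat_le0 _ (lexx 0)) subr0.
    have [hn|hp] := leP h 0; first by rewrite flat_le0// mulr0 normr0 ltW.
    rewrite -flatS// ger0_norm ?flat_ge0//.
    apply: le_trans (flat_le_linear _ _) _.
    by rewrite mulrC -ler_pdivlMr ?ltr0n ?fact_gt0// ltW.
  by apply: DeriveDef; [apply/cvg_ex; exists 0|exact: cvg_lim].
Unshelve. all: by end_near.
Qed.

Lemma smooth_flat m : smooth (flat m).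
Proof.
move=> k; elim: k m => [|k IH] m.
  move=> t; apply: differentiable_continuous; apply/derivable1_diffP.
  by have [] := is_derive_flat m t.
split=> [t|]; first by have [] := is_derive_flat m t.
rewrite (_ : D1 _ = fun t => (- m%:R) * flat m.+1 t + flat m.+2 t).
  by apply: smooth_uptoD => //; apply: smooth_uptoM => //; exact: smooth_upto_cst.
by apply/funext => t; rewrite derive1E; have [_ ->] := is_derive_flat m t.
Qed.

End smooth1.

(** * Test functions *)

Section class_C.
Context {R : realType} {N : nat}.
Local Notation space := ('rV[R]_N * measurableTypeR R)%type.
Implicit Types (phi : space -> R) (eta : R -> R).

Lemma class_CS k phi : class_C k.+1 phi ->
  (forall z, differentiable phi z) /\ (forall v, class_C k ('D_v phi)).
Proof. by []. Qed.

Lemma class_CW k phi : class_C k.+1 phi -> class_C k phi.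
Proof.
elim: k phi => [f [df _] t|k IH f /class_CS[df sf]].
  exact: differentiable_continuous.
by split=> // v; exact: IH (sf v).
Qed.

Lemma class_CD k phi psi : class_C k phi -> class_C k psi ->
  class_C k (fun z => phi z + psi z).
Proof.
elim: k phi psi => [f g cf cg t|k IH f g /class_CS[df sf] /class_CS[dg sg]].
  by apply: cvgD; [exact: cf|exact: cg].
split=> [t|v]; first exact: differentiableD.
rewrite (_ : (fun z => _) = fun t => 'D_v f t + 'D_v g t); first exact: IH.
by apply/funext => t; rewrite deriveD//; exact: diff_derivable.
Qed.

Lemma class_CM k phi psi : class_C k phi -> class_C k psi ->
  class_C k (fun z => phi z * psi z).
Proof.
elim: k phi psi => [f g cf cg t|k IH f g sf sg].
  by apply: cvgM; [exact: cf|exact: cg].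
have sf' := class_CW sf; have sg' := class_CW sg.
case: (class_CS sf) (class_CS sg) => {}df {}sf [dg {}sg].
split=> [t|v]; first exact: differentiableM.
rewrite (_ : (fun z => _) = fun t => f t * 'D_v g t + g t * 'D_v f t).
  by apply: class_CD; exact: IH.
by apply/funext => t; rewrite deriveM//; exact: diff_derivable.
Qed.

Lemma continuous_snd : continuous (snd : space -> R).
Proof. by move=> z; exact: cvg_snd. Qed.

Lemma differentiable_snd (z : space) : differentiable (snd : space -> R) z.
Proof.
apply: (@linear_differentiable _ _ _ (snd : {linear space -> R})) => x.
exact: continuous_snd.
Qed.

Lemma differentiable_smooth eta (z : space) : smooth eta ->
  differentiable (fun z : space => eta z.2) z.
Proof.
move=> se; apply: (@differentiable_comp _ _ _ _ (snd : space -> R) eta).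
  exact: differentiable_snd.
by apply/derivable1_diffP; exact: smooth_derivable.
Qed.

Lemma derive_smooth eta (z v : space) : smooth eta ->
  'D_v (fun z : space => eta z.2) z = v.2 * derive1 eta z.2.
Proof.
move=> se; rewrite deriveE; last exact: differentiable_smooth.
rewrite (@diff_comp _ _ _ _ (snd : space -> R) eta) /=.
- rewrite deriv1E; last exact: smooth_derivable.
  rewrite (@diff_lin _ _ _ (snd : {linear space -> R})) //.
  exact: continuous_snd.
- exact: differentiable_snd.
- by apply/derivable1_diffP; exact: smooth_derivable.
Qed.

Lemma smooth_class_C k eta : smooth eta -> class_C k (fun z : space => eta z.2).
Proof.
elim: k eta => [|k IH] eta se.
  move=> z; apply: (@continuous_comp _ _ _ (snd : space -> R) eta).
    exact: continuous_snd.
  exact: smooth_continuous.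
split=> [z|v]; first exact: differentiable_smooth.
rewrite (_ : (fun z => _) = fun z : space => (fun t => v.2 * derive1 eta t) z.2).
  apply: (IH (fun t => v.2 * derive1 eta t)).
  by apply: smoothM; [exact: smooth_cst|exact: smooth_derive].
by apply/funext => z; rewrite derive_smooth.
Qed.

Lemma class_CMsmooth k eta phi : smooth eta -> class_C k phi ->
  class_C k (fun z => eta z.2 * phi z).
Proof. by move=> se; apply: class_CM; exact: smooth_class_C. Qed.

Lemma deriveMsmooth eta phi (z v : space) : smooth eta -> differentiable phi z ->
  'D_v (fun z : space => eta z.2 * phi z) z =
  eta z.2 * 'D_v phi z + v.2 * derive1 eta z.2 * phi z.
Proof.
move=> se dphi; rewrite deriveM; last exact: diff_derivable.
  by rewrite derive_smooth// -![_ *: _]/(_ * _) [_ * phi z]mulrC.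
by apply: diff_derivable; exact: differentiable_smooth.
Qed.

(** One family contains all the maps of the proof: dilations (l = m), translations in y (l = m = 1)
    and reflections in y (l = 1, m = -1). *)
Definition affine (l m t : R) (z : space) : space := (l *: z.1, m * z.2 + t).
Definition linpart (l m : R) (z : space) : space := (l *: z.1, m * z.2).

Lemma derive_affine l m t phi (z v : space) :
  'D_v (phi \o affine l m t) z = 'D_(linpart l m v) phi (affine l m t z).
Proof.
rewrite /derive; apply: (congr1 (fun F : R -> R => lim (F @ 0^'))); apply: funext => h /=.
congr (_ *: (phi _ - _)); congr pair => /=.
  by rewrite /shift/= scalerDr !scalerA mulrC.
by rewrite /shift /= mulrDr -![_ *: _]/(_ * _); ring.
Qed.

Lemma differentiable_affine l m t z : differentiable (affine l m t) z.
Proof.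
apply: differentiable_pair.
  apply: differentiableZ.
  apply: (@linear_differentiable _ _ _ (fst : {linear space -> 'rV[R]_N})) => x.
  exact: cvg_fst.
apply: differentiableD; last exact: differentiable_cst.
by apply: differentiableZ; exact: differentiable_snd.
Qed.

Lemma continuous_affine l m t : continuous (affine l m t).
Proof. by move=> z; exact/differentiable_continuous/differentiable_affine. Qed.

Lemma class_C_affine k l m t phi :
  class_C k phi -> class_C k (phi \o affine l m t).
Proof.
elim: k phi => [phi cp z|k IH phi /class_CS[dp sp]].
  by apply: continuous_comp; [exact: continuous_affine|exact: cp].
split=> [z|v].
  by apply: differentiable_comp; [exact: differentiable_affine|exact: dp].
rewrite (_ : (fun z => _) = 'D_(linpart l m v) phi \o affine l m t).
  exact/IH/sp.
by apply/funext => z; rewrite derive_affine.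
Qed.


Lemma class_C_derive phi v : (forall k, class_C k phi) ->
  forall k, class_C k ('D_v phi).
Proof. by move=> sf k; have /class_CS[_] := sf k.+1; apply. Qed.

Implicit Types Om : set space.

Lemma space_compact_closed (K : set space) : compact K -> closed K.
Proof. by apply: compact_closed; exact: norm_hausdorff. Qed.

Lemma derive_outside (K : set space) phi v : compact K ->
  (forall z, ~ K z -> phi z = 0) -> forall z, ~ K z -> 'D_v phi z = 0.
Proof.
move=> cK phi0 z Kz.
have [_ <-] : is_derive z v phi 0; last by [].
apply: (@near_eq_is_derive _ _ _ (cst 0)).
have : nbhs z (~` K).
  by apply: open_nbhs_nbhs; split=> //; apply: closed_openC; exact: space_compact_closed.
by apply: filterS => x /phi0 ->.
Qed.

Lemma test_functionD Om phi psi : test_function Om phi ->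
  test_function Om psi -> test_function Om (fun z => phi z + psi z).
Proof.
move=> [sp [K [cK KO K0]]] [sq [L [cL LO L0]]]; split.
  by move=> k; exact: class_CD.
exists (K `|` L); split; first exact: compactU.
  by move=> z [/KO|/LO].
by move=> z /not_orP[/K0 -> /L0 ->]; rewrite addr0.
Qed.

(** The factor [eta], supported in [F], may shrink the domain from [Om'] to [Om]. In this way a
    cutoff turns a test function of a large domain into one of a strip or of a half-space. *)
Lemma test_functionM (Om Om' : set space) (F : set R) eta phi :
  smooth eta -> closed F -> (forall t, ~ F t -> eta t = 0) ->
  (forall z, Om' z -> F z.2 -> Om z) ->
  test_function Om' phi -> test_function Om (fun z => eta z.2 * phi z).
Proof.
move=> se cF eta0 FO [sp [K [cK KO K0]]]; split.
  by move=> k; exact: class_CMsmooth.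
exists (K `&` (snd : space -> R) @^-1` F); split.
- apply: (subclosed_compact _ cK); last exact: subIsetl.
  apply: closedI; first exact: space_compact_closed.
  by apply: closed_comp => // x _; exact: continuous_snd.
- by move=> z [/KO Oz Fz]; exact: FO.
- move=> z /not_andP[/K0 ->|/eta0 ->]; first by rewrite mulr0.
  by rewrite mul0r.
Qed.

Lemma test_function_sub (Om Om' : set space) phi : Om `<=` Om' ->
  test_function Om phi -> test_function Om' phi.
Proof.
move=> OO [sp [K [cK KO K0]]]; split=> //; exists K; split=> //.
exact: subset_trans OO.
Qed.

(** Written as an [affine] map again, so that every lemma on affine maps applies to the inverse. *)
Definition affine_inv (l m t : R) : space -> space :=
  affine l^-1 m^-1 (- (m^-1 * t)).

Lemma affineK l m t : l != 0 -> m != 0 -> cancel (affine l m t) (affine_inv l m t).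
Proof.
move=> l0 m0 [x y]; rewrite /affine_inv /affine /=; congr pair.
  by rewrite scalerA mulVf// scale1r.
by rewrite mulrDr mulrA mulVf// mul1r addrK.
Qed.

Lemma affine_invK l m t : l != 0 -> m != 0 -> cancel (affine_inv l m t) (affine l m t).
Proof.
move=> l0 m0 [x y]; rewrite /affine_inv /affine /=; congr pair.
  by rewrite scalerA divff// scale1r.
by rewrite mulrDr mulrN !mulrA divff// !mul1r addrNK.
Qed.

Lemma test_function_affine l m t Om phi : l != 0 -> m != 0 ->
  test_function Om phi ->
  test_function (affine l m t @^-1` Om) (phi \o affine l m t).
Proof.
move=> l0 m0 [sp [K [cK KO K0]]]; split.
  by move=> k; exact: class_C_affine.
exists (affine_inv l m t @` K); split.
- apply: continuous_compact => //; apply: continuous_subspaceT.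
  exact: continuous_affine.
- by move=> _ [z Kz <-] /=; rewrite affine_invK//; exact: KO.
- move=> z Kz; apply: K0 => Kz'; apply: Kz; exists (affine l m t z) => //.
  exact: affineK.
Qed.

End class_C.

(** * Lebesgue measure on R^N x R *)

Section measure.
Context {R : realType} {N : nat}.
Local Notation RR := (measurableTypeR R).
Local Notation space := ('rV[R]_N * measurableTypeR R)%type.

Lemma ball_grid (n : nat) (y e : R) : n.+1%:R^-1 < e ->
  ball y e ((Num.floor (n.+1%:R * y))%:~R / n.+1%:R).
Proof.
move=> ne; rewrite /ball /= /ball_ /=; apply: le_lt_trans ne.
have n0 : (0 : R) < n.+1%:R by rewrite ltr0n.
have /andP[fl fu] := floor_itv (n.+1%:R * y).
rewrite -[y in y - _](mulKf (lt0r_neq0 n0)) mulrC -mulrBl normrM.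
rewrite [`|n.+1%:R^-1|]gtr0_norm ?invr_gt0// ler_piMl ?invr_ge0 ?ltW//.
by rewrite ger0_norm ?subr_ge0// ltrBlDl -intrD1.
Qed.

(* A continuous function is the limit of its values at the points of the grids
   of mesh 1/(n+1), and there are only countably many such points. *)
Lemma measurable_continuous (phi : space -> R) :
  continuous phi -> measurable_fun [set: space] phi.
Proof.
move=> cphi.
pose U : countType := ('rV[int]_N * int)%type.
pose e (n : nat) (z : space) : U := (\row_j Num.floor (n.+1%:R * z.1 ord0 j),
  Num.floor (n.+1%:R * z.2)).
pose pt (n : nat) (q : U) : space :=
  (\row_j ((q.1 ord0 j)%:~R / n.+1%:R), q.2%:~R / n.+1%:R).
have mfl (n : nat) (k : int) :
    measurable [set y : RR | Num.floor (n.+1%:R * y) = k].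
  rewrite (_ : [set _ | _] = `[k%:~R / n.+1%:R, (k + 1)%:~R / n.+1%:R[%classic).
    exact: measurable_itv.
  apply/seteqP; split=> y /=; rewrite in_itv/= ler_pdivrMr ?ltr0n//.
    by move=> <-; rewrite ltr_pdivlMr ?ltr0n// mulrC floor_itv.
  by rewrite ltr_pdivlMr ?ltr0n// mulrC => /floor_def.
have me n q : measurable (e n @^-1` [set q]).
  rewrite (_ : _ @^-1` _ =
     (\bigcap_(j in [set: 'I_N]) (fun z : space => z.1 ord0 j) @^-1`
         [set y : RR | Num.floor (n.+1%:R * y) = q.1 ord0 j]) `&`
     (snd : space -> RR) @^-1` [set y : RR | Num.floor (n.+1%:R * y) = q.2]).
    apply: measurableI.
      apply: fin_bigcap_measurable; first exact: finite_finset.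
      move=> j _; rewrite -[X in measurable X]setTI.
      have mj : measurable_fun setT (fun z : space => z.1 ord0 j).
        exact: (measurableT_comp (measurable_rV_coord j) measurable_fst).
      exact: (mj measurableT _ (mfl _ _)).
    by rewrite -[X in measurable X]setTI; exact: (measurable_snd measurableT _ (mfl _ _)).
  apply/seteqP; split=> [z <-|z [/= H1 H2]].
    by split=> //= j _; rewrite mxE.
  case: q H1 H2 => q1 q2 /= H1 H2; rewrite /e H2; congr pair.
  by apply/rowP => j; rewrite mxE; exact: H1.
apply: (@measurable_fun_cvg _ _ _ _ (fun n => phi \o pt n \o e n)).
  move=> n _ Y mY; rewrite setTI.
  rewrite (_ : _ @^-1` _ = \bigcup_(q : U)
      if `[< Y (phi (pt n q)) >] then e n @^-1` [set q] else set0).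
    apply: countable_bigcupT_measurable => // q.
    by case: ifP => _; [exact: me|exact: measurable0].
  apply/seteqP; split=> [z /= Yz|z [q _]].
    by exists (e n z) => //; rewrite asboolT.
  by case: ifPn => [/asboolP Yq ez|//]; rewrite /= ez.
move=> z _; apply: (@cvg_comp _ _ _ (fun n => pt n (e n z)) phi _ (nbhs z)); last exact: cphi.
apply/cvg_ballP => r r0.
have [m _ mr] := near_infty_natSinv_lt (PosNum r0).
exists m => // n /mr nr; split; last exact: ball_grid.
by split => // i j; rewrite (ord1 i) !mxE; exact: ball_grid.
Qed.

End measure.

(** * Scaling of Lebesgue measure on R and on R^n *)

Section change_of_variables.
Context {R : realType}.
Local Notation RR := (measurableTypeR R).
Local Notation leb := (@lebesgue_measure R).
Local Open Scope ereal_scope.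

Lemma measurable_affineR (m c : R) :
  measurable_fun [set: RR] (fun t : RR => (m * t + c)%R : RR).
Proof.
by apply: measurable_funD => //; apply: measurable_funM => //; exact: measurable_id.
Qed.

(** The image of Lebesgue measure under t -> m t + c, multiplied by |m|, gives each interval ]a, b]
    its length, hence is Lebesgue measure by uniqueness. For m < 0 the preimage of such an interval
    is closed on the left and open on the right, which leaves its length unaffected. *)
Lemma ge0_integral_affineR (m c : R) (f : RR -> \bar R) : m != 0%R ->
  measurable_fun [set: RR] f -> (forall t, 0 <= f t) ->
  \int[leb]_t f (m * t + c)%R = (`|m|^-1)%:E * \int[leb]_t f t.
Proof.
move=> m0 mf f0.
have am0 : (0 < `|m|)%R by rewrite normr_gt0.
have mT := measurable_affineR m c.
pose T (t : RR) : RR := (m * t + c)%R.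
pose nu : {measure set RR -> \bar R} :=
  measure_function_pushforward__canonical__measure_function_Measure leb mT.
pose mu := mscale (NngNum (normr_ge0 m)) nu.
have E A : measurable A -> leb A = mu A.
  apply: lebesgue_measure_unique => X [[a b] _ <-].
  change (leb `]a, b] = (`|m|)%:E * leb (T @^-1` `]a, b])).
  have [m_gt0|m_lt0|/eqP] := ltgtP m 0%R; last by rewrite (negbTE m0).
  - rewrite (_ : _ @^-1` _ = `[(b - c) / m, (a - c) / m[%classic)%R; last first.
      apply/seteqP; split=> t; rewrite /T/= !in_itv/= ler_ndivrMr// ltr_ndivlMr//;
      rewrite [(t * m)%R]mulrC => /andP[H1 H2]; apply/andP; split; lra.
    rewrite !lebesgue_measure_itv/= !lte_fin ltr_nM2r ?invr_lt0// ltrD2r.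
    case: ifPn => _; last by rewrite mule0.
    by rewrite ltr0_norm// -EFinM; congr EFin; field.
  - rewrite (_ : _ @^-1` _ = `](a - c) / m, (b - c) / m]%classic)%R; last first.
      apply/seteqP; split=> t; rewrite /T/= !in_itv/= ltr_pdivrMr// ler_pdivlMr//;
      rewrite [(t * m)%R]mulrC => /andP[H1 H2]; apply/andP; split; lra.
    rewrite !lebesgue_measure_itv/= !lte_fin ltr_pM2r ?invr_gt0// ltrD2r.
    case: ifPn => _; last by rewrite mule0.
    by rewrite gtr0_norm// -EFinM; congr EFin; field.
rewrite [in RHS](eq_measure_integral mu); last by move=> A mA _; exact: E.
have E2 : \int[nu]_t f t = \int[leb]_t f (T t).
  exact: (@ge0_integral_pushforward _ _ _ _ _ _ mT leb setT f measurableT mf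
    (fun y _ => f0 y)).
rewrite ge0_integral_mscale//= -[X in _ = _ * (_ * X)]/(\int[nu]_t f t) E2 muleA -EFinM mulVf ?mul1e//; exact: lt0r_neq0.
Qed.

(** Induction on the dimension: [lebesgue_rV] in dimension n+1 is the image of a product measure,
    and Tonelli's theorem separates the first coordinate. *)
Lemma ge0_integral_rV_scale n (l : R) (f : 'rV[R]_n -> \bar R) : l != 0%R ->
  measurable_fun setT f -> (forall x, 0 <= f x) ->
  \int[lebesgue_rV n]_x f (l *: x) =
  ((`|l| ^+ n)^-1)%:E * \int[lebesgue_rV n]_x f x.
Proof.
move=> l0; elim: n f => [|n IH] f mf f0.
  rewrite expr0 invr1 mul1e; apply: eq_integral => x _.
  by congr f; apply/rowP; case.
have mscale : measurable_fun setT (fun x : 'rV[R]_n.+1 => l *: x).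
  apply: measurable_fun_rV => i; under eq_fun do rewrite mxE.
  by apply: measurable_funM => //; exact: measurable_rV_coord.
have mscale' : measurable_fun setT (fun x : 'rV[R]_n => l *: x).
  apply: measurable_fun_rV => i; under eq_fun do rewrite mxE.
  by apply: measurable_funM => //; exact: measurable_rV_coord.
have stepE (g : 'rV[R]_n.+1 -> \bar R) : measurable_fun setT g ->
    (forall x, 0 <= g x) -> \int[lebesgue_rV n.+1]_x g x =
    \int[leb]_t \int[lebesgue_rV n]_x g (rV_cons (t, x)).
  move=> mg g0; rewrite /= ge0_integral_pushforward//.
  rewrite preimage_setT fubini_tonelli1//; last by move=> x; exact: g0.
  exact: (measurableT_comp mg (@measurable_rV_cons R n)).
have mfc : measurable_fun setT (f \o @rV_cons R n).
  exact: (measurableT_comp mf (@measurable_rV_cons R n)).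
rewrite !stepE//; last exact: (measurableT_comp mf mscale).
under eq_integral => t _.
  under eq_integral => x _.
    (* The summand 0 gives the first coordinate the shape expected by [ge0_integral_affineR]. *)
    rewrite (_ : l *: rV_cons (t, x) = rV_cons ((l * t + 0)%R, l *: x)); last first.
      apply/rowP => i; rewrite !mxE; case: unlift => [j|]; rewrite ?addr0//=.
      by rewrite mxE.
    over.
  rewrite (IH (fun x => f (rV_cons ((l * t + 0)%R, x))))//; last first.
    exact: (measurableT_comp mfc (measurable_pair1 _)).
  over.
rewrite /=.
rewrite (@ge0_integral_affineR l 0%R
  (fun t => ((`|l| ^+ n)^-1)%:E * \int[lebesgue_rV n]_x f (rV_cons (t, x))))//; last 2 first.
- apply: measurable_funeM.
  exact: (measurable_fun_fubini_tonelli_F _ mfc (fun z => f0 _)).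
- move=> t; rewrite mule_ge0 ?lee_fin ?invr_ge0 ?exprn_ge0//.
  exact: integral_ge0.
rewrite ge0_integralZl//.
- by rewrite muleA -EFinM exprS invfM.
- exact: (measurable_fun_fubini_tonelli_F _ mfc (fun z => f0 _)).
- by move=> t _; exact: integral_ge0.
Qed.

End change_of_variables.

(** * Affine changes of variables and sets of finite or zero volume in R^N x R *)

Section vol.
Context {R : realType} {N : nat}.
Local Notation RR := (measurableTypeR R).
Local Notation space := ('rV[R]_N * measurableTypeR R)%type.
Local Notation leb := (@lebesgue_measure R).
Local Notation vol := (vol R N).
Local Open Scope ereal_scope.

Lemma measurable_affine (l m t : R) : measurable_fun setT (affine l m t : space -> space).
Proof.
apply: measurable_fun_pair => /=.
  apply: measurable_fun_rV => i; under eq_fun do rewrite mxE.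
  apply: measurable_funM => //.
  exact: (measurableT_comp (measurable_rV_coord i) measurable_fst).
exact: (measurableT_comp (measurable_affineR m t) measurable_snd).
Qed.

Lemma ge0_integral_affine (l m t : R) (f : space -> \bar R) :
  l != 0%R -> m != 0%R -> measurable_fun setT f -> (forall z, 0 <= f z) ->
  \int[vol]_z f (affine l m t z) =
  ((`|l| ^+ N * `|m|)^-1)%:E * \int[vol]_z f z.
Proof.
move=> l0 m0 mf f0.
have mfa : measurable_fun setT (f \o affine l m t).
  exact: (measurableT_comp mf (measurable_affine _ _ _)).
rewrite /vol !fubini_tonelli1//.
under eq_integral => x _.
  rewrite /fubini_F /= /affine /=.
  rewrite (@ge0_integral_affineR _ m t (fun y => f (l *: x, y)))//; last first.
    exact: (measurableT_comp mf (measurable_pair1 _)).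
  over.
rewrite /=.
rewrite (ge0_integral_rV_scale l0 (f := fun x => (`|m|^-1)%:E * \int[leb]_y f (x, y)))//; last 2 first.
- by apply: measurable_funeM; exact: (measurable_fun_fubini_tonelli_F _ mf f0).
- move=> x; rewrite mule_ge0 ?lee_fin ?invr_ge0//; exact: integral_ge0.
rewrite ge0_integralZl//.
- by rewrite muleA -EFinM invfM.
- exact: (measurable_fun_fubini_tonelli_F _ mf f0).
- by move=> x _; exact: integral_ge0.
Qed.

(** This holds for integrable and nonintegrable functions alike: the positive and the negative part
    scale by the same factor c > 0, which also respects the conventions for infinite differences. *)
Lemma integral_affine (l m t : R) (f : space -> \bar R) :
  l != 0%R -> m != 0%R -> measurable_fun setT f ->
  \int[vol]_z f (affine l m t z) =
  ((`|l| ^+ N * `|m|)^-1)%:E * \int[vol]_z f z.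
Proof.
move=> l0 m0 mf; rewrite integralE [in RHS]integralE.
set c := (_^-1)%R.
rewrite [X in X - _ = _](_ : _ = c%:E * \int[vol]_z f^\+ z); last first.
  rewrite -(ge0_integral_affine t)//; last exact: measurable_funepos.
  by apply: eq_integral => z _; rewrite -[RHS]/((f^\+ \o affine l m t) z) -funepos_comp.
rewrite [X in _ - X = _](_ : _ = c%:E * \int[vol]_z f^\- z); last first.
  rewrite -(ge0_integral_affine t)//; last exact: measurable_funeneg.
  by apply: eq_integral => z _; rewrite -[RHS]/((f^\- \o affine l m t) z) -funeneg_comp.
have c0 : (0 < c)%R.
  by rewrite invr_gt0 mulr_gt0 ?exprn_gt0 ?normr_gt0.
have := integral_ge0 vol (fun z (_ : setT z) => funepos_ge0 f z).
have := integral_ge0 vol (fun z (_ : setT z) => funeneg_ge0 f z).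
case: (\int[vol]_z f^\- z) => [b| |]//; case: (\int[vol]_z f^\+ z) => [a| |]// _ _.
- by rewrite /=; congr EFin; rewrite mulrBr.
- by rewrite addye// gt0_muley ?lte_fin.
- by rewrite gt0_muley ?lte_fin// -EFinM addeNy gt0_muleNy ?lte_fin.
- by rewrite gt0_muley ?lte_fin//= gt0_muleNy ?lte_fin.
Qed.

Lemma Rintegral_affine (l m t : R) (f : space -> R) :
  l != 0%R -> m != 0%R -> measurable_fun setT f ->
  (\int[vol]_z f (affine l m t z) = (`|l| ^+ N * `|m|)^-1 * \int[vol]_z f z)%R.
Proof.
move=> l0 m0 mf; rewrite /Rintegral (@integral_affine l m t (EFin \o f))//.
  have c0 : (0 < (`|l| ^+ N * `|m|)^-1)%R.
    by rewrite invr_gt0 mulr_gt0 ?exprn_gt0 ?normr_gt0.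
  case: integral => [r| |]//; first by rewrite gt0_muley ?lte_fin//= mulr0.
  by rewrite gt0_muleNy ?lte_fin//= mulr0.
exact/measurable_EFinP.
Qed.

Lemma vol_hyperplane (t : R) : vol [set z | z.2 = t] = 0.
Proof.
rewrite (_ : [set _ | _] = setT `*` [set t]).
  have -> : vol (setT `*` [set t]) = lebesgue_rV N setT * leb [set t].
    exact: product_measure1E.
  by rewrite lebesgue_measure_set1 mule0.
by apply/seteqP; split=> z //= [].
Qed.

Lemma lebesgue_rV_box n (M : R) :
  measurable [set x : 'rV[R]_n | forall i, `|x ord0 i| <= M]%R /\
  lebesgue_rV n [set x : 'rV[R]_n | forall i, `|x ord0 i| <= M]%R < +oo.
Proof.
have boxE : [set y : R | `|y| <= M]%R = `[- M, M]%classic%R.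
  by apply/seteqP; split=> y /=; rewrite in_itv/= ler_norml.
elim: n => [|n [mB IH]].
  split; last by rewrite /= diracE ltry.
  rewrite (_ : [set _ | _] = setT)//; apply/seteqP; split=> // x _ [] //.
have consE : @rV_cons R n @^-1` [set x | forall i, `|x ord0 i| <= M]%R =
    [set y | `|y| <= M]%R `*` [set x : 'rV[R]_n | forall i, `|x ord0 i| <= M]%R.
  apply/seteqP; split=> -[y x] /=.
    move=> H; split; first by have := H ord0; rewrite mxE unlift_none.
    by move=> i; have := H (lift ord0 i); rewrite mxE liftK.
  by move=> [H1 H2] i; rewrite mxE /=; case: unlift.
split.
  rewrite (_ : [set _ | _] = \bigcap_(j in [set: 'I_n.+1])
      (fun x : 'rV[R]_n.+1 => x ord0 j) @^-1` `[- M, M]%classic%R).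
    apply: fin_bigcap_measurable; first exact: finite_finset.
    move=> j _; rewrite -[X in measurable X]setTI.
    exact: (measurable_rV_coord j measurableT (measurable_itv _)).
  apply/seteqP; split=> x /= H i; first by rewrite -boxE => _; exact: H.
  by have := H i I; rewrite -boxE.
have -> : lebesgue_rV n.+1 [set x : 'rV[R]_n.+1 | forall i, `|x ord0 i| <= M]%R
    = leb [set y | `|y| <= M]%R *
      lebesgue_rV n [set x : 'rV[R]_n | forall i, `|x ord0 i| <= M]%R.
  rewrite /= /lebesgue_rV_step /pushforward consE.
  by apply: product_measure1E => //; rewrite boxE; exact: measurable_itv.
rewrite boxE lte_mul_pinfty// ?lebesgue_measure_itv /=; case: ifP => //.
Qed.

(** Boxes stand in for compact sets: they are measurable and of finite volume, so multiples of their
    indicators dominate functions of compact support. *)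
Definition box (M : R) : set space :=
  [set x : 'rV[R]_N | forall i, `|x ord0 i| <= M]%R `*` [set y : RR | `|y| <= M]%R.

Lemma measurable_box M : measurable (box M).
Proof.
apply: measurableX; first exact: (lebesgue_rV_box N M).1.
rewrite (_ : [set _ | _] = `[- M, M]%classic%R); first exact: measurable_itv.
by apply/seteqP; split=> y /=; rewrite in_itv/= ler_norml.
Qed.

Lemma vol_box_lty M : vol (box M) < +oo.
Proof.
have [mB B] := lebesgue_rV_box N M.
have boxE : [set y : R | `|y| <= M]%R = `[- M, M]%classic%R.
  by apply/seteqP; split=> y /=; rewrite in_itv/= ler_norml.
have -> : vol (box M) = lebesgue_rV N [set x : 'rV[R]_N | forall i, `|x ord0 i| <= M]%R *
    leb [set y | `|y| <= M]%R.
  by apply: product_measure1E => //; rewrite boxE; exact: measurable_itv.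
rewrite boxE lte_mul_pinfty ?ge0_fin_numE// lebesgue_measure_itv/=.
by case: ifP => // _; rewrite ltry.
Qed.

Lemma compact_sub_box (K : set space) : compact K -> exists M, K `<=` box M.
Proof.
move=> cK; have [M [_ KM]] := compact_bounded cK.
exists (M + 1)%R => z /(KM (M + 1)%R); rewrite ltrDl ltr01 => /(_ isT).
rewrite /= prod_normE /= ge_max => /andP[H1 H2]; split=> //= i.
apply: le_trans H1; rewrite /Num.norm /= mx_normrE.
by apply: (le_bigmax _ (fun ij : 'I_1 * 'I_N => `|z.1 ij.1 ij.2|%R) (ord0, i)).
Qed.

End vol.

(** * Square-integrable functions and weak derivatives *)

Section L2.
Context {R : realType} {N : nat}.
Local Notation space := ('rV[R]_N * measurableTypeR R)%type.
Local Notation vol := (vol R N).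
Implicit Types (u g f : space -> R) (Om : set space).

Lemma restrE u Om z : (u \_ Om) z = if z \in Om then u z else 0.
Proof. by []. Qed.

Lemma restr_in u Om z : Om z -> (u \_ Om) z = u z.
Proof. by move=> Oz; rewrite restrE mem_set. Qed.

Lemma restr_out u Om z : ~ Om z -> (u \_ Om) z = 0.
Proof. by move=> Oz; rewrite restrE memNset. Qed.

Lemma restr_id u Om : (forall z, ~ Om z -> u z = 0) -> u \_ Om = u.
Proof.
move=> u0; apply/funext => z; have [Oz|Oz] := pselect (Om z).
  by rewrite restr_in.
by rewrite restr_out// u0.
Qed.

Definition L2 f : Prop := f \in Lfun vol 2%:E.

Lemma L2P f : L2 f <->
  measurable_fun setT f /\ (\int[vol]_z ((f z) ^+ 2)%:E < +oo)%E.
Proof.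
have E : (\int[vol]_z ((f z) ^+ 2)%:E = 'N[vol]_2%:E[EFin \o f] `^ 2)%E.
  rewrite powR_Lnorm//; apply: eq_integral => z _.
  by rewrite /= powR_mulrn// -normrX ger0_norm// sqr_ge0.
rewrite /L2 E; split.
  rewrite inE => /andP[]; rewrite !inE /= => mf ff; split=> //.
  exact: poweR_lty.
move=> [mf ff]; rewrite inE; apply/andP; rewrite !inE /=; split=> //.
exact: lty_poweRy ff.
Qed.

Lemma L2_measurable f : L2 f -> measurable_fun setT f.
Proof. by move=> /L2P[]. Qed.

Lemma L2_integrable_sqr f : L2 f ->
  vol.-integrable setT (EFin \o (fun z => f z ^+ 2)).
Proof. exact: Lfun2_integrable_sqr. Qed.

Lemma L2_integrableM f g : L2 f -> L2 g ->
  vol.-integrable setT (EFin \o (fun z => f z * g z)).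
Proof. by move=> Lf Lg; apply/Lfun1_integrable; exact: Lfun2_mul_Lfun1. Qed.

Lemma L2_le f g : measurable_fun setT f -> L2 g ->
  (forall z, `|f z| <= `|g z|) -> L2 f.
Proof.
move=> mf /L2P[mg gf] fg; apply/L2P; split=> //; apply: le_lt_trans gf.
apply: ge0_le_integral => //.
- by move=> z _; rewrite lee_fin sqr_ge0.
- by apply/measurable_EFinP; exact: measurable_funX.
- by apply/measurable_EFinP; exact: measurable_funX.
- by move=> z _; rewrite lee_fin -[leLHS]real_normK ?num_real// -[leRHS]real_normK ?num_real// lerXn2r ?nnegrE.
Qed.

Lemma L2D f g : L2 f -> L2 g -> L2 (fun z => f z + g z).
Proof.
have p1 : (1 <= 2%:E :> \bar R)%E by rewrite lee_fin ler1n.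
by move=> Lf Lg; have [_ H] := Lfun_addr_closed vol p1; exact: H Lf Lg.
Qed.

Lemma L2_Mbounded f (c : space -> R) C : measurable_fun setT c -> L2 f ->
  (forall z, `|c z| <= C) -> L2 (fun z => c z * f z).
Proof.
move=> mc Lf cC; have LC : L2 (fun z => f z * C).
  by apply: (@Lfun_scale _ _ _ vol f C 2 _ Lf); rewrite ler1n.
apply: L2_le LC _ => [|z].
  by apply: measurable_funM => //; exact: L2_measurable.
rewrite !normrM mulrC ler_wpM2l//; apply: le_trans (cC z) _; exact: ler_norm.
Qed.

Lemma L2_restrict f Om : measurable Om -> L2 f -> L2 (f \_ Om).
Proof.
move=> mO Lf; apply: (L2_le _ Lf) => [|z].
  apply/(measurable_restrictT _ mO); apply: measurable_funTS.
  exact: L2_measurable.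
by rewrite restrE; case: ifP => // _; rewrite normr0.
Qed.

Definition mass f : R := \int[vol]_z (f z ^+ 2).

Lemma massE f : L2 f -> (\int[vol]_z (f z ^+ 2)%:E)%E = (mass f)%:E.
Proof.
move=> Lf; rewrite /mass /Rintegral fineK//.
by apply: integrable_fin_num => //; exact: L2_integrable_sqr.
Qed.

Lemma mass_ge0 f : 0 <= mass f.
Proof. by apply: Rintegral_ge0 => z _; rewrite sqr_ge0. Qed.

Lemma test_function_box Om phi : test_function Om phi ->
  exists M, forall z, ~ box M z -> phi z = 0 /\ forall v, 'D_v phi z = 0.
Proof.
move=> [sp [K [cK _ K0]]]; have [M KM] := compact_sub_box cK.
exists M => z Mz; have Kz : ~ K z by move/KM.
by split=> [|v]; [exact: K0|exact: derive_outside K0 _ Kz].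
Qed.

Lemma L2_box M (c : R) : L2 (fun z : space => c * \1_(box M) z).
Proof.
have m1 : measurable_fun setT (\1_(box M) : space -> R).
  by apply: measurable_indic; exact: measurable_box.
apply/L2P; split; first exact: measurable_funM.
rewrite (eq_integral (fun z => ((c ^+ 2)%:E * (\1_(box M) z)%:E)%E)); last first.
  move=> z _; rewrite -EFinM exprMn; congr (_ * _)%:E.
  by rewrite indicE; case: (_ \in _); rewrite ?expr1n ?expr0n.
rewrite ge0_integralZl//; last 2 first.
- exact/measurable_EFinP.
- by rewrite lee_fin sqr_ge0.
rewrite integral_indic//; last exact: measurable_box.
by rewrite setIT lte_mul_pinfty ?lee_fin ?sqr_ge0// vol_box_lty.
Qed.

Lemma bounded_support_L2 (K : set space) phi : continuous phi -> compact K ->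
  (forall z, ~ K z -> phi z = 0) -> L2 phi /\ exists C, forall z, `|phi z| <= C.
Proof.
move=> cphi cK K0.
have [C phiC] : exists C, forall z, `|phi z| <= C.
  have [C [_ HC]] := compact_bounded (continuous_compact (continuous_subspaceT cphi) cK).
  exists (`|C| + 1) => z; have [Kz|Kz] := pselect (K z); last first.
    by rewrite K0// normr0 addr_ge0.
  apply: (HC (`|C| + 1)); last by exists z.
  by rewrite (le_lt_trans (ler_norm C))// ltrDl.
split; last by exists C.
have mphi := measurable_continuous cphi.
have [M KM] := compact_sub_box cK.
apply: L2_le mphi (L2_box M C) _ => z.
have [Kz|Kz] := pselect (K z); last by rewrite K0// normr0.
rewrite indicE mem_set ?mulr1; last exact: KM.
by apply: le_trans (phiC z) _; exact: ler_norm.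
Qed.

Lemma test_function_L2 Om phi : test_function Om phi ->
  L2 phi /\ forall v, L2 ('D_v phi).
Proof.
move=> [sp [K [cK _ K0]]]; split=> [|v].
  by have [] := bounded_support_L2 (sp 0%N) cK K0.
have [] // := bounded_support_L2 (class_C_derive v sp 0%N) cK.
exact: derive_outside.
Qed.

Lemma test_function_bounded Om phi : test_function Om phi ->
  (exists C, forall z, `|phi z| <= C) /\
  forall v, exists C, forall z, `|'D_v phi z| <= C.
Proof.
move=> [sp [K [cK _ K0]]]; split=> [|v].
  by have [] := bounded_support_L2 (sp 0%N) cK K0.
have [] // := bounded_support_L2 (class_C_derive v sp 0%N) cK.
exact: derive_outside.
Qed.

(* [g] behaves as the weak derivative of [u] in the direction [v] when tested
   against [phi]. Both terms are under one integral so that the product rule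
   for weak derivatives becomes an identity between integrands. *)
Definition wd (v : space) u g phi : Prop :=
  \int[vol]_z (u z * 'D_v phi z + g z * phi z) = 0.

Lemma wd_integrable Om v u g phi : L2 u -> L2 g -> test_function Om phi ->
  vol.-integrable setT (EFin \o (fun z => u z * 'D_v phi z + g z * phi z)).
Proof.
move=> Lu Lg /test_function_L2[Lphi LD].
exact: (integrableD measurableT (L2_integrableM Lu (LD v)) (L2_integrableM Lg Lphi)).
Qed.

Lemma weak_derivativeP Om v u g : in_L2 Om u -> in_L2 Om g ->
  weak_derivative Om v u g <->
  forall phi, test_function Om phi -> wd v (u \_ Om) (g \_ Om) phi.
Proof.
move=> Lu Lg.
have H phi : test_function Om phi -> 
    \int[vol]_(z in Om) (u z * 'D_v phi z) + \int[vol]_(z in Om) (g z * phi z) =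
    \int[vol]_z ((u \_ Om) z * 'D_v phi z + (g \_ Om) z * phi z).
  move=> /test_function_L2[Lphi LD].
  rewrite RintegralD//; [|exact: L2_integrableM|exact: L2_integrableM].
  rewrite !(Rintegral_mkcond _ Om); congr (_ + _); apply: eq_Rintegral => z _;
    by rewrite !restrE; case: ifP => //; rewrite mul0r.
split=> W phi tphi; have := H phi tphi; rewrite /wd.
  by move=> <-; rewrite (W _ tphi) addNr.
by rewrite (W _ tphi) => /eqP; rewrite addr_eq0 => /eqP.
Qed.

(** The value is an extended real: finiteness of the integral of the critical power is part of what
    a Gagliardo-Nirenberg bound asserts. *)
Definition Pint (p : R) u : \bar R := (\int[vol]_z (`|u z| `^ p)%:E)%E.

Lemma norm_L_powE Om p u : p != 0 -> (norm_L Om p u `^ p)%E = Pint p (u \_ Om).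
Proof.
by move=> p0; rewrite /norm_L powR_Lnorm//; apply: eq_integral => z _ /=.
Qed.

Lemma norm_L_2E Om u q : in_L2 Om u ->
  (norm_L Om 2 u `^ q)%E = (mass (u \_ Om) `^ (q / 2))%:E.
Proof.
move=> Lu; have N2 : (norm_L Om 2 u `^ 2 = (mass (u \_ Om))%:E)%E.
  rewrite norm_L_powE// -(massE Lu); apply: eq_integral => z _.
  by rewrite powR_mulrn// real_normK ?num_real.
have -> : q = 2 * (q / 2) by field.
by rewrite poweRrM N2 poweR_EFin; congr (_ `^ _)%:E; field.
Qed.

Lemma mass_gt0P f : L2 f -> 0 < mass f <-> ~ {ae vol, forall z, f z = 0}.
Proof.
move=> Lf; have mf := L2_measurable Lf.
have me : measurable_fun setT (fun z => (f z ^+ 2)%:E).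
  by apply/measurable_EFinP; exact: measurable_funX.
have E : (\int[vol]_z `|(f z ^+ 2)%:E| = (mass f)%:E)%E.
  rewrite -massE//; apply: eq_integral => z _.
  by rewrite /= ger0_norm// sqr_ge0.
have [H1 H2] := ae_eq_integral_abs vol measurableT me.
rewrite lt_neqAle mass_ge0 andbT eq_sym; split.
  move=> /eqP m0 f0; apply: m0; have : (mass f)%:E = 0%E :> \bar R.
    rewrite -E; apply: H2; apply: filterS f0 => z /= -> _.
    by rewrite expr0n.
  by case.
move=> nf; apply/eqP => m0; apply: nf; rewrite m0 in E.
have := H1 E; apply: filterS => z /(_ I) /= [] /eqP.
by rewrite sqrf_eq0 => /eqP.
Qed.

Lemma nonzeroP Om u : in_L2 Om u -> nonzero Om u <-> 0 < mass (u \_ Om).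
Proof.
move=> Lu; rewrite (mass_gt0P Lu) /nonzero; split; apply: contra_not.
  by apply: filterS => z uz Oz; rewrite -uz restr_in.
apply: filterS => z uz; have [Oz|Oz] := pselect (Om z).
  by rewrite restr_in// uz.
by rewrite restr_out.
Qed.

Lemma Pint_gt0 p f : 0 < p -> L2 f -> 0 < mass f -> (0 < Pint p f)%E.
Proof.
move=> p0 Lf /(mass_gt0P Lf) nf; have mf := L2_measurable Lf.
rewrite lt_neqAle; apply/andP; split; last first.
  by apply: integral_ge0 => z _; rewrite lee_fin powR_ge0.
apply/eqP => P0; apply: nf.
have me : measurable_fun setT (fun z => (`|f z| `^ p)%:E).
  apply/measurable_EFinP.
  by apply: (measurableT_comp (measurable_powR p)); exact: measurableT_comp.
have [H1 _] := ae_eq_integral_abs vol measurableT me.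
have : (\int[vol]_z `|(`|f z| `^ p)%:E| = 0)%E.
  rewrite [RHS]P0; apply: eq_integral => z _.
  by rewrite /= ger0_norm// powR_ge0.
move=> /H1; apply: filterS => z /(_ I) /= [] /eqP.
by rewrite powR_eq0 normr_eq0 => /andP[/eqP].
Qed.

End L2.

(** * H^1 and the Gagliardo-Nirenberg constants *)

Section H1.
Context {R : realType} {N : nat}.
Local Notation space := ('rV[R]_N * measurableTypeR R)%type.
Local Notation vol := (vol R N).
Local Notation p := (crit_exp R N).
Local Notation s := (2 / N.+1%:R : R).
Implicit Types (u : space -> R) (Om : set space) (Du : gradient R N).

Definition map_grad (F : (space -> R) -> space -> R) Du : gradient R N :=
  Gradient (fun i => F (grad_x Du i)) (F (grad_y Du)).

Definition vanish Om u := forall z, ~ Om z -> u z = 0.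

(* H^1(Om), for functions on the whole space that are 0 outside Om. *)
Definition H1 Om u Du : Prop :=
  [/\ L2 u, (forall i, L2 (grad_x Du i)), L2 (grad_y Du),
      (forall i phi, test_function Om phi -> wd (dir_x R i) u (grad_x Du i) phi) &
      (forall phi, test_function Om phi -> wd (dir_y R N) u (grad_y Du) phi)] /\
  [/\ vanish Om u, (forall i, vanish Om (grad_x Du i)) & vanish Om (grad_y Du)].

Local Notation restr Om := (fun u => u \_ Om).

Lemma in_H1_restr Om u Du : in_H1 Om u Du ->
  H1 Om (u \_ Om) (map_grad (restr Om) Du).
Proof.
move=> [Lu Lx Ly Wx Wy]; split; last first.
  by split=> [z Oz|i z Oz|z Oz] /=; rewrite restr_out.
split=> //= [i|].
  by move=> phi tphi; exact: (weak_derivativeP _ Lu (Lx i)).1.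
by move=> phi tphi; exact: (weak_derivativeP _ Lu Ly).1.
Qed.

Lemma H1_restr_grad Om u Du : H1 Om u Du -> map_grad (restr Om) Du = Du.
Proof.
move=> [_ [_ gx0 gy0]]; case: Du gx0 gy0 => gx gy /= gx0 gy0.
rewrite /map_grad /= restr_id//; congr Gradient.
by apply/funext => i; rewrite restr_id//; exact: gx0.
Qed.

Lemma H1_in_H1 Om u Du : H1 Om u Du -> in_H1 Om u Du.
Proof.
move=> [[Lu Lx Ly Wx Wy] [u0 gx0 gy0]].
have Lu' : in_L2 Om u by rewrite /in_L2 restr_id.
have Lx' i : in_L2 Om (grad_x Du i) by rewrite /in_L2 restr_id//; [exact: Lx|exact: gx0].
have Ly' : in_L2 Om (grad_y Du) by rewrite /in_L2 restr_id.
split=> //.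
  move=> i; apply/weak_derivativeP => // phi tphi.
  by rewrite !restr_id//; [exact: Wx|exact: gx0].
by apply/weak_derivativeP => // phi tphi; rewrite !restr_id//; exact: Wy.
Qed.

Definition energy Du : R := \sum_(i < N) mass (grad_x Du i) + mass (grad_y Du).

Lemma energy_ge0 Du : 0 <= energy Du.
Proof. by rewrite addr_ge0 ?mass_ge0// sumr_ge0// => i _; exact: mass_ge0. Qed.

Lemma norm_grad_sqE Om Du : (forall i, in_L2 Om (grad_x Du i)) ->
  in_L2 Om (grad_y Du) ->
  norm_grad_sq Om Du = (energy (map_grad (restr Om) Du))%:E.
Proof.
move=> Lx Ly; rewrite /norm_grad_sq /energy EFinD -sumEFin.
congr (_ + _)%E; last by rewrite norm_L_2E// divff// powRr1 ?mass_ge0.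
by apply: eq_bigr => i _; rewrite norm_L_2E// divff// powRr1 ?mass_ge0.
Qed.

Lemma crit_exp_half : (p - 2) / 2 = s.
Proof.
rewrite /crit_exp [2 + _]addrC addrK mulrAC (_ : 4 / 2 = 2 :> R)//; lra.
Qed.

Lemma crit_exp_gt0 : 0 < p.
Proof. by rewrite /crit_exp addr_gt0// divr_gt0// ltr0n. Qed.

(* The bound [k] for the quotient of [u], in a form that makes sense when the
   denominator of the quotient vanishes. *)
Definition GN_bound (b k : R) u Du : Prop :=
  (Pint p u <= (k * ((energy Du + b * mass u) * mass u `^ s))%:E)%E.

Lemma GN_quotient_le Om u Du b k : in_H1 Om u Du -> nonzero Om u -> 0 <= b ->
  (GN_quotient Om (norm_grad_sq Om Du + b%:E * norm_L Om 2 u `^ 2) u <= k%:E)%E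
  <-> GN_bound b k (u \_ Om) (map_grad (restr Om) Du).
Proof.
move=> [Lu Lx Ly _ _] nu b0; rewrite /GN_bound /GN_quotient.
have m0 := (nonzeroP Lu).1 nu.
rewrite norm_grad_sqE// !norm_L_2E// divff// powRr1 ?mass_ge0// crit_exp_half.
rewrite norm_L_powE ?lt0r_neq0 ?crit_exp_gt0//.
set e := energy _; set m := mass _ in m0 *.
have -> : ((e%:E + b%:E * m%:E) * (m `^ s)%:E = ((e + b * m) * m `^ s)%:E)%E by [].
have P0 : (0 < Pint p (u \_ Om))%E by apply: Pint_gt0 => //; exact: crit_exp_gt0.
have ms : 0 < m `^ s by exact: powR_gt0.
have : 0 <= e + b * m by rewrite addr_ge0 ?energy_ge0// mulr_ge0// ltW.
(* If the denominator is 0, the quotient is +oo because its numerator is positive, and both sides of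
   the equivalence are false. *)
rewrite le_eqVlt => /orP[/eqP<-|em].
  rewrite mul0r mulr0 inver eqxx gt0_muley//; split => //.
  by rewrite leNgt P0.
have emm : 0 < (e + b * m) * m `^ s by rewrite mulr_gt0.
by rewrite inver gt_eqF// lee_pdivrMr// -EFinM.
Qed.

Lemma K_domain_le Om (k : R) : (K_domain Om <= k%:E)%E <->
  forall u Du, H1 Om u Du -> 0 < mass u -> GN_bound 0 k u Du.
Proof.
split.
- move=> Kk u Du hu mu; have iu := H1_in_H1 hu.
  have u0 : u \_ Om = u by apply: restr_id; case: hu => _ [].
  have nu : nonzero Om u by apply/nonzeroP; rewrite ?u0//; case: iu.
  rewrite -[u]u0 -[Du](H1_restr_grad hu); apply/GN_quotient_le => //.
  apply: le_trans Kk; apply: ereal_sup_ubound; exists u, Du; split=> //.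
  by rewrite mul0e adde0.
- move=> H; apply: ge_ereal_sup => _ [u [Du [iu nu ->]]].
  have := GN_quotient_le k iu nu (lexx 0); rewrite mul0e adde0 => ->.
  by apply: H; [exact: in_H1_restr|apply/nonzeroP => //; case: iu].
Qed.

Lemma K_segment_le (a b B k : R) : 0 <= B -> (K_segment N a b B <= k%:E)%E <->
  forall u Du, H1 (strip a b) u Du -> 0 < mass u ->
    GN_bound (B / (b - a) ^+ 2) k u Du.
Proof.
move=> B0; have b0 : 0 <= B / (b - a) ^+ 2 by rewrite divr_ge0// sqr_ge0.
split.
- move=> Kk u Du hu mu; have iu := H1_in_H1 hu.
  have u0 : u \_ (strip a b) = u by apply: restr_id; case: hu => _ [].
  have nu : nonzero (strip a b) u by apply/nonzeroP; rewrite ?u0//; case: iu.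
  rewrite -[u]u0 -[Du](H1_restr_grad hu); apply/GN_quotient_le => //.
  by apply: le_trans Kk; apply: ereal_sup_ubound; exists u, Du; split.
- move=> H; apply: ge_ereal_sup => _ [u [Du [iu nu ->]]].
  apply/(GN_quotient_le k iu nu) => //.
  by apply: H; [exact: in_H1_restr|apply/nonzeroP => //; case: iu].
Qed.

(** If a test function takes equal values at y = a and y = b, the two boundary terms of the
    Gauss-Green formula cancel, whatever the common trace is. The gluing enters the upper bound in
    this form. *)
Lemma K_cylinder_le (a b B k : R) : 0 <= B ->
  (forall u Du, H1 (strip a b) u Du ->
    (forall phi, test_function (whole_space R N) phi ->
      (forall x, phi (x, a) = phi (x, b)) -> wd (dir_y R N) u (grad_y Du) phi) ->
    0 < mass u -> GN_bound (B / (b - a) ^+ 2) k u Du) ->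
  (K_cylinder N a b B <= k%:E)%E.
Proof.
move=> B0 H; have b0 : 0 <= B / (b - a) ^+ 2 by rewrite divr_ge0// sqr_ge0.
apply: ge_ereal_sup => _ [u [Du [[iu [g [_ _ tr]]] nu ->]]].
apply/(GN_quotient_le k iu nu) => //; apply: H.
- exact: in_H1_restr.
- move=> phi tphi phiab; have := tr phi tphi.
  rewrite [RHS](_ : _ = 0).
    move=> E; rewrite /wd -[RHS]E [RHS]Rintegral_mkcond; apply: eq_Rintegral => z _.
    by rewrite /= !restrE; case: ifP => // _; rewrite !mul0r addr0.
  under eq_Rintegral do rewrite phiab subrr.
  by rewrite /Rintegral integral0.
- by apply/nonzeroP => //; case: iu.
Qed.

Lemma Lfun0 n : (cst 0 : 'rV[R]_n -> R) \in Lfun (lebesgue_rV n) 2%:E.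
Proof.
have p1 : (1 <= 2%:E :> \bar R)%E by rewrite lee_fin ler1n.
by have [H _] := Lfun_addr_closed (lebesgue_rV n) p1; exact: H.
Qed.

(* Testing against functions that need not vanish on the boundary expresses that
   both traces of [u] are 0. *)
Lemma K_cylinder_ge (a b B k : R) : 0 <= B -> (K_cylinder N a b B <= k%:E)%E ->
  forall u Du, H1 (strip a b) u Du ->
    (forall phi, test_function (whole_space R N) phi ->
      wd (dir_y R N) u (grad_y Du) phi) ->
    0 < mass u -> GN_bound (B / (b - a) ^+ 2) k u Du.
Proof.
move=> B0 Kk u Du hu wu mu.
have b0 : 0 <= B / (b - a) ^+ 2 by rewrite divr_ge0// sqr_ge0.
have iu := H1_in_H1 hu.
have u0 : u \_ (strip a b) = u by apply: restr_id; case: hu => _ [].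
have gy0 : vanish (strip a b) (grad_y Du) by case: hu => _ [].
have uv : vanish (strip a b) u by case: hu => _ [].
have nu : nonzero (strip a b) u by apply/nonzeroP; rewrite ?u0//; case: iu.
rewrite -[u]u0 -[Du](H1_restr_grad hu); apply/GN_quotient_le => //.
apply: le_trans Kk; apply: ereal_sup_ubound; exists u, Du; split=> //.
split=> //; exists (cst 0); split.
- exact: Lfun0.
- exact: Lfun0.
move=> phi tphi; rewrite [RHS](_ : _ = 0); last first.
  under eq_Rintegral do rewrite !mul0r subr0.
  by rewrite /Rintegral integral0.
rewrite Rintegral_mkcond -[RHS](wu phi tphi); apply: eq_Rintegral => z _.
rewrite restrE; case: ifPn => // /negP zO.
have zO' : ~ strip a b z by move=> h; apply: zO; rewrite inE.
by rewrite uv// gy0// !mul0r addr0.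
Qed.

End H1.

(** * Test functions that do not vanish near the boundary *)

Section boundary.
Context {R : realType} {N : nat}.
Local Notation space := ('rV[R]_N * measurableTypeR R)%type.
Local Notation vol := (vol R N).
Implicit Types (u g : space -> R) (Om : set space).

(** [rho] is a smooth defining function of the domain: [strip_rho] yields the strips, the identity
    yields the half-space. *)
Definition above (rho : R -> R) : set space := [set z | 0 < rho z.2].

(* A smooth function that vanishes where rho <= 1/n and tends to 1 where
   rho > 0. *)
Definition cutoff (rho : R -> R) (n : nat) (t : R) : R := flat 0 (n%:R * rho t - 1).

Lemma smooth_cutoff rho n : smooth rho -> smooth (cutoff rho n).
Proof.
move=> srho; rewrite /cutoff; apply: (@smooth_comp _ (fun t => n%:R * rho t - 1)).
  exact: smooth_flat.
apply: smoothD; last exact: smooth_cst.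
by apply: smoothM => //; exact: smooth_cst.
Qed.

Lemma derive_cutoff rho n t : smooth rho ->
  derive1 (cutoff rho n) t = flat 2 (n%:R * rho t - 1) * (n%:R * derive1 rho t).
Proof.
move=> srho; have [+ _] := is_derive_flat 0 (n%:R * rho t - 1) => dflat.
have drho : is_derive t 1 rho (derive1 rho t).
  by rewrite derive1E; apply: derivableP; exact: smooth_derivable.
have d1 : is_derive t 1 (fun t => n%:R * rho t - 1) (n%:R * derive1 rho t).
  by apply: is_derive_eq; rewrite subr0.
have d2 : is_derive t 1 (flat 0 \o (fun t => n%:R * rho t - 1))
   (((- 0%:R) * flat 1 (n%:R * rho t - 1) + flat 2 (n%:R * rho t - 1)) *
     (n%:R * derive1 rho t)).
  by apply: is_derive1_comp; exact: is_derive_flat.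
rewrite derive1E; have -> := @derive_val _ _ _ _ _ _ _ d2.
by rewrite oppr0 mul0r add0r.
Qed.

Lemma test_function_cutoff rho n Om phi : smooth rho -> test_function Om phi ->
  test_function (above rho) (fun z => cutoff rho n z.2 * phi z).
Proof.
move=> srho; apply: (@test_functionM _ _ _ _ [set t | 1 <= n%:R * rho t]).
- exact: smooth_cutoff.
- apply: (@closed_comp _ _ (fun t => n%:R * rho t) [set x | 1 <= x]).
    move=> t _; apply: smooth_continuous; apply: smoothM => //; exact: smooth_cst.
  exact: closed_ge.
- move=> t /negP; rewrite -ltNge => nt.
  by rewrite /cutoff flat_le0// subr_le0 ltW.
- move=> z _ /= H; rewrite /above /=.
  have : 0 < n%:R * rho z.2 by apply: lt_le_trans H.
  case: n H => [|n] H; first by rewrite mul0r ltxx.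
  by rewrite pmulr_rgt0// ltr0n.
Qed.

Lemma flat_le_inv m (t : R) : 0 < t -> flat m.+1 t <= m`!%:R / t.
Proof.
by move=> t0; rewrite flatS// mulrC ler_pM2r ?invr_gt0// flat_le_fact.
Qed.

Lemma flat0_ge (t : R) : 0 < t -> 1 - t^-1 <= flat 0 t <= 1.
Proof.
move=> t0; rewrite (le_trans (flat_le_fact 0 t))// andbT.
by rewrite /flat t0 expr0 mul1r; exact: expR_ge1Dx.
Qed.

(* One tests against [cutoff rho n * phi] and lets [n] tend to infinity. The
   derivative of the cutoff is of size 1/rho where it is not small, and the bound
   on [phi] makes up for that. *)
Lemma wd_boundary (rho : R -> R) v u g Om phi (C : R) : smooth rho ->
  L2 u -> L2 g -> vanish (above rho) u -> vanish (above rho) g ->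
  (forall psi, test_function (above rho) psi -> wd v u g psi) ->
  test_function Om phi ->
  (forall z, above rho z -> `|v.2 * derive1 rho z.2 * phi z| <= C * rho z.2) ->
  wd v u g phi.
Proof.
move=> srho Lu Lg u0 g0 W tphi HC.
have [sphi _] := tphi.
pose h z := u z * 'D_v phi z + g z * phi z.
pose phin n z := cutoff rho n z.2 * phi z.
pose hn n z := u z * 'D_v (phin n) z + g z * phin n z.
have tn n : test_function (above rho) (phin n).
  exact: (test_function_cutoff n srho tphi).
have ih : vol.-integrable setT (EFin \o h) by exact: wd_integrable tphi.
have ihn n : vol.-integrable setT (EFin \o hn n) by exact: wd_integrable (tn n).
have hn0 n : (\int[vol]_z (EFin \o hn n) z = 0)%E.
  have : fine (\int[vol]_z (EFin \o hn n) z) = 0 by exact: (W _ (tn n)).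
  have : (\int[vol]_z (EFin \o hn n) z)%E \is a fin_num.
    exact: integrable_fin_num.
  by case: integral => //= r _ ->.
have hnE n z : hn n z = cutoff rho n z.2 * h z +
    u z * (v.2 * derive1 (cutoff rho n) z.2 * phi z).
  rewrite /hn /phin deriveMsmooth//.
  - by rewrite /h; ring.
  - exact: smooth_cutoff.
  - by have [] := sphi 1%N.
have hout n z : ~ above rho z -> hn n z = 0 by move=> Oz; rewrite /hn u0// g0// !mul0r addr0.
have hout' z : ~ above rho z -> h z = 0 by move=> Oz; rewrite /h u0// g0// !mul0r addr0.
have C0 z : above rho z -> 0 <= C * rho z.2.
  by move=> Oz; apply: le_trans (HC _ Oz).
have dbound n z : above rho z -> `|v.2 * derive1 (cutoff rho n) z.2 * phi z| <=
   C * rho z.2 * n%:R * flat 2 (n%:R * rho z.2 - 1).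
  move=> Oz; rewrite derive_cutoff//.
  rewrite (_ : _ * _ * _ = v.2 * derive1 rho z.2 * phi z * n%:R *
     flat 2 (n%:R * rho z.2 - 1)); last by ring.
  rewrite normrM [`|flat _ _|]ger0_norm ?flat_ge0// normrM normr_nat.
  by rewrite ler_wpM2r ?flat_ge0// ler_wpM2r// HC.
(* With t = n rho - 1 > 0 one has n rho flat 2 t = (t + 1) flat 2 t = flat 1 t + flat 2 t, so the
   factor n of the derivative of the cutoff is absorbed. *)
have flat12 n z : above rho z ->
   C * rho z.2 * n%:R * flat 2 (n%:R * rho z.2 - 1) <=
   C * (flat 1 (n%:R * rho z.2 - 1) + flat 2 (n%:R * rho z.2 - 1)).
  move=> Oz; have [t0|t0] := leP (n%:R * rho z.2 - 1) 0.
    by rewrite !flat_le0// !mulr0 addr0 mulr0.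
  rewrite (flatE 1 (ltW t0)) le_eqVlt; apply/orP; left; apply/eqP; ring.
have CC : (exists z, above rho z) -> 0 <= C.
  by move=> [z Oz]; have := C0 _ Oz; rewrite pmulr_lge0.
have [M HM] := test_function_box tphi.
(* The constant 3 is 1! + 2!, the sum of the bounds of [flat 1] and [flat 2]. The box contains the
   support of [phi] and makes the majorant integrable. *)
pose G z := `|h z| + `|u z * (3 * `|C| * \1_(box M) z)|.
have iG : vol.-integrable setT (EFin \o G).
  have i1 : vol.-integrable setT (EFin \o (fun z => `|h z|)).
    exact: (integrable_norm ih).
  have Lb : L2 (fun z : space => 3 * `|C| * \1_(box M) z) by exact: L2_box.
  have i2 := integrable_norm (L2_integrableM Lu Lb).
  exact: (integrableD measurableT i1 i2).
have dom n z : `|hn n z| <= G z.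
  have [Oz|Oz] := pselect (above rho z); last first.
    by rewrite hout// normr0 addr_ge0.
  rewrite hnE /G; apply: le_trans (ler_normD _ _) _; apply: lerD.
    rewrite normrM ger0_norm ?flat_ge0// ler_piMl//.
    by apply: le_trans (flat_le_fact _ _) _.
  rewrite !normrM ler_wpM2l//.
  have [Mz|Mz] := pselect (box M z); last first.
    by have [-> _] := HM _ Mz; rewrite normr0 mulr0.
  rewrite indicE mem_set// normr1 mulr1 -!normrM.
  apply: le_trans (dbound n z Oz) _; apply: le_trans (flat12 n z Oz) _.
  rewrite [`|_ * _|]ger0_norm ?mulr_ge0// [`|C|]ger0_norm ?CC//; last by exists z.
  rewrite mulrC ler_wpM2r ?CC//; first by exists z.
  have := flat_le_fact 1 (n%:R * rho z.2 - 1).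
  have := flat_le_fact 2 (n%:R * rho z.2 - 1).
  rewrite /factorial /=; lra.
have cvg z : hn n z @[n --> \oo] --> h z.
  have [Oz|Oz] := pselect (above rho z); last first.
    by rewrite hout'//; under eq_fun do rewrite hout//; exact: cvg_cst.
  have C0' : 0 <= C by apply: CC; exists z.
  pose K := `|h z| + 2 * C * `|u z|.
  have K0 : 0 <= K by rewrite addr_ge0// !mulr_ge0.
  (* With t = n rho - 1, each of 1 - flat 0 t, flat 1 t and flat 2 t is at most 1/t. The last two
     account for the factor 2 in [K]. *)
  have est n : 0 < n%:R * rho z.2 - 1 -> `|h z - hn n z| <= K / (n%:R * rho z.2 - 1).
    move=> t0; rewrite hnE.
    have -> : h z - (cutoff rho n z.2 * h z + u z * (v.2 * derive1 (cutoff rho n) z.2 * phi z)) =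
       (1 - cutoff rho n z.2) * h z - u z * (v.2 * derive1 (cutoff rho n) z.2 * phi z).
      by ring.
    apply: le_trans (ler_normB _ _) _; rewrite /K [leRHS]mulrDl; apply: lerD.
      rewrite normrM mulrC ler_wpM2l//.
      have := flat0_ge t0; rewrite /cutoff => /andP[H1 H2].
      by rewrite ger0_norm ?subr_ge0// lerBlDr -lerBlDl.
    set tau := _ - 1 in t0 *.
    rewrite (_ : 2 * C * _ / _ = `|u z| * (C * (tau^-1 + tau^-1))); last by ring.
    rewrite normrM ler_wpM2l//.
    apply: le_trans (dbound n z Oz) _; apply: le_trans (flat12 n z Oz) _.
    rewrite ler_wpM2l//; apply: lerD.
      by have := flat_le_inv 0 t0; rewrite fact0 mul1r.
    by have := flat_le_inv 1 t0; rewrite mul1r.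
  apply/cvgrPdist_le => e e0; near=> n.
  have t0 : K / e + 1 <= n%:R * rho z.2 - 1.
    rewrite lerBrDr -ler_pdivrMr//; near: n; exact: nbhs_infty_ger.
  have t1 : 0 < n%:R * rho z.2 - 1.
    by apply: lt_le_trans t0; rewrite ltr_wpDl// divr_ge0// ltW.
  apply: le_trans (est n t1) _; rewrite ler_pdivrMr// mulrC -ler_pdivrMr//.
  by apply: le_trans t0; rewrite lerDl.
have [|||||_ _] := @dominated_convergence _ _ _ vol setT measurableT
   (fun n => EFin \o hn n) (EFin \o h) (EFin \o G).
- by move=> n; exact: measurable_int (ihn n).
- exact: measurable_int ih.
- apply: aeW => z _; apply: cvg_EFin; first exact: nearW.
  exact: cvg.
- exact: iG.
- by apply: aeW => z n _; rewrite lee_fin dom.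
move=> H; have {}H : (cst 0%E : (\bar R)^nat) @ \oo --> (\int[vol]_z (EFin \o h) z)%E.
  apply: cvg_trans H; apply: near_eq_cvg; apply: nearW => n.
  by rewrite /= hn0.
have E : (\int[vol]_z (EFin \o h) z = 0)%E.
  exact: (cvg_unique (@ereal_hausdorff R) H (cvg_cst _)).
by rewrite /wd /Rintegral -[X in fine X]/(\int[vol]_z (EFin \o h) z)%E E.
Unshelve. all: by end_near.
Qed.

End boundary.

(** * Products, restrictions and affine changes of variables *)

Section operations.
Context {R : realType} {N : nat}.
Local Notation space := ('rV[R]_N * measurableTypeR R)%type.
Local Notation vol := (vol R N).
Implicit Types (u g : space -> R) (Om : set space) (Du : gradient R N).

Lemma test_function_differentiable Om phi : test_function Om phi ->
  forall z, differentiable phi z.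
Proof. by move=> [/(_ 1%N) []]. Qed.

Definition mulf (eta : R -> R) u : space -> R := fun z => eta z.2 * u z.

Definition mul_grad (eta : R -> R) u Du : gradient R N :=
  Gradient (fun i => mulf eta (grad_x Du i))
    (fun z => eta z.2 * grad_y Du z + derive1 eta z.2 * u z).

Lemma wd_mulf eta v u g phi : smooth eta -> (forall z, differentiable phi z) ->
  wd v (mulf eta u) (fun z => eta z.2 * g z + v.2 * derive1 eta z.2 * u z) phi <->
  wd v u g (fun z => eta z.2 * phi z).
Proof.
move=> se dphi; rewrite /wd.
rewrite (@eq_Rintegral _ _ _ _ _ (fun z : space => u z * 'D_v (fun z : space => eta z.2 * phi z) z +
  g z * (eta z.2 * phi z)))// => z _.
by rewrite deriveMsmooth// /mulf; ring.
Qed.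

Lemma wd_y_mul_grad Om eta u Du phi : smooth eta -> test_function Om phi ->
  wd (dir_y R N) u (grad_y Du) (fun z => eta z.2 * phi z) ->
  wd (dir_y R N) (mulf eta u) (grad_y (mul_grad eta u Du)) phi.
Proof.
move=> se tphi; rewrite -wd_mulf//; last exact: test_function_differentiable tphi.
by under eq_fun do rewrite mul1r.
Qed.

Lemma measurable_smooth eta : smooth eta ->
  measurable_fun setT (fun z : space => eta z.2).
Proof.
move=> se; apply: measurable_continuous => z.
exact/differentiable_continuous/differentiable_smooth.
Qed.

(** [u] itself is only tested against functions of the form eta phi. Hence [Om] may be larger than
    the domain on which [u] is an H^1 function, and multiplication by [eta] then produces an
    extension by 0. *)
Lemma H1_mulf eta Om u Du : smooth eta ->
  (forall t, `|eta t| <= 1) -> (forall t, `|derive1 eta t| <= 1) ->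
  L2 u -> (forall i, L2 (grad_x Du i)) -> L2 (grad_y Du) ->
  [/\ vanish Om u, (forall i, vanish Om (grad_x Du i)) & vanish Om (grad_y Du)] ->
  (forall i phi, test_function Om phi ->
     wd (dir_x R i) u (grad_x Du i) (fun z => eta z.2 * phi z)) ->
  (forall phi, test_function Om phi ->
     wd (dir_y R N) u (grad_y Du) (fun z => eta z.2 * phi z)) ->
  H1 Om (mulf eta u) (mul_grad eta u Du).
Proof.
move=> se e1 e1' Lu Lx Ly [u0 gx0 gy0] Wx Wy.
have me := measurable_smooth se; have me' := measurable_smooth (smooth_derive se).
split; last first.
  split=> [z Oz|i z Oz|z Oz] /=.
  - by rewrite /mulf u0// mulr0.
  - by rewrite /mulf gx0// mulr0.
  - by rewrite u0// gy0// !mulr0 addr0.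
split=> /=.
- exact: (L2_Mbounded me Lu (fun z => e1 z.2)).
- by move=> i; exact: (L2_Mbounded me (Lx i) (fun z => e1 z.2)).
- apply: L2D; first exact: (L2_Mbounded me Ly (fun z => e1 z.2)).
  exact: (L2_Mbounded me' Lu (fun z => e1' z.2)).
- move=> i phi tphi; have := Wx i phi tphi.
  rewrite -wd_mulf//; last exact: test_function_differentiable tphi.
  rewrite /= (_ : (fun z => _) = mulf eta (grad_x Du i))//.
  by apply/funext => z; rewrite !mul0r addr0.
- by move=> phi tphi; exact: (wd_y_mul_grad se tphi (Wy phi tphi)).
Qed.

Lemma H1_restrict Om Om' u Du : measurable Om' -> Om' `<=` Om -> H1 Om u Du ->
  H1 Om' (u \_ Om') (map_grad (fun f => f \_ Om') Du).
Proof.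
move=> mO OO [[Lu Lx Ly Wx Wy] _].
have E v w g phi : test_function Om' phi -> wd v w g phi ->
    wd v (w \_ Om') (g \_ Om') phi.
  move=> [_ [K [cK KO K0]]]; rewrite /wd => <-; apply: eq_Rintegral => z _.
  have [Oz|Oz] := pselect (Om' z); first by rewrite !restr_in.
  have Kz : ~ K z by move/KO.
  by rewrite !restr_out// (derive_outside _ cK K0)// K0// !mul0r !mulr0.
split; last by split=> [z Oz|i z Oz|z Oz] /=; rewrite restr_out.
split=> /=.
- exact: L2_restrict.
- by move=> i; exact: L2_restrict.
- exact: L2_restrict.
- by move=> i phi tphi; apply: E => //; apply: Wx; exact: test_function_sub tphi.
- by move=> phi tphi; apply: E => //; apply: Wy; exact: test_function_sub tphi.
Qed.

Lemma derive_scale (c : R) (v z : space) (phi : space -> R) : differentiable phi z ->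
  'D_(c *: v) phi z = c * 'D_v phi z.
Proof. by move=> dphi; rewrite !deriveE// linearZ. Qed.

Lemma L2_affine l m t u : l != 0 -> m != 0 -> L2 u -> L2 (u \o affine l m t).
Proof.
move=> l0 m0 /L2P[mu fu]; apply/L2P; split.
  exact: (measurableT_comp mu (measurable_affine _ _ _)).
rewrite (@ge0_integral_affine _ _ l m t (fun z => (u z ^+ 2)%:E))//.
- by rewrite lte_mul_pinfty ?lee_fin// invr_ge0 mulr_ge0// exprn_ge0.
- by apply/measurable_EFinP; exact: measurable_funX.
- by move=> z; rewrite lee_fin sqr_ge0.
Qed.

Definition jac (l m : R) : R := (`|l| ^+ N * `|m|)^-1.

Lemma jac_gt0 l m : l != 0 -> m != 0 -> 0 < jac l m.
Proof. by move=> l0 m0; rewrite invr_gt0 mulr_gt0 ?exprn_gt0 ?normr_gt0. Qed.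

Lemma mass_affine l m t u : l != 0 -> m != 0 -> measurable_fun setT u ->
  mass (u \o affine l m t) = jac l m * mass u.
Proof.
move=> l0 m0 mu; rewrite /mass.
rewrite (@Rintegral_affine _ _ l m t (fun z => u z ^+ 2))//.
exact: measurable_funX.
Qed.

Lemma measurable_Pint p u : measurable_fun setT u ->
  measurable_fun setT (fun z => (`|u z| `^ p)%:E).
Proof.
move=> mu; apply/measurable_EFinP.
by apply: (measurableT_comp (measurable_powR p)); exact: measurableT_comp.
Qed.

Lemma Pint_affine p l m t u : l != 0 -> m != 0 -> measurable_fun setT u ->
  Pint p (u \o affine l m t) = ((jac l m)%:E * Pint p u)%E.
Proof.
move=> l0 m0 mu; rewrite /Pint.
rewrite (@ge0_integral_affine _ _ l m t (fun z => (`|u z| `^ p)%:E))//.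
  exact: measurable_Pint.
Qed.

Definition affine_grad l m t Du : gradient R N :=
  Gradient (fun i z => l * grad_x Du i (affine l m t z))
    (fun z => m * grad_y Du (affine l m t z)).

Lemma mass_scale c u : L2 u -> mass (fun z => c * u z) = c ^+ 2 * mass u.
Proof.
move=> Lu; rewrite /mass -RintegralZl//; last exact: L2_integrable_sqr.
by apply: eq_Rintegral => z _; rewrite exprMn.
Qed.

(** Chain rule for weak derivatives. The hypothesis on [linpart] reflects that the coordinate
    directions are eigenvectors of the linear part, so that each partial derivative is merely
    multiplied by c. *)
Lemma wd_affine Om l m t c (v v' : space) u g phi : l != 0 -> m != 0 ->
  L2 u -> L2 g -> linpart l m v' = c *: v -> test_function Om phi ->
  wd v u g phi ->
  wd v' (u \o affine l m t) (fun z => c * g (affine l m t z)) (phi \o affine l m t).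
Proof.
move=> l0 m0 Lu Lg lv tphi w0; have dphi := test_function_differentiable tphi.
pose h z := u z * 'D_v phi z + g z * phi z.
have ih := wd_integrable v Lu Lg tphi.
rewrite /wd (@eq_Rintegral _ _ _ _ _ (fun z => c * h (affine l m t z))); last first.
  move=> z _; rewrite derive_affine lv derive_scale//; rewrite /h/=; ring.
rewrite (@Rintegral_affine _ _ l m t (fun z => c * h z))//.
  by rewrite RintegralZl// [X in c * X](w0) !mulr0.
apply: measurable_funM => //.
by apply/measurable_EFinP; exact: measurable_int ih.
Qed.

Lemma H1_affine Om l m t u Du : l != 0 -> m != 0 -> H1 Om u Du ->
  H1 (affine l m t @^-1` Om) (u \o affine l m t) (affine_grad l m t Du).
Proof.
move=> l0 m0 [[Lu Lx Ly Wx Wy] [u0 gx0 gy0]].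
have Lc c (w : space -> R) : L2 w -> L2 (fun z => c * w (affine l m t z)).
  move=> Lw; apply: (@L2_Mbounded R N (w \o affine l m t) (fun=> c) `|c|) => //.
  exact: (L2_affine t l0 m0 Lw).
have back phi : test_function (affine l m t @^-1` Om) phi ->
    exists2 psi, test_function Om psi & phi = psi \o affine l m t.
  move=> tphi; exists (phi \o affine_inv l m t); last first.
    by apply/funext => z /=; rewrite affineK.
  have : test_function (affine_inv l m t @^-1` (affine l m t @^-1` Om))
      (phi \o affine_inv l m t).
    by apply: test_function_affine => //; rewrite invr_eq0.
  rewrite (_ : _ @^-1` _ = Om)//; apply/funext => z /=.
  by rewrite /preimage /= affine_invK.
split; last first.
  split=> [z Oz|i z Oz|z Oz] /=; first exact: u0.
    by rewrite gx0// mulr0.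
  by rewrite gy0// mulr0.
split=> /=.
- exact: L2_affine.
- by move=> i; exact: Lc.
- exact: Lc.
- move=> i _ /back[psi tpsi ->].
  have lv : linpart l m (dir_x R i) = l *: dir_x R i.
    by congr pair; rewrite mulr0 scaler0.
  exact: (wd_affine t l0 m0 Lu (Lx i) lv tpsi (Wx i psi tpsi)).
- move=> _ /back[psi tpsi ->].
  have lv : linpart l m (dir_y R N) = m *: dir_y R N.
    by congr pair; rewrite !scaler0.
  exact: (wd_affine t l0 m0 Lu Ly lv tpsi (Wy psi tpsi)).
Qed.

End operations.

(** * Localization by cos(y/2) and sin(y/2) *)

Section half_angle.
Context {R : realType}.

(** Half-angle functions, not hyperbolic ones: [ch] vanishes at pi and -pi, and [sh] vanishes at
    0. *)
Definition ch (t : R) : R := cos (t / 2).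
Definition sh (t : R) : R := sin (t / 2).

Let smooth_half : smooth (fun t : R => t / 2).
Proof. by apply: smoothM; [exact: smooth_id|exact: smooth_cst]. Qed.

Lemma smooth_ch : smooth ch.
Proof. by apply: smooth_comp => //; exact: smooth_cos. Qed.

Lemma smooth_sh : smooth sh.
Proof. by apply: smooth_comp => //; exact: smooth_sin. Qed.

Let is_derive_half (t : R) : is_derive t 1 (fun t => t / 2 : R) 2^-1.
Proof. by apply: is_derive_eq; rewrite !scaler0 add0r -[LHS]/(_ * _) mulr1. Qed.

Lemma derive_ch t : derive1 ch t = - 2^-1 * sh t.
Proof.
rewrite derive1E; have h := @is_derive1_comp R cos (fun t => t / 2) t _ _ (is_derive_cos (t / 2)) (is_derive_half t).
by rewrite (@derive_val _ _ _ _ _ _ _ h) mulrC mulrN mulNr.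
Qed.

Lemma derive_sh t : derive1 sh t = 2^-1 * ch t.
Proof.
rewrite derive1E; have h := @is_derive1_comp R sin (fun t => t / 2) t _ _ (is_derive_sin (t / 2)) (is_derive_half t).
by rewrite (@derive_val _ _ _ _ _ _ _ h) mulrC.
Qed.

Lemma ch2Dsh2 t : ch t ^+ 2 + sh t ^+ 2 = 1.
Proof. exact: cos2Dsin2. Qed.

Lemma norm_ch_le1 t : `|ch t| <= 1.
Proof. by rewrite ler_norml cos_geN1 cos_le1. Qed.

Lemma norm_sh_le1 t : `|sh t| <= 1.
Proof. by rewrite ler_norml sin_geN1 sin_le1. Qed.

Lemma norm_derive_ch_le1 t : `|derive1 ch t| <= 1.
Proof.
rewrite derive_ch normrM normrN [`|2^-1|]gtr0_norm ?invr_gt0//; have := norm_sh_le1 t; lra.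
Qed.

Lemma norm_derive_sh_le1 t : `|derive1 sh t| <= 1.
Proof.
rewrite derive_sh normrM [`|2^-1|]gtr0_norm ?invr_gt0//; have := norm_ch_le1 t; lra.
Qed.

Lemma sh_pi_sub t : sh (pi - t) = ch t.
Proof.
by rewrite /sh /ch mulrBl sinB sin_pihalf cos_pihalf mul1r mul0r subr0.
Qed.

Lemma ch_pi_sub t : ch (pi - t) = sh t.
Proof. by rewrite -sh_pi_sub opprB addrC subrK. Qed.

Lemma ch_opp t : ch (- t) = ch t.
Proof. by rewrite /ch mulNr cosN. Qed.

Lemma sh_add_pi t : sh (t + pi) = ch t.
Proof. by rewrite -ch_opp -sh_pi_sub opprK addrC. Qed.

Lemma ch_add_pi t : ch (t + pi) = - sh t.
Proof.
by rewrite /ch /sh mulrDl cosD sin_pihalf cos_pihalf mulr0 mulr1 sub0r.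
Qed.

Lemma sh_sub_pi t : sh (t - pi) = - ch t.
Proof. by rewrite -[t in RHS](subrK pi) ch_add_pi opprK. Qed.

Lemma ch_sub_pi t : ch (t - pi) = sh t.
Proof. by rewrite -[t in RHS](subrK pi) sh_add_pi. Qed.

Lemma ch_gt0 t : `|t| < pi -> 0 < ch t.
Proof.
rewrite ltr_norml => /andP[H1 H2]; apply: cos_gt0_pihalf.
apply/andP; split; lra.
Qed.

Lemma sin_le_id (x : R) : 0 <= x -> sin x <= x.
Proof.
move=> x0; have [|c _] := @MVT_segment R sin cos 0 x x0 (fun t _ => is_derive_sin t).
  by apply: continuous_subspaceT; exact: continuous_sin.
rewrite sin0 !subr0 => ->; rewrite -[leRHS]mul1r ler_wpM2r//; exact: cos_le1.
Qed.

(** [ch t] is the sine of half the distance from t to either endpoint, hence at most that half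
    distance. This is the linear decay that [wd_boundary] asks for. *)
Lemma ch_le t : `|t| < pi -> ch t <= (pi - t) / 2 /\ ch t <= (pi + t) / 2.
Proof.
rewrite ltr_norml => /andP[H1 H2]; split.
  by rewrite -sh_pi_sub; apply: sin_le_id; lra.
by rewrite -ch_opp -sh_pi_sub opprK; apply: sin_le_id; lra.
Qed.

End half_angle.

(** * Splitting of mass and energy, and the convexity inequality *)

Section pythagoras.
Context {R : realType} {N : nat}.
Local Notation space := ('rV[R]_N * measurableTypeR R)%type.
Local Notation vol := (vol R N).
Local Notation p := (crit_exp R N).
Local Notation s := (2 / N.+1%:R : R).
Implicit Types (u g : space -> R) (Om : set space) (Du : gradient R N).

Lemma mass_add_eq (c : R) f1 f2 g1 g2 : L2 f1 -> L2 f2 -> L2 g1 -> L2 g2 ->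
  (forall z : space, f1 z ^+ 2 + f2 z ^+ 2 = g1 z ^+ 2 + c * g2 z ^+ 2) ->
  mass f1 + mass f2 = mass g1 + c * mass g2.
Proof.
move=> F1 F2 G1 G2 E; rewrite /mass -RintegralZl//; last exact: L2_integrable_sqr.
rewrite -!RintegralD//; try exact: L2_integrable_sqr.
  by apply: eq_Rintegral => z _; exact: E.
by have := integrableZl measurableT c (L2_integrable_sqr G2).
Qed.

Lemma L2_mulf eta u : smooth eta -> (forall t, `|eta t| <= 1) -> L2 u ->
  L2 (mulf eta u).
Proof.
by move=> se e1 Lu; exact: (L2_Mbounded (measurable_smooth se) Lu (fun z => e1 z.2)).
Qed.

Lemma L2_mul_grad_y eta u Du : smooth eta -> (forall t, `|eta t| <= 1) ->
  (forall t, `|derive1 eta t| <= 1) -> L2 u -> L2 (grad_y Du) ->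
  L2 (grad_y (mul_grad eta u Du)).
Proof.
move=> se e1 e1' Lu Ly; apply: L2D; first exact: L2_mulf.
exact: (L2_mulf (smooth_derive se)).
Qed.

Lemma mass_pythagoras u : L2 u -> mass (mulf ch u) + mass (mulf sh u) = mass u.
Proof.
move=> Lu; rewrite -[RHS]addr0 -[0 in RHS](mul0r (mass u)).
apply: mass_add_eq => //.
- by apply: L2_mulf => //; [exact: smooth_ch|exact: norm_ch_le1].
- by apply: L2_mulf => //; [exact: smooth_sh|exact: norm_sh_le1].
- by move=> z; rewrite mul0r addr0 /mulf !exprMn -mulrDl ch2Dsh2 mul1r.
Qed.

(** The cross terms cancel since ch ch' + sh sh' = 0, and ch'^2 + sh'^2 = 1/4 gives the mass
    term. *)
Lemma energy_pythagoras u Du : L2 u -> (forall i, L2 (grad_x Du i)) ->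
  L2 (grad_y Du) ->
  energy (mul_grad ch u Du) + energy (mul_grad sh u Du) =
  energy Du + 4^-1 * mass u.
Proof.
move=> Lu Lx Ly; rewrite /energy addrACA -big_split /= -addrA; congr (_ + _).
  by apply: eq_bigr => i _; exact: mass_pythagoras.
apply: mass_add_eq => //.
- apply: L2_mul_grad_y => //; [exact: smooth_ch|exact: norm_ch_le1|exact: norm_derive_ch_le1].
- apply: L2_mul_grad_y => //; [exact: smooth_sh|exact: norm_sh_le1|exact: norm_derive_sh_le1].
- move=> z; rewrite derive_ch derive_sh.
  transitivity ((ch z.2 ^+ 2 + sh z.2 ^+ 2) *
      (grad_y Du z ^+ 2 + 4^-1 * u z ^+ 2)); first by rewrite /=; field.
  by rewrite ch2Dsh2 mul1r.
Qed.

(** Convexity of the power function at the points x/t and y/(1-t), with weights t and 1-t. *)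
Lemma powR_convex (q t x y : R) : 1 <= q -> 0 < t < 1 -> 0 <= x -> 0 <= y ->
  (x + y) `^ q <= t `^ (1 - q) * x `^ q + (1 - t) `^ (1 - q) * y `^ q.
Proof.
move=> q1 /andP[t0 t1] x0 y0; have t1' : 0 < 1 - t by rewrite subr_gt0.
have ti : (0 <= t <= 1) by rewrite !ltW.
have := @convex_powR R q q1 (Itv01 (ltW t0) (ltW t1)) (x / t) (y / (1 - t)).
rewrite !inE /= !in_itv/= !andbT !divr_ge0 ?(ltW t0) ?(ltW t1')// => /(_ isT isT).
rewrite !convRE /= /unstable.onem.
set X := conv _ _ _.
have -> : X = x + y.
  transitivity (t * (x / t) + (1 - t) * (y / (1 - t))); first by [].
  by rewrite mulrC divfK ?gt_eqF// mulrC divfK ?gt_eqF.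
move=> /le_trans; apply.
have E (a b : R) : 0 < a -> 0 <= b -> a * (b / a) `^ q = a `^ (1 - q) * b `^ q.
  move=> a0 b0; have a0' := ltW a0.
  rewrite powRM ?invr_ge0// -[a^-1]powR_inv1// -powRrM mulN1r.
  rewrite powRD; last by rewrite (gt_eqF a0) implybT.
  by rewrite powRr1//; ring.
by rewrite !E.
Qed.

End pythagoras.

(** * Adding up the inequalities of the two pieces *)

Section combine.
Context {R : realType} {N : nat}.
Local Notation space := ('rV[R]_N * measurableTypeR R)%type.
Local Notation vol := (vol R N).
Local Notation p := (crit_exp R N).
Local Notation s := (2 / N.+1%:R : R).
Implicit Types (u g : space -> R) (Om : set space) (Du : gradient R N).

Lemma s_gt0 : 0 < s.
Proof. by rewrite divr_gt0// ltr0n. Qed.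

Lemma crit_expE : p = 2 * (1 + s).
Proof. by rewrite -crit_exp_half; field. Qed.

Lemma normr_powR_crit (x : R) : `|x| `^ p = (x ^+ 2) `^ (1 + s).
Proof. by rewrite crit_expE powRrM powR_mulrn// real_normK ?num_real. Qed.

(** Since |u|^p = (u^2)^(1+s), this is [powR_convex] with q = 1 + s, applied pointwise to the
    squares and integrated. *)
Lemma Pint_le_split (t : R) u u1 u2 : 0 < t < 1 -> measurable_fun setT u ->
  measurable_fun setT u1 -> measurable_fun setT u2 ->
  (forall z, u z ^+ 2 = u1 z ^+ 2 + u2 z ^+ 2) ->
  (Pint p u <= (t `^ (- s))%:E * Pint p u1 + ((1 - t) `^ (- s))%:E * Pint p u2)%E.
Proof.
move=> t01 mu m1 m2 E.
have P0 q v (z : space) : setT z -> (0 <= (`|v z| `^ q)%:E :> \bar R)%E.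
  by rewrite lee_fin powR_ge0.
rewrite /Pint -!ge0_integralZl ?lee_fin ?powR_ge0//; try exact: measurable_Pint;
  try by move=> z; exact: P0.
rewrite -ge0_integralD//; last 4 first.
- by move=> z _; rewrite mule_ge0 ?lee_fin ?powR_ge0.
- by apply: measurable_funeM; exact: measurable_Pint.
- by move=> z _; rewrite mule_ge0 ?lee_fin ?powR_ge0.
- by apply: measurable_funeM; exact: measurable_Pint.
apply: ge0_le_integral => //.
- exact: measurable_Pint.
- by apply: emeasurable_funD; apply: measurable_funeM; exact: measurable_Pint.
- move=> z _; rewrite -!EFinM -EFinD lee_fin !normr_powR_crit E.
  have := @powR_convex R (1 + s) t (u1 z ^+ 2) (u2 z ^+ 2).
  rewrite !sqr_ge0 lerDl (ltW s_gt0) t01 (_ : 1 - (1 + s) = - s); last by ring.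
  exact.
Qed.

Lemma powRN_ratio (a b : R) : 0 < a -> 0 < b ->
  (a / b) `^ (- s) * a `^ s = b `^ s.
Proof.
move=> a0 b0; have a1 := ltW a0; have b1 := ltW b0.
rewrite powRM ?invr_ge0// -[b^-1]powR_inv1// -powRrM mulN1r opprK.
rewrite mulrAC -powRD; last by rewrite (gt_eqF a0) implybT.
by rewrite addNr powRr0 mul1r.
Qed.

(* The weight in [Pint_le_split] is the share of [u1] in the mass of [u], which
   turns the sum of the two bounds into a multiple of a power of [mass u]. *)
Lemma GN_combine (b k : R) u u1 u2 Du D1 D2 :
  measurable_fun setT u -> L2 u1 -> L2 u2 ->
  (forall z, u z ^+ 2 = u1 z ^+ 2 + u2 z ^+ 2) ->
  mass u1 + mass u2 = mass u ->
  energy D1 + energy D2 <= energy Du + b * mass u ->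
  0 < mass u1 -> 0 < mass u2 -> GN_bound 0 k u1 D1 -> GN_bound 0 k u2 D2 ->
  GN_bound b k u Du.
Proof.
move=> mu L1 Lu2 E mE eE m1 m2; rewrite /GN_bound !mul0r !addr0 => G1 G2.
have m0 : 0 < mass u by rewrite -mE addr_gt0.
(* A negative k would contradict [Pint p u1 > 0]. The sign allows the energy inequality to be
   multiplied by k at the end. *)
have k0 : 0 <= k.
  have P1 : (0 < Pint p u1)%E by apply: Pint_gt0 => //; exact: crit_exp_gt0.
  have := lt_le_trans P1 G1; rewrite lte_fin => H; rewrite leNgt; apply/negP => k0.
  move: H; rewrite ltNge mulr_le0_ge0 ?(ltW k0)// mulr_ge0 ?energy_ge0 ?powR_ge0//.
pose t := mass u1 / mass u.
have t0 : 0 < t by rewrite divr_gt0.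
have t1 : 1 - t = mass u2 / mass u.
  by rewrite /t -mE -[1](@divff _ (mass u1 + mass u2)) ?mE ?gt_eqF// -mulrBl -mE addrC addKr.
have t01 : 0 < t < 1 by rewrite t0 -subr_gt0 t1 divr_gt0.
apply: le_trans (Pint_le_split t01 mu (L2_measurable L1) (L2_measurable Lu2) E) _.
apply: (@le_trans _ _ (((t `^ (- s))%:E * (k * (energy D1 * mass u1 `^ s))%:E +
   ((1 - t) `^ (- s))%:E * (k * (energy D2 * mass u2 `^ s))%:E)%E)).
  by apply: leeD; [apply: lee_wpmul2l G1|apply: lee_wpmul2l G2];
    rewrite lee_fin powR_ge0.
rewrite -!EFinM -EFinD lee_fin.
have -> : t `^ (- s) * (k * (energy D1 * mass u1 `^ s)) =
  k * energy D1 * (t `^ (- s) * mass u1 `^ s) by ring.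
have -> : (1 - t) `^ (- s) * (k * (energy D2 * mass u2 `^ s)) =
  k * energy D2 * ((1 - t) `^ (- s) * mass u2 `^ s) by ring.
rewrite t1 /t !powRN_ratio// -mulrDl -mulrDr -mulrA.
by rewrite ler_wpM2l// ler_wpM2r// powR_ge0.
Qed.

End combine.

(** * Concentration at a point of the boundary or of the interior *)

Section blowup.
Context {R : realType} {N : nat}.
Local Notation space := ('rV[R]_N * measurableTypeR R)%type.
Local Notation vol := (vol R N).
Local Notation p := (crit_exp R N).
Local Notation s := (2 / N.+1%:R : R).
Implicit Types (u g : space -> R) (Om : set space) (Du : gradient R N).
Local Notation restr Om := (fun u => u \_ Om).

Lemma le_limn_einf (f g : (\bar R)^nat) : (forall n, f n <= g n)%E ->
  (limn_einf f <= limn_einf g)%E.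
Proof.
move=> fg; rewrite !limn_einf_lim; apply: lee_lim.
- exact: is_cvg_einfs.
- exact: is_cvg_einfs.
- apply: nearW => n; apply: le_ereal_inf_tmp => _ [m nm <-].
  by apply: le_trans (fg m); apply: ereal_inf_lbound; exists m.
Qed.

Lemma mass_restrict_le Om u : measurable Om -> L2 u -> mass (u \_ Om) <= mass u.
Proof.
move=> mO Lu; apply: le_Rintegral => //.
- by apply: L2_integrable_sqr; exact: L2_restrict.
- exact: L2_integrable_sqr.
- by move=> z _; rewrite restrE; case: ifP => // _; rewrite expr0n sqr_ge0.
Qed.

Lemma energy_restrict_le Om Du : measurable Om -> (forall i, L2 (grad_x Du i)) ->
  L2 (grad_y Du) -> energy (map_grad (restr Om) Du) <= energy Du.
Proof.
move=> mO Lx Ly; apply: lerD; last exact: mass_restrict_le.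
by apply: ler_sum => i _; exact: mass_restrict_le.
Qed.

Lemma mass_mulf_ch_le u : L2 u -> mass (mulf ch u) <= mass u.
Proof. by move=> Lu; rewrite -(mass_pythagoras Lu) lerDl mass_ge0. Qed.

Lemma energy_mul_grad_ch_le u Du : L2 u -> (forall i, L2 (grad_x Du i)) ->
  L2 (grad_y Du) -> energy (mul_grad ch u Du) <= energy Du + 4^-1 * mass u.
Proof.
by move=> Lu Lx Ly; rewrite -energy_pythagoras// lerDl energy_ge0.
Qed.

Lemma energy_affine l m t Du : l != 0 -> m != 0 -> l ^+ 2 = m ^+ 2 ->
  (forall i, L2 (grad_x Du i)) -> L2 (grad_y Du) ->
  energy (affine_grad l m t Du) = m ^+ 2 * (jac (N := N) l m * energy Du).
Proof.
move=> l0 m0 lm Lx Ly; rewrite /energy mulrDr mulrDr !mulr_sumr.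
have E c (w : space -> R) : L2 w -> mass (fun z => c * w (affine l m t z)) =
    c ^+ 2 * (jac (N := N) l m * mass w).
  move=> Lw; rewrite (@mass_scale _ _ c (w \o affine l m t)); last exact: L2_affine.
  by rewrite mass_affine//; exact: L2_measurable.
by congr (_ + _); [apply: eq_bigr => i _; rewrite E// lm|rewrite E].
Qed.

(** The scale invariance of the critical exponent: the Jacobian factor is n^-(N+1) and s (N+1) =
    2. *)
Lemma jac_powR (n : nat) : (0 < n)%N ->
  n%:R ^+ 2 * jac (N := N) n%:R n%:R `^ s = 1 :> R.
Proof.
move=> n0; have n1 : (0 : R) < n%:R by rewrite ltr0n.
have d0 : (N.+1%:R : R) != 0 by rewrite pnatr_eq0.
rewrite /jac gtr0_norm// -exprSr -!powR_mulrn ?ltW//.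
rewrite -[(_ `^ _)^-1]powR_inv1 ?powR_ge0// -!powRrM -powRD; last first.
  by rewrite (gt_eqF n1) implybT.
rewrite (_ : 2 + _ = 0) ?powRr0//.
by rewrite mulN1r mulrN mulrCA divff// mulr1 subrr.
Qed.

Lemma Pint_eq0 (f : space -> R) : L2 f -> mass f <= 0 -> Pint p f = 0%E.
Proof.
move=> Lf; rewrite leNgt => /negP.
move=> /(contra_not (mass_gt0P Lf).2) /contrapT f0.
have [_ H2] := ae_eq_integral_abs vol measurableT (measurable_Pint p (L2_measurable Lf)).
rewrite -[RHS]H2; last first.
  apply: filterS f0 => z /= -> _.
  by rewrite normr0 powR0// gt_eqF// crit_exp_gt0.
by apply: eq_integral => z _; rewrite gee0_abs// lee_fin powR_ge0.
Qed.

(* Concentrating [u] by the factor n+1 multiplies its energy by (n+1)^2 relative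
   to its mass, so the terms that the cutoff and [b] contribute are negligible in
   the limit. *)
Lemma GN_blowup Om O' (b k : R) : measurable O' -> O' `<=` Om -> 0 <= b ->
  (forall n, affine n.+1%:R n.+1%:R 0 @^-1` Om = Om) ->
  (forall z, Om z -> \forall n \near \oo, O' (affine_inv n.+1%:R n.+1%:R 0 z)) ->
  (forall u Du, H1 Om u Du -> 0 < mass (mulf ch (u \_ O')) ->
    GN_bound b k (mulf ch (u \_ O')) (mul_grad ch (u \_ O') (map_grad (restr O') Du))) ->
  forall u Du, H1 Om u Du -> 0 < mass u -> GN_bound 0 k u Du.
Proof.
move=> mO OO b0 inv abs H u Du hu mu.
have [[Lu Lx Ly _ _] [u0 _ _]] := hu.
pose T n := affine n.+1%:R n.+1%:R 0 : space -> space.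
have n0 n : (n.+1%:R : R) != 0 by rewrite pnatr_eq0.
have n1 n : (0 : R) < n.+1%:R by rewrite ltr0n.
pose un n := u \o T n.
pose Dn n := affine_grad n.+1%:R n.+1%:R 0 Du.
have hn n : H1 Om (un n) (Dn n).
  by rewrite -(inv n); exact: H1_affine.
pose J n := jac (N := N) n.+1%:R n.+1%:R : R.
have J0 n : 0 < J n by exact: jac_gt0.
pose w n := mulf ch (un n \_ O').
have Lw n : L2 (w n).
  apply: L2_mulf; [exact: smooth_ch|exact: norm_ch_le1|].
  by apply: L2_restrict => //; have [[]] := hn n.
(* The truncated concentrated function, dilated back to the scale of [u], where it can converge to
   [u]. *)
pose v n := w n \o affine_inv n.+1%:R n.+1%:R 0.
have wv n : w n = v n \o T n by apply/funext => z; rewrite /v /= affineK.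
have Lv n : L2 (v n) by apply: L2_affine => //; rewrite invr_eq0.
have PE n : Pint p (v n) = (((J n)^-1)%:E * Pint p (w n))%E.
  have E : Pint p (v n \o T n) = ((J n)%:E * Pint p (v n))%E.
    exact: (Pint_affine p 0 (n0 n) (n0 n) (L2_measurable (Lv n))).
  move: E; rewrite -(wv n) => ->; by rewrite muleA -EFinM mulVf ?mul1e// gt_eqF.
have Pu0 : (0 < Pint p u)%E by apply: Pint_gt0 => //; exact: crit_exp_gt0.
(* For z in [Om], v n z = ch (z.2 / (n+1)) u z as soon as z / (n+1) lies in [O'], and the first
   factor tends to ch 0 = 1. *)
have vcvg z : (`|v n z| `^ p)%:E @[n --> \oo] --> (`|u z| `^ p)%:E.
  have [Oz|Oz] := pselect (Om z); last first.
    have vz0 n : v n z = 0.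
      rewrite /v /= /w /mulf restr_out ?mulr0// => /OO; rewrite -(inv n).
      by rewrite /preimage /= affine_invK.
    by under eq_fun do rewrite vz0; rewrite u0//; exact: cvg_cst.
  have cvg_c : (n.+1%:R^-1 * z.2 : R) @[n --> \oo] --> (0 : R).
    rewrite -[X in _ --> X](mul0r z.2); apply: cvgMr_tmp; exact: cvg_harmonic.
  have cvg_ch : ch (n.+1%:R^-1 * z.2) @[n --> \oo] --> (1 : R).
    rewrite [X in _ --> X](_ : 1 = ch 0); last by rewrite /ch mul0r cos0.
    apply: (@cvg_comp _ _ _ (fun n => n.+1%:R^-1 * z.2) ch _ (nbhs (0:R))) => //.
    exact: (smooth_continuous smooth_ch).
  apply: cvg_EFin; first exact: nearW.
  have : expR (p * ln (ch (n.+1%:R^-1 * z.2))) * `|u z| `^ p @[n --> \oo] -->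
      expR (p * ln 1) * `|u z| `^ p.
    apply: cvgMr_tmp; apply: (@cvg_comp _ _ _ _ expR); last exact: continuous_expR.
    apply: cvgMl_tmp; apply: (@cvg_comp _ _ _ _ (@ln R) _ _ _ cvg_ch).
    exact: continuous_ln.
  rewrite ln1 mulr0 expR0 mul1r; apply: cvg_trans; apply: near_eq_cvg.
  have := abs z Oz; apply: filter_app.
  have : \forall n \near \oo, 0 < ch (n.+1%:R^-1 * z.2).
    by apply: cvgr_gt cvg_ch _ _.
  apply: filterS => n c0 On /=.
  rewrite /v /= /w /mulf restr_in// /un /T /= affine_invK// normrM powRM//.
  rewrite mulr0 oppr0 addr0 [`|ch _|]gtr0_norm//; congr (_ * _).
  by rewrite /powR (gt_eqF c0).
(* Fatou's lemma gives the required direction, including the case where [Pint p u] is infinite. *)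
have fat : (Pint p u <= limn_einf (fun n => Pint p (v n)))%E.
  rewrite /Pint; apply: (@le_trans _ _ (\int[vol]_z limn_einf (fun n => (`|v n z| `^ p)%:E))%E).
    rewrite le_eqVlt; apply/orP; left; apply/eqP; apply: eq_integral => z _.
    by apply/esym; apply: (cvg_limn_einf_sup _).1; exact: vcvg.
  apply: fatou; first exact: measurableT.
    by move=> n; exact: (measurable_Pint p (L2_measurable (Lv n))).
  by move=> n z _; rewrite lee_fin powR_ge0.
(* For k < 0 the hypothesis would force every [w n] to have zero mass, and then Fatou's lemma would
   give [Pint p u = 0]. *)
have k0 : 0 <= k.
  rewrite leNgt; apply/negP => k0.
  have w0 n : Pint p (w n) = 0%E.
    apply: Pint_eq0 => //; rewrite leNgt; apply/negP => wn.
    have P0 : (0 < Pint p (w n))%E by apply: Pint_gt0 => //; exact: crit_exp_gt0.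
    have := lt_le_trans P0 (H _ _ (hn n) wn); rewrite lte_fin ltNge mulr_le0_ge0//.
      exact: ltW.
    by rewrite mulr_ge0 ?powR_ge0// addr_ge0 ?energy_ge0// mulr_ge0// ltW.
  have : (Pint p u <= 0)%E.
    apply: le_trans fat _; rewrite (_ : (fun n => _) = cst 0%E).
      by rewrite (cvg_limn_einf_sup (cvg_cst _)).1.
    by apply/funext => n; rewrite PE w0 mule0.
  by rewrite leNgt Pu0.
have main n : (Pint p (v n) <= (k * ((energy Du + (4^-1 + b) * mass u / n.+1%:R ^+ 2) * mass u `^ s))%:E)%E.
  have [[Lun Lxn Lyn _ _] _] := hn n.
  have Jm : mass (un n) = J n * mass u.
    by rewrite /un mass_affine//; exact: L2_measurable.
  have Lr : L2 (un n \_ O') by exact: L2_restrict.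
  have m_le : mass (w n) <= J n * mass u.
    by rewrite -Jm; apply: le_trans (mass_mulf_ch_le Lr) _; exact: mass_restrict_le.
  have e_le : energy (mul_grad ch (un n \_ O') (map_grad (restr O') (Dn n))) <=
      n.+1%:R ^+ 2 * (J n * energy Du) + 4^-1 * (J n * mass u).
    apply: le_trans (energy_mul_grad_ch_le Lr _ _) _.
    - by move=> i; apply: L2_restrict => //; exact: Lxn.
    - by apply: L2_restrict.
    apply: lerD; last by rewrite -Jm ler_wpM2l ?invr_ge0// mass_restrict_le.
    by rewrite -(energy_affine 0)//; exact: energy_restrict_le.
  have : (Pint p (w n) <= (k * ((n.+1%:R ^+ 2 * (J n * energy Du) + 4^-1 * (J n * mass u) +
      b * (J n * mass u)) * (J n * mass u) `^ s))%:E)%E.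
    (* [H] speaks of pieces with positive mass; when the mass is 0, the left side is 0 as well. *)
    have [wn|wn] := ltP 0 (mass (w n)); last first.
      rewrite Pint_eq0// lee_fin; apply: mulr_ge0 => //; apply: mulr_ge0; last exact: powR_ge0.
      have JM : 0 <= J n * mass u by rewrite mulr_ge0 ?ltW.
      by rewrite !addr_ge0// ?mulr_ge0 ?energy_ge0// ?invr_ge0// ?sqr_ge0// ltW.
    apply: le_trans (H _ _ (hn n) wn) _; rewrite lee_fin ler_wpM2l//.
    apply: ler_pM.
    - by rewrite addr_ge0 ?energy_ge0// mulr_ge0// ltW.
    - exact: powR_ge0.
    - by apply: lerD => //; rewrite ler_wpM2l.
    - by rewrite ge0_ler_powR ?nnegrE ?(ltW s_gt0)// ?(ltW wn)// mulr_ge0 ?ltW.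
  move=> /(lee_wpmul2l (_ : 0 <= ((J n)^-1)%:E)%E) => /(_ _)/le_trans; rewrite -PE; apply.
    by rewrite lee_fin invr_ge0 ltW.
  rewrite -EFinM lee_fin.
  rewrite powRM ?(ltW (J0 n)) ?(ltW mu)//.
  (* The factor J^s = (n+1)^-2 cancels the growth of the gradient term and remains as a decaying
     factor on the mass terms. *)
  have E := jac_powR (ltn0Sn n); rewrite -/(J n) in E.
  have N0 := n0 n; have j0 := lt0r_neq0 (J0 n).
  have N2 : (n.+1%:R ^+ 2 : R) != 0 by rewrite expf_neq0.
  have -> : J n `^ s = (n.+1%:R ^+ 2)^-1.
    by apply: (mulfI N2); rewrite E divff.
  rewrite le_eqVlt; apply/orP; left; apply/eqP.
  by field; rewrite j0 addrC natr1 N0.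
rewrite /GN_bound mul0r addr0; apply: le_trans fat _.
apply: le_trans (le_limn_einf main) _.
rewrite le_eqVlt; apply/orP; left; apply/eqP; apply: (cvg_limn_einf_sup _).1.
apply: cvg_EFin; first exact: nearW.
apply: cvgMl_tmp; apply: cvgMr_tmp.
rewrite -[X in _ --> X]addr0; apply: cvgD; first exact: cvg_cst.
rewrite -[X in _ --> X](mulr0 ((4^-1 + b) * mass u)); apply: cvgMl_tmp.
rewrite -[X in _ --> X](mulr0 0) (_ : (fun n => _) = fun n => harmonic n * harmonic n).
  by apply: cvgM; exact: cvg_harmonic.
by apply/funext => n; rewrite /harmonic expr2 invfM.
Qed.

End blowup.

(** * Comparison of the constants of a strip and of its blow-up *)

Section domains.
Context {R : realType} {N : nat}.
Local Notation space := ('rV[R]_N * measurableTypeR R)%type.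
Local Notation vol := (vol R N).
Local Notation p := (crit_exp R N).
Local Notation s := (2 / N.+1%:R : R).
Implicit Types (u g : space -> R) (Om : set space) (Du : gradient R N).
Local Notation restr Om := (fun u => u \_ Om).

Definition strip_rho (a b t : R) : R := (t - a) * (b - t).

Lemma smooth_strip_rho a b : smooth (strip_rho a b).
Proof.
have sN : smooth (fun t : R => b - t).
  by rewrite (_ : (fun t => _) = fun t => (-1) * t + b);
    [exact: smooth_affine|apply/funext => t; ring].
apply: smoothM => //; apply: smoothD; [exact: smooth_id|exact: smooth_cst].
Qed.

Lemma derive_strip_rho a b t : derive1 (strip_rho a b) t = (b - t) - (t - a).
Proof.
have d : is_derive t 1 (strip_rho a b) ((b - t) - (t - a)).
  by apply: is_derive_eq; rewrite -![_ *: _]/(_ * _); ring.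
by rewrite derive1E; have := @derive_val _ _ _ _ _ _ _ d.
Qed.

Lemma above_strip_rho a b : a < b -> above (strip_rho a b) = strip a b :> set space.
Proof.
move=> ab; apply/seteqP; split=> z; rewrite /above /strip /strip_rho /=.
  by move=> h; apply/andP; split; rewrite ltNge; apply/negP => ?; nra.
by move=> /andP[h1 h2]; rewrite mulr_gt0// subr_gt0.
Qed.

Lemma smooth_idfun : smooth (@idfun R). Proof. exact: smooth_id. Qed.

Lemma measurable_strip a b : measurable (strip a b : set space).
Proof.
rewrite (_ : strip a b = setT `*` `]a, b[%classic); first exact: measurableX.
by apply/seteqP; split=> z /=; rewrite /strip /= in_itv/=; [split|case].
Qed.

Lemma measurable_half : measurable (half_space R N).
Proof.
rewrite (_ : half_space R N = setT `*` `]0, +oo[%classic); first exact: measurableX.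
by apply/seteqP; split=> z /=; rewrite /half_space /= in_itv/= andbT; [split|case].
Qed.

(** Derivatives along the boundary do not see a cutoff in y, so the bound of [wd_boundary] holds
    with C = 0 for every test function. *)
Lemma wd_x_above rho i u Du Om phi : smooth rho -> H1 (above rho) u Du ->
  test_function Om phi -> wd (dir_x R i) u (grad_x Du i) phi.
Proof.
move=> srho [[Lu Lx _ Wx _] [u0 gx0 _]] tphi.
apply: (@wd_boundary _ _ rho _ _ _ Om phi 0) => //.
- exact: Wx.
- by move=> z _; rewrite /= !mul0r normr0.
Qed.

Lemma wd_y_above rho u Du Om phi (C : R) : smooth rho -> H1 (above rho) u Du ->
  test_function Om phi ->
  (forall z, above rho z -> `|derive1 rho z.2 * phi z| <= C * rho z.2) ->
  wd (dir_y R N) u (grad_y Du) phi.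
Proof.
move=> srho [[Lu _ Ly _ Wy] [u0 _ gy0]] tphi HC.
apply: (@wd_boundary _ _ rho _ _ _ Om phi C) => //.
by move=> z Oz; rewrite mul1r; exact: HC.
Qed.

Lemma test_function_mulT Om eta phi : smooth eta -> test_function Om phi ->
  test_function Om (fun z => eta z.2 * phi z).
Proof.
move=> se; apply: (@test_functionM _ _ _ _ setT) => //.
by move=> t [].
Qed.

(** The mean value theorem in y. It yields linear decay at y = 0 both for test functions of the
    half-space and for the odd differences used with the even reflection. *)
Lemma test_function_lipschitz Om phi : test_function Om phi ->
  exists2 C, 0 <= C & forall x y y', `|phi (x, y) - phi (x, y')| <= C * `|y - y'|.
Proof.
move=> tphi; have [_ /(_ (dir_y R N))[C HC]] := test_function_bounded tphi.
have C0 : 0 <= C by apply: le_trans (HC 0).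
exists C => // x.
have d (t : R) : is_derive t 1 (fun t : R => phi (x, t) : R)
    ('D_(dir_y R N) phi (x, t) : R).
  have dphi : derivable phi ((x, t) : space) (dir_y R N).
    by apply: diff_derivable; exact: (test_function_differentiable tphi).
  have E : (fun h : R => h^-1 *: (((fun t : R => phi (x, t)) \o shift t) (h *: (1 : R)) - phi (x, t)))
     = (fun h : R => h^-1 *: ((phi \o shift ((x, t) : space)) (h *: dir_y R N) - phi (x, t))).
    apply/funext => h /=; congr (_ *: (phi _ - _)); congr pair => /=.
    by rewrite scaler0 add0r.
  by apply: DeriveDef; rewrite /derivable /derive E.
have main y y' : y <= y' -> `|phi (x, y') - phi (x, y)| <= C * `|y' - y|.
  move=> yy; have [|c _ ->] := @MVT_segment R _ _ y y' yy (fun t _ => d t).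
    apply: continuous_subspaceT => t; apply: differentiable_continuous.
    by apply/derivable1_diffP; have [] := d t.
  by rewrite normrM ler_wpM2r.
move=> y y'; have [yy|/ltW yy] := leP y' y; first exact: main.
by rewrite distrC [`|y - y'|]distrC; exact: main.
Qed.

Lemma H1_ch Om u Du : H1 Om u Du -> H1 Om (mulf ch u) (mul_grad ch u Du).
Proof.
move=> [[Lu Lx Ly Wx Wy] van]; apply: H1_mulf => //.
- exact: smooth_ch.
- exact: norm_ch_le1.
- exact: norm_derive_ch_le1.
- by move=> i phi tphi; apply: Wx; apply: test_function_mulT => //; exact: smooth_ch.
- by move=> phi tphi; apply: Wy; apply: test_function_mulT => //; exact: smooth_ch.
Qed.

Let pi0 := pi_gt0 R.

(** Here rho = (pi - |t|) (pi + |t|) and |rho'| = 2 |t|, so that |rho'| ch <= |t| (pi - |t|) <= rho: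
    the decay of [ch] admits an arbitrary bounded [phi]. *)
Lemma wd_y_strip_ch u Du Om phi : H1 (strip (- pi) pi) u Du ->
  test_function Om phi ->
  wd (dir_y R N) u (grad_y Du) (fun z => ch z.2 * phi z).
Proof.
have Npp : - pi < pi :> R by rewrite gtrN.
rewrite -(above_strip_rho Npp) => hu tphi.
have [[C HC] _] := test_function_bounded tphi.
have C0 : 0 <= C by apply: le_trans (HC 0).
apply: (@wd_y_above _ _ _ Om _ C) hu _ _; first exact: smooth_strip_rho.
  by apply: test_function_mulT => //; exact: smooth_ch.
move=> z; rewrite above_strip_rho// => /andP[z1 z2].
have zp : `|z.2| < pi by rewrite ltr_norml z1.
have [c1 c2] := ch_le zp; have c0 := ch_gt0 zp.
rewrite derive_strip_rho mulrA normrM mulrC ler_pM// normrM (gtr0_norm c0).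
rewrite /strip_rho opprK (_ : _ - _ - _ = - (2 * z.2)); last by ring.
rewrite normrN normrM ger0_norm//.
have [z0|z0] := leP 0 z.2.
  by rewrite ger0_norm//; nra.
by rewrite ltr0_norm//; nra.
Qed.

Lemma H1_strip_ch u Du : H1 (strip (- pi) pi) u Du ->
  H1 (whole_space R N) (mulf ch u) (mul_grad ch u Du).
Proof.
move=> hu; have [[Lu Lx Ly Wx Wy] van] := hu.
apply: H1_mulf => //.
- exact: smooth_ch.
- exact: norm_ch_le1.
- exact: norm_derive_ch_le1.
- by split=> [z []|i z []|z []].
- move=> i phi tphi; have Npp : - pi < pi :> R by rewrite gtrN.
  move: hu; rewrite -(above_strip_rho Npp) => hu.
  apply: wd_x_above hu _; first exact: smooth_strip_rho.
  by apply: test_function_mulT tphi; exact: smooth_ch.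
- by move=> phi tphi; exact: wd_y_strip_ch hu tphi.
Qed.

(** The decay comes from [phi] at y = 0 and from [ch] at y = pi. The constant C pi / 2 is the
    product of |rho'| = |pi - 2t| <= pi, ch <= (pi - t)/2 and |phi| <= C t, divided by rho = t (pi -
    t). *)
Lemma wd_y_half_strip_ch u Du phi : H1 (strip 0 pi) u Du ->
  test_function (half_space R N) phi ->
  wd (dir_y R N) u (grad_y Du) (fun z => ch z.2 * phi z).
Proof.
rewrite -(above_strip_rho pi0) => hu tphi.
have [C C0 HC] := test_function_lipschitz tphi.
have phi0 x : phi (x, 0) = 0.
  have [_ [K [_ KO K0]]] := tphi; apply: K0 => /KO.
  by rewrite /half_space /= ltxx.
have bnd z : 0 < z.2 -> `|phi z| <= C * z.2.
  by case: z => x y /= y0; have := HC x y 0; rewrite phi0 !subr0 (gtr0_norm y0).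
apply: (@wd_y_above _ _ _ (half_space R N) _ (C * pi / 2)) hu _ _; first exact: smooth_strip_rho.
  by apply: test_function_mulT => //; exact: smooth_ch.
move=> z; rewrite above_strip_rho// => /andP[z1 z2].
have zp : `|z.2| < pi by rewrite gtr0_norm.
have [c1 _] := ch_le zp; have c0 := ch_gt0 zp.
rewrite derive_strip_rho mulrA normrM [leRHS](_ : _ = (pi * ((pi - z.2) / 2)) * (C * z.2)); last first.
  by rewrite /strip_rho subr0; field.
apply: ler_pM => //; last exact: bnd.
rewrite normrM (gtr0_norm c0); apply: ler_pM => //; first exact: ltW.
by rewrite subr0 ler_norml; apply/andP; split; lra.
Qed.

Lemma H1_half_strip_ch u Du : H1 (strip 0 pi) u Du ->
  H1 (half_space R N) (mulf ch u) (mul_grad ch u Du).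
Proof.
move=> hu; have [[Lu Lx Ly Wx Wy] [u0 gx0 gy0]] := hu.
have sub z : ~ half_space R N z -> ~ strip 0 pi z.
  by move=> nz /andP[z0 _]; exact: nz.
apply: H1_mulf => //.
- exact: smooth_ch.
- exact: norm_ch_le1.
- exact: norm_derive_ch_le1.
- by split=> [z /sub|i z /sub|z /sub]; [exact: u0|exact: gx0|exact: gy0].
- move=> i phi tphi; move: hu; rewrite -(above_strip_rho pi0) => hu.
  apply: wd_x_above hu _; first exact: smooth_strip_rho.
  by apply: test_function_mulT tphi; exact: smooth_ch.
- by move=> phi tphi; exact: wd_y_half_strip_ch hu tphi.
Qed.

Lemma near_affine_inv (z : space) (a b : R) : a < 0 < b ->
  \forall n \near \oo, strip a b (affine_inv n.+1%:R n.+1%:R 0 z).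
Proof.
move=> /andP[a0 b0].
have cvg_c : (n.+1%:R^-1 * z.2 : R) @[n --> \oo] --> (0 : R).
  rewrite -[X in _ --> X](mul0r z.2); apply: cvgMr_tmp; exact: cvg_harmonic.
near=> n; rewrite /strip /affine_inv /affine /= mulr0 oppr0 addr0.
by apply/andP; split; near: n; [exact: (cvgr_gt _ cvg_c)|exact: (cvgr_lt _ cvg_c)].
Unshelve. all: by end_near.
Qed.

Lemma K_whole_le_cylinder (B k : R) : 0 <= B ->
  (K_cylinder N (- pi) pi B <= k%:E)%E -> (K_domain (whole_space R N) <= k%:E)%E.
Proof.
move=> B0 Kk; apply/K_domain_le.
apply: (@GN_blowup _ _ _ (strip (- pi) pi) (B / (pi - - pi) ^+ 2)).
- exact: measurable_strip.
- by [].
- by rewrite divr_ge0// sqr_ge0.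
- by [].
- by move=> z _; apply: near_affine_inv; rewrite oppr_lt0 pi0.
move=> u Du hu mu; have hv := H1_restrict (measurable_strip (- pi) pi) (@subsetT _ _) hu.
(* Multiplication by [ch] makes both traces 0, hence equal, so the truncated function is admissible
   on the cylinder. *)
apply: (K_cylinder_ge B0 Kk) => //; first exact: H1_ch.
move=> phi tphi; apply: (wd_y_mul_grad smooth_ch tphi).
exact: wd_y_strip_ch hv tphi.
Qed.

Lemma K_half_le_segment (B k : R) : 0 <= B ->
  (K_segment N 0 pi B <= k%:E)%E -> (K_domain (half_space R N) <= k%:E)%E.
Proof.
move=> B0 /(K_segment_le _ _ _ B0) Kk; apply/K_domain_le.
apply: (@GN_blowup _ _ _ (strip 0 pi) (B / (pi - 0) ^+ 2)).
- exact: measurable_strip.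
- by move=> z /andP[].
- by rewrite divr_ge0// sqr_ge0.
- move=> n; apply/seteqP; split=> z; rewrite /half_space /affine /= addr0.
    by rewrite pmulr_rgt0// ltr0n.
  by move=> z0; rewrite mulr_gt0// ltr0n.
(* Here z.2 > 0 settles the lower end y = 0, so any negative number can replace it in
   [near_affine_inv]. *)
- move=> z z0; have : \forall n \near \oo, strip (-1) pi (affine_inv n.+1%:R n.+1%:R 0 z).
    by apply: near_affine_inv; rewrite oppr_lt0 ltr01 pi0.
  apply: filterS => n /andP[_ z2]; apply/andP; split=> //.
  by rewrite /affine_inv /affine /= mulr0 oppr0 addr0 mulr_gt0// invr_gt0 ltr0n.
move=> u Du hu mu; apply: Kk => //.
apply: H1_ch; apply: H1_restrict hu; first exact: measurable_strip.
by move=> z /andP[].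
Qed.

End domains.

(** * Upper bounds for the strips: reflection of the segment, translation of the cylinder *)

Section upper.
Context {R : realType} {N : nat}.
Local Notation space := ('rV[R]_N * measurableTypeR R)%type.
Local Notation vol := (vol R N).
Local Notation p := (crit_exp R N).
Local Notation s := (2 / N.+1%:R : R).
Implicit Types (u g f : space -> R) (Om : set space) (Du : gradient R N).
Local Notation restr Om := (fun u => u \_ Om).
Let pi0 := pi_gt0 R.

(** [ch] is positive where [u] can be nonzero. Positive mass of both pieces puts the share t of
    [GN_combine] strictly between 0 and 1. *)
Lemma mass_mulf_ch_gt0 u : L2 u -> (forall z, pi <= `|z.2| -> u z = 0) ->
  0 < mass u -> 0 < mass (mulf ch u).
Proof.
move=> Lu u0 /(mass_gt0P Lu) nu.
have Lc : L2 (mulf ch u) by apply: L2_mulf => //; [exact: smooth_ch|exact: norm_ch_le1].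
apply/(mass_gt0P Lc); apply: contra_not nu; apply: filterS => z /eqP.
rewrite mulf_eq0 => /orP[/eqP c0|/eqP//].
have [zp|/u0//] := ltP `|z.2| pi.
by have := ch_gt0 zp; rewrite c0 ltxx.
Qed.

Lemma GN_bound_eq (b k : R) u (v : space -> R) Du (Dv : gradient R N) : Pint p u = Pint p v -> mass u = mass v ->
  energy Du = energy Dv -> GN_bound b k u Du -> GN_bound b k v Dv.
Proof. by rewrite /GN_bound => -> -> ->. Qed.

(** [B] denotes the coefficient of the mass here, that is, the parameter already divided by the
    squared width. *)
Lemma GN_strip (k B : R) u Du : 4^-1 <= B -> L2 u -> (forall i, L2 (grad_x Du i)) ->
  L2 (grad_y Du) -> 0 < mass (mulf ch u) -> 0 < mass (mulf sh u) ->
  GN_bound 0 k (mulf ch u) (mul_grad ch u Du) ->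
  GN_bound 0 k (mulf sh u) (mul_grad sh u Du) -> GN_bound B k u Du.
Proof.
move=> B4 Lu Lx Ly m1 m2.
apply: GN_combine => //.
- exact: L2_measurable.
- by apply: L2_mulf => //; [exact: smooth_ch|exact: norm_ch_le1].
- by apply: L2_mulf => //; [exact: smooth_sh|exact: norm_sh_le1].
- by move=> z; rewrite /mulf !exprMn -mulrDl ch2Dsh2 mul1r.
- exact: mass_pythagoras.
- by rewrite energy_pythagoras// lerD2l ler_wpM2r// mass_ge0.
Qed.

Lemma K_segment_le_half (B k : R) : 4^-1 <= B / (pi - 0) ^+ 2 -> 0 <= B ->
  (K_domain (half_space R N) <= k%:E)%E -> (K_segment N 0 pi B <= k%:E)%E.
Proof.
move=> B4 B0 /K_domain_le Kk; apply/K_segment_le => // u Du hu mu.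
have [[Lu Lx Ly _ _] [u0 _ _]] := hu.
(* The reflection y -> pi - y exchanges [ch] and [sh], which moves the zero of [sh] at y = 0 to the
   end y = pi. *)
pose T : space -> space := affine 1 (-1) pi.
have n1 : (-1 : R) != 0 by rewrite oppr_eq0 oner_neq0.
have i1 : (1 : R) != 0 by exact: oner_neq0.
have j1 : jac (N := N) (1 : R) (-1) = 1 by rewrite /jac normrN !normr1 expr1n mulr1 invr1.
have hv := H1_affine pi i1 n1 hu.
rewrite (_ : _ @^-1` _ = strip 0 pi) in hv; last first.
  apply/seteqP; split=> z; rewrite /strip /affine /= => /andP[z1 z2];
    apply/andP; split; lra.
have small v : vanish (strip 0 pi) v -> forall z, pi <= `|z.2| -> v z = 0.
  move=> v0 z pz; apply: v0 => /andP[z1 z2]; move: pz.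
  by rewrite gtr0_norm// leNgt z2.
have E w : mulf ch (w \o T) = mulf sh w \o T.
  by apply/funext => z; rewrite /mulf /= mulN1r addrC sh_pi_sub.
have [[Lv Lvx Lvy _ _] [v0 _ _]] := hv.
have Lsu : L2 (mulf sh u) by apply: L2_mulf => //; [exact: smooth_sh|exact: norm_sh_le1].
have Lshx i : L2 (mulf sh (grad_x Du i)).
  by apply: L2_mulf => //; [exact: smooth_sh|exact: norm_sh_le1].
have Lshy : L2 (grad_y (mul_grad sh u Du)).
  apply: L2_mul_grad_y => //; [exact: smooth_sh|exact: norm_sh_le1|exact: norm_derive_sh_le1].
have mE : mass (mulf ch (u \o T)) = mass (mulf sh u).
  by rewrite E mass_affine// ?j1 ?mul1r//; exact: L2_measurable.
have mv : 0 < mass (mulf ch (u \o T)).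
  apply: mass_mulf_ch_gt0 => //; first exact: small v0.
  by rewrite mass_affine ?j1 ?mul1r//; exact: L2_measurable.
have mc : 0 < mass (mulf ch u) by apply: mass_mulf_ch_gt0 => //; exact: small u0.
apply: GN_strip => //; first by rewrite -mE.
  by apply: Kk => //; exact: H1_half_strip_ch.
apply: GN_bound_eq (Kk _ _ (H1_half_strip_ch hv) mv) => //.
  by rewrite E Pint_affine ?j1 ?mul1e//; exact: L2_measurable.
have Ex i : mulf ch (fun z => 1 * grad_x Du i (T z)) = mulf sh (grad_x Du i) \o T.
  by rewrite -E; apply/funext => z; rewrite /mulf mul1r.
rewrite /energy /=; congr (_ + _).
  by apply: eq_bigr => i _; rewrite Ex mass_affine ?j1 ?mul1r//; exact: L2_measurable.
(* The y-derivative changes sign under the reflection; its square does not. *)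
rewrite (_ : (fun z => _) = (fun z => (-1) * (grad_y (mul_grad sh u Du) \o T) z)).
  rewrite mass_scale; last exact: L2_affine.
  by rewrite sqrrN expr1n mul1r mass_affine ?j1 ?mul1r//; exact: L2_measurable.
apply/funext => z; rewrite /= derive_ch derive_sh.
have -> : -1 * z.2 + pi = pi - z.2 by ring.
by rewrite sh_pi_sub ch_pi_sub; ring.
Qed.

(* The translation by pi of a function on the cylinder obtained by gluing
   y = -pi and y = pi. *)
Definition swap f : space -> R := fun z =>
  if 0 < z.2 < pi then f (affine 1 1 (- pi) z)
  else if - pi < z.2 < 0 then f (affine 1 1 pi z) else 0.

Lemma in_strip a b (z : space) : (z \in strip a b) = (a < z.2 < b).
Proof. by apply/idP/idP; rewrite inE. Qed.

(** As a sum of translated restrictions, [swap f] becomes accessible to the change of variables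
    formula. *)
Lemma swapE f : swap f = fun z =>
  (f \_ (strip (- pi) 0)) (affine 1 1 (- pi) z) +
  (f \_ (strip 0 pi)) (affine 1 1 pi z).
Proof.
apply/funext => z; rewrite /swap !restrE !in_strip /affine /= !mul1r.
rewrite (_ : (- pi < z.2 - pi < 0) = (0 < z.2 < pi)); last first.
  by apply/idP/idP => /andP[h1 h2]; apply/andP; split; lra.
rewrite (_ : (0 < z.2 + pi < pi) = (- pi < z.2 < 0)); last first.
  by apply/idP/idP => /andP[h1 h2]; apply/andP; split; lra.
case: ifPn => [/andP[h1 h2]|_]; last by rewrite add0r.
by rewrite ifF ?addr0//; apply/negbTE/negP => /andP[h3 h4]; lra.
Qed.

Lemma swap_comp (G : R -> R) f z : G 0 = 0 -> swap (G \o f) z = G (swap f z).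
Proof. by move=> G0; rewrite /swap; case: ifP => // _; case: ifP. Qed.

Let i1 : (1 : R) != 0. Proof. exact: oner_neq0. Qed.

Let j1 : jac (N := N) (1 : R) 1 = 1.
Proof. by rewrite /jac !normr1 expr1n mulr1 invr1. Qed.

Lemma ae_off_hyperplane (t : R) : {ae vol, forall z : space, z.2 <> t}.
Proof.
exists [set z : space | z.2 = t]; split.
- rewrite (_ : [set _ | _] = setT `*` [set t]); first exact: measurableX.
  by apply/seteqP; split=> z //= [].
- exact: vol_hyperplane.
- by move=> z /= /contrapT.
Qed.

Lemma split_strip f (z : space) : vanish (strip (- pi) pi) f -> z.2 <> 0 ->
  f z = (f \_ (strip (- pi) 0)) z + (f \_ (strip 0 pi)) z.
Proof.
move=> f0 z0; rewrite !restrE !in_strip.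
have [zp|zp|//] := ltgtP z.2 0.
  rewrite /= andbT addr0; case: ifPn => // h; apply: f0 => /andP[h1 _].
  by rewrite h1 in h.
rewrite /= andbF add0r; case: ifPn => // h; apply: f0 => /andP[_ h1].
by rewrite h1 in h.
Qed.

(** The two halves trade places by translations; the hyperplane y = 0, which belongs to neither, has
    measure 0. *)
Lemma ge0_integral_swap f : measurable_fun setT f -> (forall z, 0 <= f z) ->
  vanish (strip (- pi) pi) f ->
  (\int[vol]_z (swap f z)%:E = \int[vol]_z (f z)%:E)%E.
Proof.
move=> mf f0 fv.
have mr a b : measurable_fun setT (f \_ (strip a b)).
  by apply/(measurable_restrictT _ (measurable_strip _ _)); exact: measurable_funTS.
have r0 a b z : 0 <= (f \_ (strip a b)) z by rewrite restrE; case: ifP.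
have mra a b t : measurable_fun setT (fun z => ((f \_ (strip a b)) (affine 1 1 t z))%:E).
  apply/measurable_EFinP; exact: (measurableT_comp (mr a b) (measurable_affine _ _ _)).
have sa a b t : (\int[vol]_z ((f \_ (strip a b)) (affine 1 1 t z))%:E =
    \int[vol]_z ((f \_ (strip a b)) z)%:E)%E.
  rewrite (@ge0_integral_affine _ _ 1 1 t (fun z => ((f \_ (strip a b)) z)%:E))//.
  - by rewrite -[X in X%:E]/(jac 1 1) j1 mul1e.
  - exact/measurable_EFinP.
  - by move=> z; rewrite lee_fin.
rewrite swapE; under eq_integral do rewrite EFinD.
rewrite ge0_integralD//; try (by move=> z _; rewrite lee_fin).
rewrite !sa -ge0_integralD//; try (by move=> z _; rewrite lee_fin); try exact/measurable_EFinP.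
apply: ge0_ae_eq_integral => //.
- by apply: emeasurable_funD; exact/measurable_EFinP.
- exact/measurable_EFinP.
- by move=> z _; rewrite adde_ge0// lee_fin.
- by move=> z _; rewrite lee_fin.
- by apply: filterS (ae_off_hyperplane 0) => z z0 _; rewrite -EFinD -split_strip.
Qed.

Lemma Rintegral_swap f : measurable_fun setT f -> vanish (strip (- pi) pi) f ->
  \int[vol]_z swap f z = \int[vol]_z f z.
Proof.
move=> mf fv; rewrite /Rintegral; congr fine; rewrite integralE [RHS]integralE.
congr (_ - _)%E.
- rewrite (eq_integral (fun z => (swap (fun z => Num.max (f z) 0) z)%:E)); last first.
    move=> z _; rewrite (swap_comp (G := fun x => Num.max x 0)) ?maxxx//.
    by rewrite funeposE EFin_max.
  rewrite ge0_integral_swap.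
  - by apply: eq_integral => z _; rewrite funeposE EFin_max.
  - exact: measurable_maxr.
  - by move=> z; rewrite le_max lexx orbT.
  - by move=> z /fv ->; rewrite maxxx.
- rewrite (eq_integral (fun z => (swap (fun z => Num.max (- f z) 0) z)%:E)); last first.
    move=> z _; rewrite (swap_comp (G := fun x => Num.max (- x) 0)) ?oppr0 ?maxxx//.
    by rewrite funenegE EFin_max.
  rewrite ge0_integral_swap.
  - by apply: eq_integral => z _; rewrite funenegE EFin_max.
  - by apply: measurable_maxr => //; exact: measurableT_comp.
  - by move=> z; rewrite le_max lexx orbT.
  - by move=> z /fv ->; rewrite oppr0 maxxx.
Qed.

Lemma L2_swap f : L2 f -> L2 (swap f).
Proof.
move=> Lf; rewrite swapE; apply: L2D.
  exact: (L2_affine _ i1 i1 (L2_restrict (measurable_strip _ _) Lf)).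
exact: (L2_affine _ i1 i1 (L2_restrict (measurable_strip _ _) Lf)).
Qed.

Lemma vanish_swap f : vanish (strip (- pi) pi) (swap f).
Proof.
move=> z nz; rewrite /swap.
case: ifPn => [/andP[h1 h2]|_].
  by exfalso; apply: nz; apply/andP; split=> //; lra.
case: ifPn => [/andP[h1 h2]|//].
by exfalso; apply: nz; apply/andP; split=> //; lra.
Qed.

(** Only absolute values are compared because [mulf ch (swap w)] and [swap (mulf sh w)] have
    opposite signs on the upper half, where sh (t - pi) = - ch t. *)
Lemma mass_swap F f : L2 f -> vanish (strip (- pi) pi) f ->
  (forall z, `|F z| = `|swap f z|) -> mass F = mass f.
Proof.
move=> Lf f0 E; rewrite /mass -[RHS]Rintegral_swap.
- apply: eq_Rintegral => z _; rewrite (swap_comp (G := fun x => x ^+ 2)) ?expr0n//.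
  by rewrite -[LHS]real_normK ?num_real// E real_normK ?num_real.
- by apply: measurable_funX; exact: L2_measurable.
- by move=> z /f0 ->; rewrite expr0n.
Qed.

Lemma Pint_swap F f : L2 f -> vanish (strip (- pi) pi) f ->
  (forall z, `|F z| = `|swap f z|) -> Pint p F = Pint p f.
Proof.
move=> Lf f0 E; rewrite /Pint -[RHS]ge0_integral_swap.
- apply: eq_integral => z _; rewrite (swap_comp (G := fun x => `|x| `^ p)) ?E//.
  by rewrite normr0 powR0// gt_eqF// crit_exp_gt0.
- by apply/measurable_EFinP; apply: measurable_Pint; exact: L2_measurable.
- by move=> z; rewrite powR_ge0.
- by move=> z /f0 ->; rewrite normr0 powR0// gt_eqF// crit_exp_gt0.
Qed.

(** The translation is moved to the test function. Its translate takes the value phi (x, 0) on both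
    sides of the seam, so the gluing condition on [u] applies to it. *)
Lemma wd_swap v u g (phi : space -> R) : L2 u -> L2 g ->
  vanish (strip (- pi) pi) u -> vanish (strip (- pi) pi) g ->
  test_function (strip (- pi) pi) phi ->
  (forall psi, test_function (whole_space R N) psi ->
    (forall x, psi (x, - pi) = psi (x, pi)) -> wd v u g psi) ->
  wd v (swap u) (swap g) phi.
Proof.
move=> Lu Lg u0 g0 tphi W.
have [_ [K [cK KO K0]]] := tphi.
have far1 (t : R) : 0 < t < pi -> ~ (- pi < t + (- pi - pi) < pi).
  by move=> /andP[h1 h2] /andP[h3 h4]; lra.
have far2 (t : R) : - pi < t < 0 -> ~ (- pi < t + (pi + pi) < pi).
  by move=> /andP[h1 h2] /andP[h3 h4]; lra.
(* On the strip at most one of the two terms is nonzero, and [psi] takes the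
   same values at y = -pi and y = pi. *)
pose psi z := phi (affine 1 1 pi z) + phi (affine 1 1 (- pi) z).
have ta t : test_function (whole_space R N) (phi \o affine 1 1 t).
  exact: test_function_sub (@subsetT _ _) (test_function_affine t i1 i1 tphi).
have tpsi : test_function (whole_space R N) psi by exact: (test_functionD (ta pi) (ta (- pi))).
have phi_out z : ~ strip (- pi) pi z -> phi z = 0 /\ 'D_v phi z = 0.
  move=> nz; have Kz : ~ K z by move/KO.
  by split; [exact: K0|exact: (derive_outside v cK K0 Kz)].
have dpsi z : 'D_v psi z = 'D_v phi (affine 1 1 pi z) + 'D_v phi (affine 1 1 (- pi) z).
  rewrite /psi deriveD; last 2 first.
  - by apply: diff_derivable; exact: (test_function_differentiable (ta _)).
  - by apply: diff_derivable; exact: (test_function_differentiable (ta _)).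
  rewrite !derive_affine (_ : linpart 1 1 v = v)//.
  by case: v {W phi_out} => v1 v2; rewrite /linpart /= scale1r mul1r.
have Wpsi : wd v u g psi.
  apply: W => // x; rewrite /psi /affine /= !scale1r !mul1r subrr addNr.
  have [-> _] : phi (x, pi + pi) = 0 /\ 'D_v phi (x, pi + pi) = 0.
    by apply: phi_out; rewrite /strip /= => /andP[h1 h2]; lra.
  have [-> _] : phi (x, - pi - pi) = 0 /\ 'D_v phi (x, - pi - pi) = 0.
    by apply: phi_out; rewrite /strip /= => /andP[h1 h2]; lra.
  by rewrite addr0 add0r.
pose h z := u z * 'D_v psi z + g z * psi z.
rewrite /wd -[RHS]Wpsi -[RHS](@Rintegral_swap h).
- apply: eq_Rintegral => z _.
  have aa (t t' : R) : affine 1 1 t (affine 1 1 t' z) = (z.1, (z.2 : R) + (t' + t)).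
    by rewrite /affine /= !scale1r !mul1r addrA.
  have zE : (z.1, (z.2 : R) + 0) = z by rewrite addr0; case: (z).
  rewrite /swap; case: ifPn => [z0|_]; last case: ifPn => [z0|_].
  + have [p1 p2] : phi (z.1, (z.2 : R) + (- pi - pi)) = 0 /\
        'D_v phi (z.1, (z.2 : R) + (- pi - pi)) = 0.
      by apply: phi_out; exact: far1 z0.
    by rewrite /h dpsi /psi !aa addNr zE p1 p2 !addr0.
  + have [p1 p2] : phi (z.1, (z.2 : R) + (pi + pi)) = 0 /\
        'D_v phi (z.1, (z.2 : R) + (pi + pi)) = 0.
      by apply: phi_out; exact: far2 z0.
    by rewrite /h dpsi /psi !aa subrr zE p1 p2 !add0r.
  + by rewrite !mul0r addr0.
- by apply/measurable_EFinP; exact: measurable_int (wd_integrable v Lu Lg tpsi).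
- by move=> z nz; rewrite /h u0// g0// !mul0r addr0.
Qed.

Lemma H1_swap u Du : H1 (strip (- pi) pi) u Du ->
  (forall phi, test_function (whole_space R N) phi ->
     (forall x, phi (x, - pi) = phi (x, pi)) -> wd (dir_y R N) u (grad_y Du) phi) ->
  H1 (strip (- pi) pi) (swap u) (map_grad swap Du).
Proof.
move=> hu Wc; have [[Lu Lx Ly Wx Wy] [u0 gx0 gy0]] := hu.
split; last by split=> [|i|]; exact: vanish_swap.
split=> /=.
- exact: L2_swap.
- by move=> i; exact: L2_swap.
- exact: L2_swap.
- move=> i phi tphi; apply: wd_swap => // psi tpsi _.
  have Npp : - pi < pi :> R by rewrite gtrN.
  move: hu; rewrite -(above_strip_rho Npp) => hu.
  by apply: wd_x_above hu tpsi; exact: smooth_strip_rho.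
- by move=> phi tphi; exact: wd_swap.
Qed.

Lemma K_cylinder_le_whole (B k : R) : 4^-1 <= B / (pi - - pi) ^+ 2 -> 0 <= B ->
  (K_domain (whole_space R N) <= k%:E)%E -> (K_cylinder N (- pi) pi B <= k%:E)%E.
Proof.
move=> B4 B0 /K_domain_le Kk; apply: K_cylinder_le => // u Du hu Wc mu.
have [[Lu Lx Ly _ _] [u0 gx0 gy0]] := hu.
have hv := H1_swap hu Wc.
have [[Lv Lvx Lvy _ _] [v0 _ _]] := hv.
have small v : vanish (strip (- pi) pi) v -> forall z, pi <= `|z.2| -> v z = 0.
  by move=> w0 z pz; apply: w0 => /andP[z1 z2]; move: pz; rewrite leNgt ltr_norml z1 z2.
have Esh w z : `|mulf ch (swap w) z| = `|swap (mulf sh w) z|.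
  rewrite /mulf /swap; case: ifP => _; last case: ifP => _.
  - by rewrite /affine /= !mul1r sh_sub_pi mulNr normrN.
  - by rewrite /affine /= !mul1r sh_add_pi.
  - by rewrite mulr0.
have van w : vanish (strip (- pi) pi) w -> vanish (strip (- pi) pi) (mulf sh w).
  by move=> w0 z /w0; rewrite /mulf => ->; rewrite mulr0.
have Lsh w : L2 w -> L2 (mulf sh w).
  by move=> Lw; apply: L2_mulf => //; [exact: smooth_sh|exact: norm_sh_le1].
have mE : mass (mulf ch (swap u)) = mass (mulf sh u).
  by apply: mass_swap => //; [exact: Lsh|exact: van].
have mv0 : mass (swap u) = mass u by exact: mass_swap.
have mv : 0 < mass (mulf ch (swap u)).
  by apply: mass_mulf_ch_gt0 => //; [exact: small|rewrite mv0].
have mc : 0 < mass (mulf ch u) by apply: mass_mulf_ch_gt0 => //; exact: small.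
apply: GN_strip => //; first by rewrite -mE.
  by apply: Kk => //; exact: H1_strip_ch.
apply: GN_bound_eq (Kk _ _ (H1_strip_ch hv) mv) => //.
  by apply: Pint_swap => //; [exact: Lsh|exact: van].
rewrite /energy /=; congr (_ + _).
  by apply: eq_bigr => i _; apply: mass_swap => //; [exact: Lsh|exact: van].
apply: mass_swap.
- exact: (L2_mul_grad_y smooth_sh (@norm_sh_le1 R) (@norm_derive_sh_le1 R) Lu Ly).
- by move=> z nz; rewrite u0// gy0// !mulr0 addr0.
- move=> z; rewrite /swap; case: ifP => _; last case: ifP => _.
  + rewrite derive_ch derive_sh /affine /= !mul1r sh_sub_pi ch_sub_pi -normrN.
    by congr `|_|; ring.
  + by rewrite derive_ch derive_sh /affine /= !mul1r sh_add_pi ch_add_pi; congr `|_|; ring.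
  + by rewrite !mulr0 addr0.
Qed.

End upper.

(** * The half-space *)

Section reflection.
Context {R : realType} {N : nat}.
Local Notation space := ('rV[R]_N * measurableTypeR R)%type.
Local Notation vol := (vol R N).
Local Notation p := (crit_exp R N).
Local Notation s := (2 / N.+1%:R : R).
Implicit Types (u g f : space -> R) (Om : set space) (Du : gradient R N).

Let i1 : (1 : R) != 0. Proof. exact: oner_neq0. Qed.
Let n1 : (-1 : R) != 0. Proof. by rewrite oppr_eq0 oner_neq0. Qed.
Let j1 : jac (N := N) (1 : R) (-1) = 1.
Proof. by rewrite /jac normrN !normr1 expr1n mulr1 invr1. Qed.

Definition refl : space -> space := affine 1 (-1) 0.

Lemma reflE z : refl z = (z.1, - z.2 : R).
Proof. by rewrite /refl /affine scale1r mulN1r addr0. Qed.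

Lemma reflK : involutive refl.
Proof. by move=> z; rewrite !reflE opprK; case: z. Qed.

Lemma refl_orth f z : vanish (half_space R N) f -> f z * f (refl z) = 0.
Proof.
move=> f0; have [z0|z0] := ltP 0 z.2; last first.
  by rewrite f0 ?mul0r// /half_space /= ltNge z0.
have -> : f (refl z) = 0; last by rewrite mulr0.
by apply: f0; rewrite reflE /half_space /= oppr_gt0 ltNge (ltW z0).
Qed.

(** [f] and its mirror image have disjoint supports. The cases c = 1 and c = -1 serve the even
    function with its x-derivatives and the odd y-derivative. *)
Lemma refl_norm (F f : space -> R) (c : R) z : vanish (half_space R N) f ->
  `|c| = 1 -> (forall z, F z = f z + c * f (refl z)) ->
  `|F z| = `|f z| + `|f (refl z)|.
Proof.
move=> f0 c1 ->; have /eqP := refl_orth z f0; rewrite mulf_eq0 => /orP[] /eqP ->.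
  by rewrite normr0 !add0r normrM c1 mul1r.
by rewrite mulr0 normr0 !addr0.
Qed.

Lemma mass_refl (F f : space -> R) (c : R) : L2 f -> L2 F ->
  vanish (half_space R N) f -> `|c| = 1 ->
  (forall z, F z = f z + c * f (refl z)) -> mass F = 2 * mass f.
Proof.
move=> Lf LF f0 c1 E.
have Lr : L2 (f \o refl) by exact: L2_affine.
have := mass_add_eq (c := 0) Lf Lr LF Lf.
rewrite mul0r addr0 mass_affine ?j1 ?mul1r//; last exact: L2_measurable.
move=> <-; first by ring.
move=> z; rewrite mul0r addr0 -[RHS]real_normK ?num_real// (refl_norm z f0 c1 E).
rewrite -[LHS](_ : `|f z| ^+ 2 + `|f (refl z)| ^+ 2 = _); last by rewrite !real_normK ?num_real.
have := refl_orth z f0; move=> /(congr1 Num.norm); rewrite normr0 normrM => h.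
by rewrite sqrrD h mul0rn addr0.
Qed.

Lemma Pint_refl (F f : space -> R) (c : R) : L2 f ->
  vanish (half_space R N) f -> `|c| = 1 ->
  (forall z, F z = f z + c * f (refl z)) -> Pint p F = (2%:E * Pint p f)%E.
Proof.
move=> Lf f0 c1 E; have Lr : L2 (f \o refl) by exact: L2_affine.
have -> : (2%:E * Pint p f = Pint p f + Pint p (f \o refl))%E.
  rewrite Pint_affine ?j1 ?mul1e//; last exact: L2_measurable.
  by rewrite mule_natl mule2n.
rewrite /Pint -ge0_integralD//.
- apply: eq_integral => z _; rewrite -EFinD; congr EFin.
  rewrite (refl_norm z f0 c1 E); have p0 : p != 0 by rewrite gt_eqF// crit_exp_gt0.
  have /eqP := refl_orth z f0; rewrite mulf_eq0 /= => /orP[] /eqP ->.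
    by rewrite normr0 add0r powR0// add0r.
  by rewrite normr0 addr0 powR0// addr0.
- exact: (measurable_Pint p (L2_measurable Lf)).
- exact: (measurable_Pint p (L2_measurable Lr)).
Qed.

Definition evenf f : space -> R := fun z => f z + f (refl z).

Definition even_grad Du : gradient R N :=
  Gradient (fun i => evenf (grad_x Du i))
    (fun z => grad_y Du z - grad_y Du (refl z)).

(** The reflection is moved to the test function by a change of variables, where c = 1 or c = -1 is
    the eigenvalue of the reflection in the direction v. *)
Lemma wd_refl Om (v : space) (c : R) u g phi : L2 u -> L2 g ->
  linpart 1 (-1) v = c *: v -> c ^+ 2 = 1 -> test_function Om phi ->
  wd v u g (fun z => phi z + c * phi (refl z)) ->
  wd v (evenf u) (fun z => g z + c * g (refl z)) phi.
Proof.
move=> Lu Lg cv c2 tphi; have [Lphi LD] := test_function_L2 tphi.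
have dphi := test_function_differentiable tphi.
pose h1 z := u z * 'D_v phi z + g z * phi z.
pose h3 z := u z * 'D_v phi (refl z) + c * (g z * phi (refl z)).
have ih1 : vol.-integrable setT (EFin \o h1) := wd_integrable v Lu Lg tphi.
have ih3 : vol.-integrable setT (EFin \o h3).
  have a1 := L2_integrableM Lu (L2_affine 0 i1 n1 (LD v)).
  have a2 := L2_integrableM Lg (L2_affine 0 i1 n1 Lphi).
  exact: (integrableD measurableT a1 (integrableZl measurableT c a2)).
have mh3 : measurable_fun setT h3.
  by apply/measurable_EFinP; exact: measurable_int ih3.
have E3 : \int[vol]_z h3 (refl z) = \int[vol]_z h3 z.
  rewrite (@Rintegral_affine _ _ 1 (-1) 0 h3)//.
  by rewrite -[X in X * _]/(jac 1 (-1)) j1 mul1r.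
have ih3r : vol.-integrable setT (EFin \o (h3 \o refl)).
  have b1 := L2_integrableM (L2_affine 0 i1 n1 Lu) (LD v).
  have b2 := L2_integrableM (L2_affine 0 i1 n1 Lg) Lphi.
  have := integrableD measurableT b1 (integrableZl measurableT c b2).
  apply: eq_integrable => // z _ /=.
  by rewrite -/(refl z) /h3 reflK EFinD EFinM.
rewrite /wd => W.
transitivity (\int[vol]_z h1 z + \int[vol]_z h3 z).
  rewrite -E3 -RintegralD//; apply: eq_Rintegral => z _.
  by rewrite /h1 /h3 /evenf reflK; ring.
rewrite -RintegralD// -[RHS]W; apply: eq_Rintegral => z _.
have dr z' : differentiable (phi \o refl) z'.
  by apply: differentiable_comp; [exact: differentiable_affine|exact: dphi].
have -> : 'D_v (fun z => phi z + c * phi (refl z)) z =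
    'D_v phi z + c * 'D_v (phi \o refl) z.
  rewrite deriveD; last 2 first.
  - exact/diff_derivable.
  - by apply: derivableZ; exact/diff_derivable.
  by congr (_ + _); apply: deriveZ; exact/diff_derivable.
rewrite derive_affine cv derive_scale// mulrA -expr2 c2 mul1r /h1 /h3; ring.
Qed.

Lemma L2_evenf (c : R) f : L2 f -> L2 (fun z => f z + c * f (refl z)).
Proof.
move=> Lf; apply: L2D => //.
by apply: (@L2_Mbounded R N _ (fun=> c) `|c|) => //; exact: (L2_affine 0 i1 n1 Lf).
Qed.

Lemma H1_even u Du : H1 (half_space R N) u Du ->
  H1 (whole_space R N) (evenf u) (even_grad Du).
Proof.
move=> hu; have [[Lu Lx Ly _ _] _] := hu.
have evE f : evenf f = fun z => f z + 1 * f (refl z).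
  by apply/funext => z; rewrite mul1r.
have odE f : (fun z => f z - f (refl z)) = fun z => f z + (-1) * f (refl z).
  by apply/funext => z; rewrite mulN1r.
have tpsi (c : R) phi : test_function (whole_space R N) phi ->
    test_function (whole_space R N) (fun z => phi z + c * phi (refl z)).
  move=> tphi; apply: (test_functionD tphi).
  apply: (test_function_mulT (smooth_cst c)).
  exact: (test_function_sub (@subsetT _ _) (test_function_affine 0 i1 n1 tphi)).
split; last by split=> [z []|i z []|z []].
split=> /=.
- by rewrite evE; exact: L2_evenf.
- by move=> i; rewrite evE; exact: L2_evenf.
- by rewrite odE; exact: L2_evenf.
- move=> i phi tphi; rewrite [evenf (grad_x _ _)]evE.
  apply: (@wd_refl (whole_space R N)) => //.
  + by rewrite scale1r /linpart /dir_x /= scale1r mulr0.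
  + by rewrite expr1n.
  + apply: (wd_x_above (rho := idfun)) (tpsi 1 _ tphi) => //; exact: smooth_idfun.
- move=> phi tphi; rewrite odE.
  apply: (@wd_refl (whole_space R N)) => //.
  + by rewrite scaleN1r /linpart /dir_y /= scale1r mulr1; congr pair; rewrite oppr0.
  + by rewrite sqrrN expr1n.
  (* The test function phi(x, y) - phi(x, -y) is at most C times the distance 2y between its two
     arguments, whence the constant 2 C. *)
  + have [C C0 HC] := test_function_lipschitz tphi.
    apply: (wd_y_above (rho := idfun) (C := 2 * C)) (tpsi (-1) _ tphi) _ => //.
      exact: smooth_idfun.
    move=> z; rewrite /above /= => z0.
    rewrite derive1_id mul1r mulN1r reflE.
    have := HC z.1 z.2 (- z.2); rewrite -surjective_pairing => /le_trans; apply.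
    by rewrite opprK ger0_norm ?addr_ge0 ?(ltW z0)// le_eqVlt; apply/orP; left; apply/eqP; ring.
Qed.

(** Even reflection doubles the critical integral, the energy and the mass; the doubled mass to the
    power s leaves the factor 2^s. *)
Lemma K_half_le_whole (k : R) : (K_domain (whole_space R N) <= k%:E)%E ->
  (K_domain (half_space R N) <= (2 `^ s * k)%:E)%E.
Proof.
move=> /K_domain_le Kk; apply/K_domain_le => u Du hu mu.
have [[Lu Lx Ly _ _] [u0 gx0 gy0]] := hu.
have he := H1_even hu; have [[Le Lxe Lye _ _] _] := he.
have mE : mass (evenf u) = 2 * mass u.
  by apply: (mass_refl Lu Le u0 (normr1 R)) => z; rewrite mul1r.
have eE : energy (even_grad Du) = 2 * energy Du.
  rewrite /energy mulrDr mulr_sumr; congr (_ + _).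
    apply: eq_bigr => i _; apply: (mass_refl (Lx i) (Lxe i) (gx0 i) (normr1 R)) => z.
    by rewrite mul1r.
  apply: (mass_refl (c := -1) Ly Lye gy0) => [|z]; first by rewrite normrN normr1.
  by rewrite mulN1r.
have PE : Pint p (evenf u) = (2%:E * Pint p u)%E.
  by apply: (Pint_refl Lu u0 (normr1 R)) => z; rewrite mul1r.
have := Kk _ _ he; rewrite mE mulr_gt0// => /(_ isT).
rewrite /GN_bound PE mE eE !mul0r !addr0 -lee_pdivlMl// => /le_trans; apply.
rewrite -EFinM lee_fin powRM ?(ltW mu)// le_eqVlt; apply/orP; left; apply/eqP.
by field.
Qed.

End reflection.

(** * Cutting a function along a hyperplane into halves of equal mass *)

Section splitting.
Context {R : realType} {N : nat}.
Local Notation space := ('rV[R]_N * measurableTypeR R)%type.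
Local Notation vol := (vol R N).
Local Notation p := (crit_exp R N).
Local Notation s := (2 / N.+1%:R : R).
Implicit Types (u g f : space -> R) (Om : set space) (Du : gradient R N).
Local Notation restr Om := (fun u => u \_ Om).

(* [sigma] is 1 or -1. *)
Definition side (sigma t : R) : set space := [set z | 0 < sigma * (z.2 - t)].

Lemma measurable_side sigma t : measurable (side sigma t).
Proof.
have mf : measurable_fun setT (fun z : space => sigma * (z.2 - t)).
  by apply: measurable_smooth (fun y : R => sigma * (y - t)) _;
    apply: smoothM; [exact: smooth_cst|apply: smoothD; [exact: smooth_id|exact: smooth_cst]].
have := mf measurableT _ (measurable_itv `]0, +oo[).
rewrite setTI (_ : _ @^-1` _ = side sigma t)//.
by apply/seteqP; split=> z; rewrite /side /= in_itv/= andbT.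
Qed.

Lemma in_side1 t (z : space) : (z \in side 1 t) = (t < z.2).
Proof. by apply/idP/idP; rewrite inE /side /= mul1r subr_gt0. Qed.

Lemma in_sideN t (z : space) : (z \in side (-1) t) = (z.2 < t).
Proof. by apply/idP/idP; rewrite inE /side /= mulN1r opprB subr_gt0. Qed.

Lemma mass_restrict_cvg u (D : nat -> set space) (E : set space) : L2 u ->
  (forall n, measurable (D n)) -> measurable E ->
  {ae vol, forall z, \forall n \near \oo, (z \in D n) = (z \in E)} ->
  mass (u \_ (D n)) @[n --> \oo] --> mass (u \_ E).
Proof.
move=> Lu mD mE DE.
have [|||||_ _ H] := @dominated_convergence _ _ _ vol setT measurableT
   (fun n z => (((u \_ (D n)) z) ^+ 2)%:E) (fun z => (((u \_ E) z) ^+ 2)%:E)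
   (EFin \o (fun z => u z ^+ 2)).
- move=> n; apply/measurable_EFinP; apply: measurable_funX.
  by apply: L2_measurable; exact: L2_restrict.
- by apply/measurable_EFinP; apply: measurable_funX; apply: L2_measurable; exact: L2_restrict.
- apply: filterS DE => z DE _; apply: cvg_near_cst.
  by apply: filterS DE => n nE; rewrite !restrE nE.
- exact: L2_integrable_sqr.
- apply: aeW => z n _; rewrite lee_fin ger0_norm ?sqr_ge0// restrE.
  by case: ifP => // _; rewrite expr0n sqr_ge0.
have E1 n : (\int[vol]_z ((u \_ (D n)) z ^+ 2)%:E = (mass (u \_ (D n)))%:E)%E.
  by apply: massE; exact: L2_restrict.
have E2 : (\int[vol]_z ((u \_ E) z ^+ 2)%:E = (mass (u \_ E))%:E)%E.
  by apply: massE; exact: L2_restrict.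
move: H; rewrite E2; under eq_fun do rewrite E1.
by move/fine_cvg.
Qed.

Lemma ge0_integral_side t f : measurable_fun setT f -> (forall z, 0 <= f z) ->
  (\int[vol]_z ((f \_ (side 1 t)) z)%:E + \int[vol]_z ((f \_ (side (-1) t)) z)%:E =
   \int[vol]_z (f z)%:E)%E.
Proof.
move=> mf f0.
have mr sigma : measurable_fun setT (f \_ (side sigma t)).
  by apply/(measurable_restrictT _ (measurable_side _ _)); exact: measurable_funTS.
have r0 sigma z : (0 <= ((f \_ (side sigma t)) z)%:E)%E.
  by rewrite lee_fin restrE; case: ifP.
rewrite -ge0_integralD//; try exact/measurable_EFinP.
apply: ge0_ae_eq_integral => //.
- by apply: emeasurable_funD; exact/measurable_EFinP.
- exact/measurable_EFinP.
- by move=> z _; rewrite adde_ge0.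
- by move=> z _; rewrite lee_fin.
- apply: filterS (ae_off_hyperplane t) => z zt _.
  rewrite -EFinD !restrE in_side1 in_sideN.
  have [h|h|h] := ltgtP (z.2 : R) t; rewrite ?addr0 ?add0r//; by case: (zt h).
Qed.

Lemma mass_split t f : L2 f ->
  mass (f \_ (side 1 t)) + mass (f \_ (side (-1) t)) = mass f.
Proof.
move=> Lf; apply: EFin_inj; rewrite EFinD -!massE//; last 2 first.
- by apply: L2_restrict => //; exact: measurable_side.
- by apply: L2_restrict => //; exact: measurable_side.
rewrite -(@ge0_integral_side t (fun z => f z ^+ 2)).
- by congr (_ + _)%E; apply: eq_integral => z _; rewrite !restrE; case: ifP => // _;
    rewrite expr0n.
- by apply: measurable_funX; exact: L2_measurable.
- by move=> z; rewrite sqr_ge0.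
Qed.

Lemma Pint_split t f : L2 f ->
  (Pint p (f \_ (side 1 t)) + Pint p (f \_ (side (-1) t)) = Pint p f)%E.
Proof.
move=> Lf; rewrite /Pint -(@ge0_integral_side t (fun z => `|f z| `^ p)).
- by congr (_ + _)%E; apply: eq_integral => z _; rewrite !restrE; case: ifP => // _;
    rewrite normr0 powR0// gt_eqF// crit_exp_gt0.
- by apply/measurable_EFinP; apply: measurable_Pint; exact: L2_measurable.
- by move=> z; rewrite powR_ge0.
Qed.

(** The mass above the level t is continuous in t, because hyperplanes are null sets, and it runs
    from [mass u] to 0; the intermediate value theorem gives t. *)
Lemma half_mass_level u : L2 u -> 0 < mass u -> exists t,
  mass (u \_ (side 1 t)) = mass u / 2 /\ mass (u \_ (side (-1) t)) = mass u / 2.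
Proof.
move=> Lu m0; pose G t := mass (u \_ (side 1 t)).
suff [t Gt] : exists t, G t = mass u / 2.
  exists t; split=> //; have := mass_split t Lu; rewrite -/(G t) Gt => h; lra.
have seqG (t : R) (tn : nat -> R) : tn n @[n --> \oo] --> t ->
    G (tn n) @[n --> \oo] --> G t.
  move=> tnt; apply: mass_restrict_cvg => //.
  - by move=> n; exact: measurable_side.
  - exact: measurable_side.
  - apply: filterS (ae_off_hyperplane t) => z zt.
    have [tz|tz|tz] := ltgtP t z.2; last by case: (zt (esym tz)).
      apply: filterS (cvgr_lt _ tnt _ tz) => n h.
      by rewrite !in_side1 h tz.
    apply: filterS (cvgr_gt _ tnt _ tz) => n h.
    by rewrite !in_side1 !ltNge (ltW h) (ltW tz).
have contG : continuous G.
  move=> t; apply/left_right_continuousP; split.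
    by apply/cvg_at_leftP => tn [_ /seqG].
  by apply/cvg_at_rightP => tn [_ /seqG].
have G0 : G n%:R @[n --> \oo] --> (0 : R).
  rewrite [X in _ --> X](_ : 0 = mass (u \_ set0)); last first.
    rewrite /mass /Rintegral integral0_eq// => z _.
    by rewrite restrE in_set0 expr0n.
  apply: mass_restrict_cvg => //; first by move=> n; exact: measurable_side.
  apply: aeW => z; near=> n; rewrite in_side1 in_set0; apply/negbTE; rewrite -leNgt.
  near: n; exact: nbhs_infty_ger.
have Gm : G (- n%:R) @[n --> \oo] --> mass u.
  have uT : u \_ setT = u by rewrite restr_id// => z [].
  rewrite -[in X in _ --> X]uT; apply: mass_restrict_cvg => //.
    by move=> n; exact: measurable_side.
  apply: aeW => z; near=> n; rewrite in_side1 in_setT ltrNl.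
  near: n; exact: nbhs_infty_gtr.
have m2 : 0 < mass u / 2 < mass u by apply/andP; split; lra.
have : \forall n \near \oo, G n%:R < mass u / 2 /\ mass u / 2 < G (- n%:R).
  move/andP: m2 => [m2 m2']; near=> n; split; near: n.
    exact: (cvgr_lt _ G0).
  exact: (cvgr_gt _ Gm).
move=> [n _ /(_ n (leqnn n)) [h1 h2]].
have nn : - n%:R <= n%:R :> R by rewrite -subr_ge0 opprK addr_ge0.
have [||t _ Gt] := @IVT R G (- n%:R) n%:R (mass u / 2) nn.
- exact: continuous_subspaceT.
- by rewrite ge_min le_max (ltW h1) (ltW h2) orbT.
by exists t.
Unshelve. all: by end_near.
Qed.

Let i1 : (1 : R) != 0. Proof. exact: oner_neq0. Qed.

Lemma GN_side (sigma t k : R) u Du : sigma ^+ 2 = 1 -> H1 (whole_space R N) u Du ->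
  (K_domain (half_space R N) <= k%:E)%E -> 0 < mass (u \_ (side sigma t)) ->
  GN_bound 0 k (u \_ (side sigma t)) (map_grad (restr (side sigma t)) Du).
Proof.
move=> s2 hu /K_domain_le Kk mu.
have [[Lu Lx Ly _ _] _] := hu.
have ns : `|sigma| = 1.
  by apply/eqP; rewrite -(@eqrXn2 _ 2)// expr1n real_normK ?num_real// s2.
have s0 : sigma != 0 by rewrite -normr_gt0 ns.
have ss : sigma^-1 = sigma by rewrite -[LHS]mul1r -s2 expr2 mulfK.
(* affine 1 sigma t maps the half-space onto the side. *)
pose T : space -> space := affine 1 sigma t.
have jT : jac (N := N) (1 : R) sigma = 1 by rewrite /jac ns normr1 expr1n mulr1 invr1.
have E f : (f \o T) \_ (half_space R N) = (f \_ (side sigma t)) \o T.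
  apply/funext => z; rewrite /= !restrE.
  rewrite (_ : (T z \in side sigma t) = (z \in half_space R N)) //.
  have e : sigma * (sigma * z.2 + t - t) = z.2 by rewrite addrK mulrA -expr2 s2 mul1r.
  by apply/idP/idP; rewrite !inE /side /half_space /T /affine /= e.
have LD f : L2 f -> L2 (f \_ (side sigma t)).
  by apply: L2_restrict; exact: measurable_side.
have mE f : L2 f -> mass ((f \o T) \_ (half_space R N)) = mass (f \_ (side sigma t)).
  move=> Lf; rewrite E mass_affine ?jT ?mul1r//.
  exact: L2_measurable (LD _ Lf).
have hv : H1 (half_space R N) ((u \o T) \_ (half_space R N))
    (map_grad (restr (half_space R N)) (affine_grad 1 sigma t Du)).
  apply: (H1_restrict (Om := whole_space R N)) => //; first exact: measurable_half.
  exact: (H1_affine t i1 s0 hu).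
apply: GN_bound_eq (Kk _ _ hv _); last by rewrite mE.
- rewrite E Pint_affine ?jT ?mul1e//; exact: L2_measurable (LD _ Lu).
- exact: mE.
- have Lc (c : R) f : L2 f -> L2 (fun z => c * f z).
    by move=> Lf; apply: (@L2_Mbounded R N f (fun=> c) `|c|).
  have restrZ (c : R) f D : (fun z => c * f z) \_ D = (fun z => c * (f \_ D) z).
    by apply/funext => z; rewrite !restrE; case: ifP; rewrite ?mulr0.
  have Lr f : L2 f -> L2 ((f \o T) \_ (half_space R N)).
    move=> Lf; apply: L2_restrict; first exact: measurable_half.
    exact: L2_affine.
  rewrite /energy /=; congr (_ + _).
    apply: eq_bigr => i _.
    rewrite (restrZ 1 (grad_x Du i \o T)) mass_scale; last exact: Lr.
    by rewrite expr1n mul1r mE.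
  rewrite (restrZ sigma (grad_y Du \o T)) mass_scale; last exact: Lr.
  by rewrite s2 mul1r mE.
Qed.

Lemma energy_split t Du : (forall i, L2 (grad_x Du i)) -> L2 (grad_y Du) ->
  energy (map_grad (restr (side 1 t)) Du) + energy (map_grad (restr (side (-1) t)) Du) =
  energy Du.
Proof.
move=> Lx Ly; rewrite /energy addrACA -big_split /= mass_split//; congr (_ + _).
by apply: eq_bigr => i _; exact: mass_split.
Qed.

(** Both pieces have mass m/2, so the two bounds share the factor (m/2)^s and their energies simply
    add up. This reverses the reflection inequality with the same constant. *)
Lemma K_whole_le_half (k : R) : (K_domain (half_space R N) <= k%:E)%E ->
  (K_domain (whole_space R N) <= ((2 `^ s)^-1 * k)%:E)%E.
Proof.
move=> Kk; apply/K_domain_le => u Du hu mu.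
have [[Lu Lx Ly _ _] _] := hu.
have [t [t1 t2]] := half_mass_level Lu mu.
have m2 : 0 < mass u / 2 by rewrite divr_gt0.
have G1 : GN_bound 0 k (u \_ (side 1 t)) (map_grad (restr (side 1 t)) Du).
  by apply: GN_side => //; rewrite ?expr1n ?t1.
have G2 : GN_bound 0 k (u \_ (side (-1) t)) (map_grad (restr (side (-1) t)) Du).
  by apply: GN_side => //; rewrite ?sqrrN ?expr1n ?t2.
move: G1 G2; rewrite /GN_bound !mul0r !addr0 t1 t2 => G1 G2.
rewrite -(Pint_split t Lu); apply: le_trans (leeD G1 G2) _.
rewrite -EFinD lee_fin -mulrDr -mulrDl energy_split//.
rewrite powRM ?(ltW mu)// ?invr_ge0// le_eqVlt; apply/orP; left; apply/eqP.
have -> : (2^-1 : R) `^ s = (2 `^ s)^-1.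
  by rewrite -[2^-1]powR_inv1// -powRrM mulN1r powRN.
by field; rewrite gt_eqF// powR_gt0.
Qed.

End splitting.

(** Infinite values are included: +oo has no real upper bound, and every real number bounds -oo. *)
Lemma ereal_le_ext (R : realType) (x y : \bar R) :
  (forall k : R, (x <= k%:E)%E <-> (y <= k%:E)%E) -> x = y.
Proof.
case: x y => [x| |] [y| |] H //.
- congr EFin; apply/eqP; rewrite eq_le; have /= := H y; rewrite !lee_fin lexx => -[_ ->//].
  by have /= := H x; rewrite !lee_fin lexx => -[->].
- by have [/(_ (lexx _))] := H x.
- have [_ /(_ (leNye _))] := H (x - 1)%R; rewrite lee_fin => h; exfalso; lra.
- by have [_ /(_ (lexx _))] := H y.
- by have [_ /(_ (leNye _))] := H 0.
- have [/(_ (leNye _))] := H (y - 1)%R; rewrite lee_fin => h; exfalso; lra.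
- by have [/(_ (leNye _))] := H 0.
Qed.

Theorem proposition4p11 (R : realType) (N : nat) (hN : (1 <= N)%N) :
  [/\ K_cylinder N (- pi) pi B @[B --> +oo%R] --> K_domain (whole_space R N),
      K_segment N 0 pi B @[B --> +oo%R] --> K_domain (half_space R N) &
      K_domain (half_space R N) =
        ((2 `^ (2 / N.+1%:R))%:E * K_domain (whole_space R N))%E].
Proof.
have pp := pi_gt0 R.
split.
- have Q0 : 0 < (pi - - pi : R) ^+ 2 by rewrite exprn_gt0// opprK addr_gt0.
  (* The two constants coincide as soon as B >= (2 pi)^2 / 4. *)
  apply: cvg_near_cst; near=> B.
  have B0 : 0 <= B by near: B; exact: nbhs_pinfty_ge.
  apply: ereal_le_ext => k; split; first exact: K_whole_le_cylinder.
  apply: K_cylinder_le_whole => //.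
  by rewrite ler_pdivlMr//; near: B; exact: nbhs_pinfty_ge.
- have Q0 : 0 < (pi - 0 : R) ^+ 2 by rewrite exprn_gt0// subr0.
  apply: cvg_near_cst; near=> B.
  have B0 : 0 <= B by near: B; exact: nbhs_pinfty_ge.
  apply: ereal_le_ext => k; split; first exact: K_half_le_segment.
  apply: K_segment_le_half => //.
  by rewrite ler_pdivlMr//; near: B; exact: nbhs_pinfty_ge.
- have c0 : 0 < 2 `^ (2 / N.+1%:R) :> R by exact: powR_gt0.
  apply: ereal_le_ext => k; rewrite -lee_pdivlMl// -EFinM; split.
    exact: K_whole_le_half.
  move=> /K_half_le_whole; rewrite mulrA divff ?mul1r// gt_eqF//.
Unshelve. all: by end_near.
Qed.
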